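(* Let $V_h=P_k(\mathcal M)$, $Y$, $E_h:V_h\to\mathbb R\cup\{+\infty\}$ and $E_h^*:Y\to\mathbb R\cup\{-\infty\}$ be the discrete primal space, the (infinite-dimensional) dual space, the discrete energy and the discrete dual energy of the local discontinuous Galerkin method defined in the context. Then $$\sup_{\tau\in Y}E_h^*(\tau)\le\min_{v_h\in V_h}E_h(v_h).$$ If, in addition, $W\in C^1(\mathbb R^n)$, and $\psi_h(x,\cdot)\in C^1(\mathbb R)$ for a.e. $x\in\Omega$ with $\partial_u\psi_h(\cdot,v_h)\in P_k(\mathcal M)$ for every $v_h\in P_k(\mathcal M)$ (here $\partial_u$ is the derivative in the second variable), then the supremum is attained and there is no discrete duality gap: $$\max_{\tau\in Y}E_h^*(\tau)=\min_{v_h\in V_h}E_h(v_h).$$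
   Context: **Domain and mesh.** $\Omega\subset\mathbb R^n$ is an open bounded polyhedral Lipschitz domain, $\Gamma_D\subset\partial\Omega$ is compact with positive surface measure, $\Gamma_N=\partial\Omega\setminus\Gamma_D$, $1<p<\infty$, $p'=p/(p-1)$. $\mathcal M$ is a finite collection of closed polytopes of positive volume, with overlaps of measure zero, covering $\overline\Omega$. $\mathcal F$ is a finite collection of faces (closed connected subsets of hyperplanes with positive $(n-1)$-dimensional measure, each contained either in $K_+\cap K_-$ for two distinct cells $K_\pm\in\mathcal M$ (interior face) or in $K_+\cap\partial\Omega$ (boundary face)), with overlaps of surface measure zero, covering the skeleton $\partial\mathcal M=\bigcup_{K\in\mathcal M}\partial K$. $\mathcal F_D$ is the set of faces contained in $\Gamma_D$; $\mathcal F_N$ is the set of the remaining boundary faces. $h_S$ is the diameter of $S\in\mathcal F$. Each interior face $S$ has a fixed unit normal $\nu_S$, and $K_+$ (resp. $K_-$) is the adjacent cell whose outer normal on $S$ is $\nu_S$ (resp. $-\nu_S$); for boundary faces $\nu_S$ is the outer normal of $\Omega$. Jumps and averages: $[v]_S=v|_{K_+}-v|_{K_-}$, $\{v\}_S=(v|_{K_+}+v|_{K_-})/2$ on interior faces and $[v]_S=\{v\}_S=v|_{K_+}$ on boundary faces. $P_k(\mathcal M)$ is the space of piecewise polynomials of degree at most $k$; $\Pi_{\mathcal M}^{k}$ is the $L^2$ projection onto $P_k(\mathcal M)$ (componentwise for vector fields); $\nabla_{\rm pw}$, ${\rm div}_{\rm pw}$ are the piecewise gradient and divergence. **Discrete primal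 problem.** Fix $k\ge1$, $1<r<\infty$, $r'=r/(r-1)$, $s\in\mathbb R$, and $V_h=P_k(\mathcal M)$. The discrete gradient $\nabla_hv_h\in P_{k-1}(\mathcal M)^n$ of $v_h\in V_h$ is defined by $$\int_\Omega\nabla_hv_h\cdot\Phi\,dx=-\int_\Omega v_h\,{\rm div}_{\rm pw}\Phi\,dx+\sum_{S\in\mathcal F\setminus\mathcal F_D}\int_S\{v_h\}_S[\Phi]_S\cdot\nu_S\,ds\quad\text{for all }\Phi\in P_{k-1}(\mathcal M)^n.$$ $W\in C(\mathbb R^n)$ is convex; $\psi_h:\Omega\times\mathbb R\to\mathbb R\cup\{+\infty\}$ is measurable and $\psi_h(x,\cdot)$ is proper, lower semicontinuous and convex for a.e. $x\in\Omega$. With $$s_h(v_h;w_h)=\sum_{S\in\mathcal F\setminus\mathcal F_N}h_S^{-s}\int_S|[v_h]_S|^{r-2}[v_h]_S[w_h]_S\,ds,\qquad s_h(v_h)=s_h(v_h;v_h),$$ the discrete energy is $E_h(v_h)=\int_\Omega(W(\nabla_hv_h)+\psi_h(\cdot,v_h))\,dx+s_h(v_h)/r$. Standing assumption: $E_h$ is well defined with values in $\mathbb R\cup\{+\infty\}$ and attains a finite minimum on $V_h$. **Discrete dual problem.** $Y=\{(\tau_{\mathcal M},\tau_{\mathcal F})\in L^{p'}(\Omega)^n\times L^2(\partial\mathcal M):\tau_{\mathcal F}|_S=0\text{ for all }S\in\mathcal F_N\}$; write $\tau_S=\tau_{\mathcal F}|_S$. For $\tau\in Y$, ${\rm div}_h\tau\in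 P_k(\mathcal M)$ is defined by $$\int_\Omega{\rm div}_h\tau\,\phi\,dx=-\int_\Omega\tau_{\mathcal M}\cdot\nabla_{\rm pw}\phi\,dx+\sum_{S\in\mathcal F\setminus\mathcal F_N}\int_S\tau_S[\phi]_S\,ds\quad\text{for all }\phi\in P_k(\mathcal M).$$ With convex conjugates $W^*$ and $\psi_h^*(x,\cdot)$ (conjugate of $\psi_h(x,\cdot)$), $$E_h^*(\tau)=-\int_\Omega(W^*(\tau_{\mathcal M})+\psi_h^*(\cdot,{\rm div}_h\tau))\,dx-\gamma_h(\tau)/r',$$ $$\gamma_h(\tau)=\sum_{S\in\mathcal F\setminus\mathcal F_N}h_S^{s/(r-1)}\|\tau_S-\{\Pi_{\mathcal M}^{k-1}\tau_{\mathcal M}\}_S\cdot\nu_S\|_{L^{r'}(S)}^{r'}\in[0,\infty].$$ *)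

(* Defs.v *)
From HB Require Import structures.
From mathcomp Require Import all_boot all_order all_algebra.
(* The notations of mpoly clash with those of mathcomp-analysis, and its module
   Measure would shadow that of mathcomp-analysis if imported afterwards. *)
From mathcomp Require Import -(notations) mpoly.
From mathcomp Require Import all_classical all_reals all_analysis.
From mathcomp Require Import measurable_realfun.

Set Implicit Arguments.
Unset Strict Implicit.
Unset Printing Implicit Defensive.

Import Order.TTheory GRing.Theory Num.Theory.
Import numFieldNormedType.Exports.

Local Open Scope classical_set_scope.
Local Open Scope ring_scope.

(* As for tuples: the sigma-algebra generated by the coordinate functions. *)
Section measurable_rV.
Context {d : measure_display} {T : measurableType d} (n : nat).

Let coors : 'I_n -> 'rV[T]_n -> T := fun i x => x ord0 i.

Let rV_set0 : g_sigma_preimage coors set0.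
Proof. exact: sigma_algebra0. Qed.

Let rV_setC A : g_sigma_preimage coors A -> g_sigma_preimage coors (~` A).
Proof. exact: sigma_algebraC. Qed.

Let rV_bigcup (F : _^nat) : (forall i, g_sigma_preimage coors (F i)) ->
  g_sigma_preimage coors (\bigcup_i (F i)).
Proof. exact: sigma_algebra_bigcup. Qed.

HB.instance Definition _ := @isMeasurable.Build (measure_tuple_display d)
  'rV[T]_n (g_sigma_preimage coors) rV_set0 rV_setC rV_bigcup.

Lemma measurable_coord (i : 'I_n) :
  measurable_fun [set: 'rV[T]_n] (fun x => x ord0 i).
Proof.
move=> _ Y mY; rewrite setTI; apply: sub_sigma_algebra => /=.
rewrite -bigcup_seq/=; exists i => /=; first by rewrite mem_index_enum.
by exists Y => //; rewrite setTI.
Qed.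

Lemma measurable_fun_rV d1 (T1 : measurableType d1) (f : T1 -> 'rV[T]_n) :
  (forall i, measurable_fun [set: T1] (fun x => f x ord0 i)) ->
  measurable_fun [set: T1] f.
Proof.
move=> mf.
have sub : g_sigma_preimage (fun i => coors i \o f) `<=` measurable.
  apply: smallest_sub; first exact: sigma_algebra_measurable.
  rewrite -bigcup_seq; apply: bigcup_sub => i _ A [B mB <-].
  exact: (mf i measurableT B mB).
move=> _ A mA; apply: sub; rewrite g_sigma_preimage_comp.
by exists A.
Qed.

End measurable_rV.

Section lebesgue_rV.
Context {R : realType}.

Definition cons_rV n (p : measurableTypeR R * 'rV[R]_n) : 'rV[R]_n.+1 :=
  row_mx (p.1)%:M p.2 : 'rV[R]_(1 + n).

Definition uncons_rV n (x : 'rV[R]_n.+1) : measurableTypeR R * 'rV[R]_n :=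
  ((x : 'rV[R]_(1 + n)) ord0 ord0, rsubmx (x : 'rV[R]_(1 + n))).

Lemma uncons_rVK n : cancel (@uncons_rV n) (@cons_rV n).
Proof.
move=> x; apply/rowP => i; rewrite /cons_rV /uncons_rV mxE.
case: splitP => j ij; rewrite mxE ?ord1 ?eqxx ?mulr1n /=.
  by congr (x _ _); apply/val_inj; rewrite /= ij ord1.
by congr (x _ _); apply/val_inj; rewrite /= ij.
Qed.

Lemma cons_rVK n : cancel (@cons_rV n) (@uncons_rV n).
Proof.
case=> t y; rewrite /cons_rV /uncons_rV row_mxKr; congr pair.
rewrite (_ : ord0 = lshift n ord0 :> 'I_(1 + n)); last exact/val_inj.
by rewrite row_mxEl mxE eqxx mulr1n.
Qed.

Lemma measurable_cons_rV n : measurable_fun setT (@cons_rV n).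
Proof.
apply: measurable_fun_rV => i.
have -> : (fun p : measurableTypeR R * 'rV[R]_n => cons_rV p ord0 i) =
    match fintype.split (i : 'I_(1 + n)) with
    | inl _ => fst
    | inr j => fun p => p.2 ord0 j
    end.
  apply/funext => p; rewrite /cons_rV mxE.
  by case: splitP => j _ //; rewrite mxE !ord1 eqxx mulr1n.
case: fintype.split => [_|j]; first exact: measurable_fst.
exact: (measurableT_comp (measurable_coord j) measurable_snd).
Qed.

Lemma measurable_uncons_rV n : measurable_fun setT (@uncons_rV n).
Proof.
apply/measurable_fun_pairP; split => /=; first exact: measurable_coord.
apply: measurable_fun_rV => i /=.
rewrite (_ : (fun _ => _) =
  fun x : 'rV[R]_n.+1 => x ord0 (rshift 1 i : 'I_(1 + n))).
  exact: measurable_coord.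
by apply/funext => x /=; rewrite mxE.
Qed.

Section lebesgue_cons.
Variables (n : nat) (mu : {sigma_finite_measure set 'rV[R]_n -> \bar R}).
Local Open Scope ereal_scope.

Definition lebesgue_cons : set 'rV[R]_n.+1 -> \bar R :=
  pushforward (@lebesgue_measure R \x mu) (@cons_rV n).

Definition lebesgue_cons_measure :=
  measure_function_pushforward__canonical__measure_function_Measure
    (@lebesgue_measure R \x mu) (@measurable_cons_rV n).

HB.instance Definition _ := isMeasure.Build _ _ _ lebesgue_cons
  (@measure0 _ _ _ lebesgue_cons_measure)
  (@measure_ge0 _ _ _ lebesgue_cons_measure)
  (@measure_semi_sigma_additive _ _ _ lebesgue_cons_measure).

Let lebesgue_cons_sigma_finite : sigma_finite setT lebesgue_cons.
Proof.
have /sigma_finiteP[F [TF ndF Foo]] := sigma_finiteT (@lebesgue_measure R).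
have /sigma_finiteP[G [TG ndG Goo]] := sigma_finiteT mu.
exists (fun k => @uncons_rV n @^-1` (F k `*` G k)).
  rewrite -preimage_bigcup (_ : \bigcup_k _ = setT) ?preimage_setT//.
  rewrite -setXTT TF TG predeqE => -[x y]; split.
    by move=> [k _ []/= ? ?]; split; exists k.
  move=> [/= [k _ Fkx] [l _ Gly]]; exists (maxn k l) => //; split.
  - by move: x Fkx; exact/subsetPset/ndF/leq_maxl.
  - by move: y Gly; exact/subsetPset/ndG/leq_maxr.
move=> k; have [? ?] := Foo k; have [? ?] := Goo k; split.
  rewrite -[X in measurable X]setTI; apply: measurable_uncons_rV => //.
  exact: measurableX.
rewrite /lebesgue_cons /pushforward -comp_preimage.
rewrite (_ : _ \o _ = id); last by apply/funext => p /=; rewrite cons_rVK.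
by rewrite preimage_id product_measure1E// lte_mul_pinfty// ge0_fin_numE.
Qed.

HB.instance Definition _ := Measure_isSigmaFinite.Build _ _ _
  lebesgue_cons lebesgue_cons_sigma_finite.

End lebesgue_cons.

Fixpoint lebesgue_rV n : {sigma_finite_measure set 'rV[R]_n -> \bar R} :=
  match n with
  | 0 => \d_(0 : 'rV[R]_0)
  | n'.+1 => lebesgue_cons (lebesgue_rV n')
  end.

End lebesgue_rV.

Section geometry.
Context {R : realType} {n : nat}.
Local Notation V := 'rV[R]_n.

Definition dot (x y : V) : R := \sum_i x ord0 i * y ord0 i.

Definition enorm (x : V) : R := Num.sqrt (dot x x).

Definition diam (A : set V) : R := sup [set enorm (x - y) | x in A & y in A].

Definition frontier (A : set V) : set V := closure A `\` A°.

(* The point of {x | dot nu x = c} whose coordinates other than i are y. *)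
Definition graph_pt (nu : V) (c : R) (i : 'I_n) (y : 'rV[R]_n.-1) : V :=
  \row_j if unlift i j is Some j' then y ord0 j'
         else (c - \sum_l nu ord0 (lift i l) * y ord0 l) / nu ord0 i.

Lemma measurable_graph_pt nu c i : measurable_fun setT (graph_pt nu c i).
Proof.
apply: measurable_fun_rV => j; under eq_fun do rewrite mxE.
case: unliftP => [k _|_]; first exact: measurable_coord.
apply: measurable_funM => //; apply: measurable_funB => //.
apply: measurable_sum => l; apply: measurable_funM => //.
exact: measurable_coord.
Qed.

Definition push_graph (nu : V) (c : R) (i : 'I_n) : set V -> \bar R :=
  pushforward (@lebesgue_rV R n.-1) (graph_pt nu c i).

Definition push_graph_measure nu c i :=
  measure_function_pushforward__canonical__measure_function_Measure
    (@lebesgue_rV R n.-1) (@measurable_graph_pt nu c i).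

HB.instance Definition _ nu c i := isMeasure.Build _ _ _ (push_graph nu c i)
  (@measure0 _ _ _ (push_graph_measure nu c i))
  (@measure_ge0 _ _ _ (push_graph_measure nu c i))
  (@measure_semi_sigma_additive _ _ _ (push_graph_measure nu c i)).

(* Surface measure on the hyperplane H = {x | dot nu x = c}, nu a unit vector,
   as a measure on R^n: H is the graph of an affine function g of the n - 1
   coordinates other than i, and ds = sqrt (1 + |grad g|^2) dx' with
   sqrt (1 + |grad g|^2) = |nu_i|^-1.  The measure does not depend on the
   choice of a coordinate i with nu_i != 0. *)
Definition hyperplane_measure (nu : V) (c : R) : {measure set V -> \bar R} :=
  if [pick i | nu ord0 i != 0] is Some i
  then mscale `|nu ord0 i|^-1%:nng (push_graph nu c i) else mzero.

Definition convex_hull (s : seq V) : set V :=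
  [set x | exists c : 'I_(size s) -> R, [/\ forall i, 0 <= c i,
     \sum_i c i = 1 & x = \sum_i c i *: s`_i]].

(* Not necessarily convex: a connected finite union of n-dimensional convex
   polytopes. *)
Definition polytope (K : set V) : Prop :=
  connected K /\ exists ss : seq (seq V),
    (forall s, s \in ss -> (convex_hull s)° !=set0) /\
    K = \bigcup_(s in [set` ss]) convex_hull s.

(* nu is the outer unit normal of A at x, where the frontier of A is flat. *)
Definition outer_normal_at (A : set V) (x nu : V) : Prop :=
  dot nu nu = 1 /\ \forall y \near x, A y <-> dot nu (y - x) <= 0.

(* Near each frontier point, Om is the set of points below the graph, over the
   hyperplane orthogonal to a unit vector e, of a Lipschitz function g. *)
Definition lipschitz_domain (Om : set V) : Prop :=
  [/\ open Om, connected Om, bounded_set Om, Om !=set0 &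
   forall x, frontier Om x -> exists (e : V) (g : V -> R) (L : R),
     [/\ dot e e = 1, forall y z, `|g y - g z| <= L * enorm (y - z) &
      \forall y \near x, Om y <-> dot y e < g (y - dot y e *: e)]].

Definition polyhedral_lipschitz_domain (Om : set V) : Prop :=
  lipschitz_domain Om /\ polytope (closure Om).

End geometry.

(* Kminus S is None iff S is a boundary face; the face S lies in the hyperplane
   {x | dot (normal S) x = offset S}. *)
Record mesh (R : realType) (n : nat) := Mesh {
  cellT : finType;
  faceT : finType;
  cell : cellT -> set 'rV[R]_n;
  face : faceT -> set 'rV[R]_n;
  normal : faceT -> 'rV[R]_n;
  offset : faceT -> R;
  Kplus : faceT -> cellT;
  Kminus : faceT -> option cellT }.

Section mesh.
Context {R : realType} {n : nat} (M : mesh R n).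
Local Notation V := 'rV[R]_n.
Local Notation leb := (@lebesgue_rV R n).

Definition surf (S : faceT M) : {measure set V -> \bar R} :=
  hyperplane_measure (normal S) (offset S).

Definition interior_face (S : faceT M) : bool := Kminus S != None.

Definition interior_face_spec (S : faceT M) (Kp Km : cellT M) : Prop :=
  [/\ Km <> Kp, face S `<=` cell Kp `&` cell Km,
   {ae surf S, forall x, face S x -> outer_normal_at (cell Kp) x (normal S)} &
   {ae surf S, forall x, face S x -> outer_normal_at (cell Km) x (- normal S)}].

Definition boundary_face_spec (Om : set V) (S : faceT M) (Kp : cellT M) :
    Prop :=
  face S `<=` cell Kp `&` frontier Om /\
  {ae surf S, forall x, face S x -> outer_normal_at (closure Om) x (normal S)}.

Definition is_mesh (Om : set V) : Prop :=
  [/\ [/\ forall K : cellT M, polytope (cell K),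
          forall K : cellT M, (0 < leb (cell K))%E,
          forall K L : cellT M, K != L -> leb (cell K `&` cell L) = 0%E &
          \bigcup_(K in [set: cellT M]) cell K = closure Om],
      [/\ forall S : faceT M, closed (face S) /\ connected (face S),
          forall S : faceT M, dot (normal S) (normal S) = 1 /\
            face S `<=` [set x | dot (normal S) x = offset S],
          forall S : faceT M, (0 < surf S (face S))%E,
          forall S T : faceT M, S != T -> surf S (face S `&` face T) = 0%E &
          \bigcup_(S in [set: faceT M]) face S =
            \bigcup_(K in [set: cellT M]) frontier (cell K)] &
      forall S : faceT M,
        if Kminus S is Some Km then interior_face_spec S (Kplus S) Km
        else boundary_face_spec Om S (Kplus S)].

(* The boundary faces cover the boundary of Om up to a null set, so that the
   sum is the surface measure of GammaD. *)
Definition dirichlet_boundary (Om GammaD : set V) : Prop :=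
  [/\ GammaD `<=` frontier Om, compact GammaD &
   (0 < \sum_(S : faceT M | ~~ interior_face S) surf S (face S `&` GammaD))%E].

Definition dirichlet_face (GammaD : set V) (S : faceT M) : bool :=
  `[< face S `<=` GammaD >].

Definition neumann_face (GammaD : set V) (S : faceT M) : bool :=
  ~~ interior_face S && ~~ dirichlet_face GammaD S.

(* Since cells have nonempty interior, a piecewise polynomial is determined by
   and identified with the family of its polynomials on the cells. *)
Definition pwpoly := cellT M -> mpoly n R.

(* msize p is the total degree plus one, and 0 for p = 0. *)
Definition P_ (k : nat) : set pwpoly :=
  [set v | forall K, (msize (v K) <= k.+1)%N].

Definition PV_ (k : nat) : set ('I_n -> pwpoly) :=
  [set F | forall i, P_ k (F i)].

Definition peval (p : mpoly n R) (x : V) : R := meval (fun i => x ord0 i) p.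

(* Well defined outside the overlaps of the cells, a null set. *)
Definition pweval (v : pwpoly) (x : V) : R :=
  if [pick K | `[< cell K x >]] is Some K then peval (v K) x else 0.

Definition pwevalV (F : 'I_n -> pwpoly) (x : V) : V := \row_i pweval (F i) x.

Definition grad_pw (v : pwpoly) : 'I_n -> pwpoly := fun i K => mderiv i (v K).

Definition div_pw (F : 'I_n -> pwpoly) : pwpoly :=
  fun K => \sum_i mderiv i (F i K).

Definition jump (S : faceT M) (v : pwpoly) (x : V) : R :=
  if Kminus S is Some Km then peval (v (Kplus S)) x - peval (v Km) x
  else peval (v (Kplus S)) x.

Definition avg (S : faceT M) (v : pwpoly) (x : V) : R :=
  if Kminus S is Some Km then (peval (v (Kplus S)) x + peval (v Km) x) / 2
  else peval (v (Kplus S)) x.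

Definition jumpV (S : faceT M) (F : 'I_n -> pwpoly) (x : V) : V :=
  \row_i jump S (F i) x.

Definition avgV (S : faceT M) (F : 'I_n -> pwpoly) (x : V) : V :=
  \row_i avg S (F i) x.

(* By orthogonality, which makes sense for every f in L^1, not only in L^2. *)
Definition is_L2_projection (Om : set V) (k : nat) (f : V -> R) (q : pwpoly) :
    Prop :=
  P_ k q /\ forall phi, P_ k phi ->
    (\int[leb]_(x in Om) (pweval q x * pweval phi x)) =
    \int[leb]_(x in Om) (f x * pweval phi x).

Definition L2_projection (Om : set V) (k : nat) (f : V -> R) : pwpoly :=
  xget (fun=> 0) [set q | is_L2_projection Om k f q].

Definition L2_projectionV (Om : set V) (k : nat) (f : V -> V) :
    'I_n -> pwpoly :=
  fun i => L2_projection Om k (fun x => f x ord0 i).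

End mesh.

Section convex.
Context {R : realType}.
Local Open Scope ereal_scope.

Definition econvex (f : R -> \bar R) : Prop :=
  forall (t u v : R), (0 <= t <= 1)%R ->
    f (t * u + (1 - t) * v)%R <= t%:E * f u + (1 - t)%:E * f v.

Definition conjugate {T : Type} (pairing : T -> T -> R) (f : T -> \bar R)
    (y : T) : \bar R :=
  ereal_sup [set (pairing y x)%:E - f x | x in [set: T]].

Definition C1_real (f : R -> \bar R) : Prop :=
  [/\ forall u, f u \is a fin_num,
      forall u, derivable (fine \o f : R -> R) u 1 &
      continuous (derive1 (fine \o f))].

Definition C1_rV {n : nat} (W : 'rV[R]_n -> R) : Prop :=
  (forall x, differentiable W x) /\
  forall i, continuous (fun x => 'D_(delta_mx ord0 i) W x).

Definition is_min {T : Type} (A : set T) (f : T -> \bar R) (m : \bar R) :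
    Prop :=
  (exists2 x, A x & f x = m) /\ forall x, A x -> m <= f x.

Definition is_max {T : Type} (A : set T) (f : T -> \bar R) (m : \bar R) :
    Prop :=
  (exists2 x, A x & f x = m) /\ forall x, A x -> f x <= m.

End convex.

Definition conj_exp {R : realType} (q : R) : R := q / (q - 1).

Section ldg.
Context {R : realType} {n : nat} (Om GammaD : set 'rV[R]_n) (M : mesh R n).
Variables (k : nat) (p r s : R).
Variables (W : 'rV[R]_n -> R) (psi : 'rV[R]_n -> R -> \bar R).
Local Notation V := 'rV[R]_n.
Local Notation leb := (@lebesgue_rV R n).

Definition is_discrete_gradient (v : pwpoly M) (G : 'I_n -> pwpoly M) : Prop :=
  PV_ k.-1 G /\ forall F, PV_ k.-1 F ->
    (\int[leb]_(x in Om) dot (pwevalV G x) (pwevalV F x)) =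
    - (\int[leb]_(x in Om) (pweval v x * pweval (div_pw F) x))
    + \sum_(S : faceT M | ~~ dirichlet_face GammaD S)
        \int[surf S]_(x in face S) (avg S v x * dot (jumpV S F x) (normal S)).

Definition discrete_gradient (v : pwpoly M) : 'I_n -> pwpoly M :=
  xget (fun _ _ => 0) [set G | is_discrete_gradient v G].

Definition s_h (v w : pwpoly M) : R :=
  \sum_(S : faceT M | ~~ neumann_face GammaD S)
    (diam (face S) `^ (- s) *
     (\int[surf S]_(x in face S)
        (`|jump S v x| `^ (r - 2) * jump S v x * jump S w x))).

Definition energy_density (v : pwpoly M) (x : V) : \bar R :=
  ((W (pwevalV (discrete_gradient v) x))%:E + psi x (pweval v x))%E.

Definition E_h (v : pwpoly M) : \bar R :=
  ((\int[leb]_(x in Om) energy_density v x) + (s_h v v / r)%:E)%E.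

(* The integral of the density is never of the form oo - oo nor -oo. *)
Definition E_h_well_defined : Prop :=
  forall v, P_ k v -> ((\int[leb]_(x in Om) (energy_density v)^\- x) < +oo)%E.

Definition in_Lp (mu : set V -> \bar R) (D : set V) (q : R) (f : V -> R) :
    Prop :=
  measurable_fun D f /\ ((\int[mu]_(x in D) (`|f x| `^ q)%:E) < +oo)%E.

(* tau.1 is tau_M, and the restriction of tau.2 to face S is tau_S; functions
   are not identified when they agree almost everywhere. *)
Definition Y : set ((V -> V) * (V -> R)) := [set tau : (V -> V) * (V -> R) |
  [/\ forall i : 'I_n, in_Lp leb Om (conj_exp p) (fun x => tau.1 x ord0 i),
      forall S : faceT M, in_Lp (surf S) (face S) 2 tau.2 &
      forall S : faceT M, neumann_face GammaD S ->
        {ae surf S, forall x, face S x -> tau.2 x = 0}]].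

Definition is_discrete_divergence (tau : (V -> V) * (V -> R)) (q : pwpoly M) :
    Prop :=
  P_ k q /\ forall phi, P_ k phi ->
    (\int[leb]_(x in Om) (pweval q x * pweval phi x)) =
    - (\int[leb]_(x in Om) dot (tau.1 x) (pwevalV (grad_pw phi) x))
    + \sum_(S : faceT M | ~~ neumann_face GammaD S)
        \int[surf S]_(x in face S) (tau.2 x * jump S phi x).

Definition discrete_divergence (tau : (V -> V) * (V -> R)) : pwpoly M :=
  xget (fun=> 0) [set q | is_discrete_divergence tau q].

Definition gamma_h (tau : (V -> V) * (V -> R)) : \bar R :=
  (\sum_(S : faceT M | ~~ neumann_face GammaD S)
    ((diam (face S) `^ (s / (r - 1)))%:E *
     (\int[surf S]_(x in face S)
        (`|tau.2 x - dot (avgV S (L2_projectionV Om k.-1 tau.1) x) (normal S)|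
          `^ conj_exp r)%:E)))%E.

Definition E_h_dual (tau : (V -> V) * (V -> R)) : \bar R :=
  (- (\int[leb]_(x in Om)
        (conjugate dot (EFin \o W) (tau.1 x) +
         conjugate *%R (psi x) (pweval (discrete_divergence tau) x)))
   - gamma_h tau * (conj_exp r)^-1%:E)%E.

(* Measurability for the product of the Lebesgue sigma-algebra of Om and the
   Borel sigma-algebra of R. *)
Definition psi_measurable : Prop := exists N : set V,
  [/\ measurable N, leb N = 0%E &
   measurable_fun ((Om `\` N) `*` [set: R]) (fun z : V * R => psi z.1 z.2)].

Definition psi_proper_lsc_convex : Prop :=
  {ae leb, forall x, Om x ->
    [/\ exists u, (psi x u < +oo)%E, lower_semicontinuous (psi x) &
        econvex (psi x)]}.

Definition psi_C1 : Prop := {ae leb, forall x, Om x -> C1_real (psi x)}.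

Definition psi_derivative_pwpoly : Prop :=
  forall v : pwpoly M, P_ k v -> exists2 q : pwpoly M, P_ k q &
    {ae leb, forall x, Om x ->
      derive1 (fine \o psi x) (pweval v x) = pweval q x}.

End ldg.

Arguments E_h {R n} Om GammaD M k r s W psi v.

(* Main.v *)
From mathcomp Require Import -(notations) mpoly.
Require Import Defs.
From mathcomp Require Import all_boot all_order all_algebra.
From mathcomp Require Import all_classical all_reals all_analysis.
From mathcomp Require Import measurable_realfun.
From mathcomp Require Import ring lra zify.

(** Weak duality rests on the identity, for v in V_h and tau in Y,
      int tau_M . grad_h v + int div_h tau v
        = sum_(S not in F_N) int_S (tau_S - {Pi tau_M}_S . nu_S) [v]_S,
    obtained by integrating by parts on each cell.  The Fenchel inequalities for
    W and psi_h on Om, and a weighted Young inequality on the faces, bound its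
    two sides by the energies.

    Under the smoothness assumptions these inequalities are equalities for a
    minimizer v and
      tau_M = DW (grad_h v),
      tau_S = {Pi tau_M}_S . nu_S - h_S^-s |[v]_S|^(r-2) [v]_S.
    That div_h tau = d_u psi_h (., v) is the Euler-Lagrange equation of v.  The
    first variation is obtained from the tangents at v + w / (j + 1), which lie
    below the energy at v, by dominated convergence as j tends to infinity: the
    terms d_u psi_h (., v + w / (j + 1)) w lie between their values at v and at
    v + w because psi_h is convex. *)

Set Implicit Arguments.
Unset Strict Implicit.
Unset Printing Implicit Defensive.

Import Order.TTheory GRing.Theory Num.Theory.
Import numFieldNormedType.Exports.

Local Open Scope classical_set_scope.
Local Open Scope ring_scope.

(** * Lebesgue measure on row vectors *)

(** Cells may be nonconvex and outer normals are known only almost everywhere on the faces. The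
    divergence theorem on a cell is therefore reduced to lines parallel to an axis: almost every
    such line meets the cell in a compact set with finitely many one-sided endpoints. The projection
    of tau_M appears because grad_h v has degree k - 1: under the integral, tau_M can be replaced by
    Pi tau_M, which is then an admissible test field in the definition of grad_h v. The conjugates
    of W and psi_h(x, .) are suprema over uncountable families, and their measurability is not
    established; integrals are compared through simple functions lying below the integrands. The
    exponent s / (r - 1) of h_S comes from Young's inequality with the weights h_S^(-s/r) and
    h_S^(s/r), whose product is one, since (s/r) r' = s / (r - 1). The same exponent makes gamma_h
    equal to s_h(v) at the optimal tau. In the passage to the limit the domination comes from the
    derivatives of psi_h along v and v + w being piecewise polynomials, hence bounded on Om. *)

Section insert_coordinate.
Context {R : realType} (n : nat).

(** [cons_rV] with the new entry at an arbitrary position, so that every axis can serve as the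
    direction of integration. *)
Definition ins_rV (i : 'I_n.+1) (p : measurableTypeR R * 'rV[R]_n) :
    'rV[R]_n.+1 :=
  \row_j if unlift i j is Some j' then p.2 ord0 j' else p.1.

Lemma ins_rV_lift i p j : ins_rV i p ord0 (lift i j) = p.2 ord0 j.
Proof. by rewrite mxE liftK. Qed.

Lemma ins_rV_id i p : ins_rV i p ord0 i = p.1.
Proof. by rewrite mxE unlift_none. Qed.

Lemma measurable_ins_rV i : measurable_fun setT (ins_rV i).
Proof.
apply: measurable_fun_rV => j; under eq_fun do rewrite mxE.
case: unliftP => [k _|_]; last exact: measurable_fst.
exact: (measurableT_comp (measurable_coord k) measurable_snd).
Qed.

Lemma measurable_ins_rV1 i t : measurable_fun setT (fun y => ins_rV i (t, y)).
Proof.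
apply: (measurableT_comp (measurable_ins_rV i)).
by apply: measurable_fun_pair => //; exact: measurable_cst.
Qed.

Lemma measurable_ins_rV2 i y : measurable_fun setT (fun t => ins_rV i (t, y)).
Proof.
apply: (measurableT_comp (measurable_ins_rV i)).
by apply: measurable_fun_pair => //; exact: measurable_cst.
Qed.

Lemma cons_rVE : @cons_rV R n = ins_rV ord0.
Proof.
apply/funext => p; apply/rowP => j; rewrite mxE.
case: splitP => k jk; rewrite [RHS]mxE.
  rewrite mxE (_ : j = ord0) ?unlift_none ?ord1 ?eqxx ?mulr1n//.
  by apply/val_inj; rewrite /= jk ord1.
by rewrite (_ : j = lift ord0 k) ?liftK//; exact/val_inj.
Qed.

End insert_coordinate.

Section lebesgue_insert.
Context {R : realType}.
Local Open Scope ereal_scope.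
Local Notation leb1 := (@lebesgue_measure R).
Local Notation leb := (@lebesgue_rV R _).

Lemma ins_rV_lift0 n (i : 'I_n.+1) (t u : R) (z : 'rV[R]_n) :
  ins_rV (lift ord0 i) (u, ins_rV ord0 (t, z)) =
  ins_rV ord0 (t, ins_rV i (u, z)).
Proof.
apply/rowP => j; case: (unliftP ord0 j) => [k ->|->].
  rewrite [RHS]ins_rV_lift /=; case: (unliftP i k) => [l ->|->].
    rewrite [RHS]ins_rV_lift /=.
    rewrite (_ : lift ord0 (lift i l) = lift (lift ord0 i) (lift ord0 l)).
      by rewrite ins_rV_lift [LHS]ins_rV_lift.
    by apply/val_inj; rewrite /= /bump /= !add1n ltnS addnS.
  by rewrite ins_rV_id ins_rV_id.
have e : ord0 = lift (lift ord0 i) ord0 by exact/val_inj.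
by rewrite [RHS]ins_rV_id /= [in LHS]e ins_rV_lift [LHS]ins_rV_id.
Qed.

Lemma lebesgue_rV_ins0 n (A : set 'rV[R]_n.+1) :
  leb A = (leb1 \x (@lebesgue_rV R n)) (ins_rV ord0 @^-1` A).
Proof. by rewrite -cons_rVE. Qed.

(* Conversion tests that unfold lebesgue_rV do not terminate in practice. *)
Opaque lebesgue_rV.

Lemma lebesgue_rVS n (A : set 'rV[R]_n.+1) : measurable A ->
  leb A = \int[leb1]_t leb ((fun y => ins_rV ord0 (t, y)) @^-1` A).
Proof.
move=> mA; rewrite lebesgue_rV_ins0; apply: eq_integral => t _ /=; congr (leb _); apply/seteqP; split => y /=.
  by rewrite /xsection/= inE.
by rewrite /xsection/= inE.
Qed.

(** The measure is built by splitting off coordinate 0. Any other coordinate can be split off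
    instead by induction on the slices and Tonelli's theorem. *)
Lemma lebesgue_rV_ins n (i : 'I_n.+1) (A : set 'rV[R]_n.+1) : measurable A ->
  leb A = (leb1 \x (@lebesgue_rV R n)) (ins_rV i @^-1` A).
Proof.
elim: n i A => [|n IH] i A mA.
  by rewrite ord1; exact: lebesgue_rV_ins0.
case: (unliftP ord0 i) => [j ->|->]; last first.
  exact: lebesgue_rV_ins0.
(* [h] inserts the coordinates 0 and [lift ord0 j] together; the two orders of integration of its
   slice measure [F] give the two sides. *)
pose h (p : (measurableTypeR R * measurableTypeR R) * 'rV[R]_n) :=
  ins_rV (lift ord0 j) (p.1.2, ins_rV ord0 (p.1.1, p.2)).
have mh : measurable_fun setT h.
  apply: (measurableT_comp (measurable_ins_rV _)).
  apply: measurable_fun_pair => /=.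
    exact: (measurableT_comp measurable_snd measurable_fst).
  apply: (measurableT_comp (measurable_ins_rV _)).
  apply: measurable_fun_pair => /=; last exact: measurable_snd.
  exact: (measurableT_comp measurable_fst measurable_fst).
have mhA : measurable (h @^-1` A) by rewrite -[X in measurable X]setTI; exact: mh.
pose F (p : measurableTypeR R * measurableTypeR R) :=
  leb ((fun z => h (p, z)) @^-1` A).
have mF : measurable_fun setT F.
  rewrite (_ : F = leb \o xsection (h @^-1` A)).
    exact: measurable_fun_xsection.
  by apply/funext => p /=; congr (leb _); apply/seteqP; split => z;
    rewrite /xsection /= inE.
have mins m (k : 'I_m.+1) (t : measurableTypeR R) B : measurable B ->
    measurable ((fun y => ins_rV k (t, y)) @^-1` B).
  by move=> mB; rewrite -[X in measurable X]setTI; exact: measurable_ins_rV1.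
transitivity (\int[leb1]_t \int[leb1]_u F (t, u)).
  rewrite lebesgue_rVS; last by [].
  apply: eq_integral => t _.
  rewrite (IH j); last exact: mins.
  apply: eq_integral => u _ /=; congr (leb _); apply/seteqP; split => z /=;
    by rewrite /xsection /= inE /h /= ins_rV_lift0.
rewrite fubini_tonelli; [|by []|by []].
apply: eq_integral => u _.
rewrite /=.
transitivity (leb ((fun y => ins_rV (lift ord0 j) (u, y)) @^-1` A)).
  rewrite lebesgue_rVS; last exact: mins.
  by apply: eq_integral => t _; congr (leb _).
by congr (leb _); apply/seteqP; split => z /=; rewrite /xsection /= inE.
Qed.

End lebesgue_insert.

Section rV_box.
Context {R : realType} {n : nat}.
Implicit Types (x a : 'rV[R]_n) (A : set 'rV[R]_n).

Lemma coord_le_norm x i : `|x ord0 i| <= `|x|.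
Proof.
rewrite {2}/Num.norm /= mx_normrE.
by apply/bigmax_geP; right => /=; exists (ord0, i).
Qed.

Lemma rV_norm_le x M : 0 <= M -> (forall i, `|x ord0 i| <= M) -> `|x| <= M.
Proof.
move=> M0 xM; rewrite /Num.norm /= mx_normrE.
by apply/bigmax_leP; split => // -[i j] _ /=; rewrite ord1.
Qed.

Definition box a (e : R) : set 'rV[R]_n :=
  [set x | forall i, `|x ord0 i - a ord0 i| < e].

Lemma ball_boxE x (e : R) : 0 < e -> ball x e = box x e.
Proof.
move=> e0; apply/seteqP; split=> y /=.
  by move=> [_ yx] i; rewrite distrC; exact: yx.
by move=> yx; split=> // i j; rewrite ord1 /ball/= distrC; exact: yx.
Qed.

Lemma nbhs_boxP x A : nbhs x A <-> exists2 e : R, 0 < e & box x e `<=` A.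
Proof.
split=> [/nbhs_ballP[e /= e0 xA]|[e e0 xA]].
  by exists e => //; rewrite -ball_boxE.
by apply/nbhs_ballP; exists e => //=; rewrite ball_boxE.
Qed.

Lemma measurable_box a e : measurable (box a e).
Proof.
rewrite (_ : box a e = \bigcap_(i in [set: 'I_n])
    ((fun x => x ord0 i) @^-1` [set t | `|t - a ord0 i| < e])).
  apply: fin_bigcap_measurable => // i _.
  rewrite -[X in measurable X]setTI; apply: measurable_coord => //.
  apply: open_measurable.
  rewrite (_ : [set _ | _] = ball (a ord0 i : R) e); first exact: ball_open.
  by apply/seteqP; split=> t /=; rewrite /ball/= distrC.
by apply/seteqP; split=> [x xa i _|x xa i]; [exact: xa|exact: (xa i)].
Qed.

(** The sigma-algebra is the one generated by the coordinates, so an open set is written as a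
    countable union of boxes with rational centres and radii 1 / (m + 1). *)
Lemma open_measurable_rV A : open A -> measurable A.
Proof.
move=> oA.
pose D := [set p : 'rV[rat]_n * nat |
  box (map_mx ratr p.1) (p.2.+1%:R^-1) `<=` A].
pose F (p : 'rV[rat]_n * nat) : set 'rV[R]_n :=
  if p \in D then box (map_mx ratr p.1) (p.2.+1%:R^-1) else set0.
rewrite (_ : A = \bigcup_p F p).
  apply: countable_bigcupT_measurable; first exact: countableP.
  by move=> p; rewrite /F; case: ifP => // _; exact: measurable_box.
apply/seteqP; split => [x Ax|x [p _]]; last first.
  by rewrite /F; case: ifPn => //; rewrite inE => Dp /Dp.
have /nbhs_boxP[e e0 xeA] : nbhs x A by exact: open_nbhs_nbhs.
(* One half of [e] is spent on the distance from [x] to the rational centre, the other on the radius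
   of the box around that centre. *)
have e20 : 0 < e / 2 by rewrite divr_gt0.
have [m _ em] := near_infty_natSinv_lt (PosNum e20).
have {}em := em m (leqnn m).
have q_ i : exists q : rat, `|ratr q - x ord0 i| < m.+1%:R^-1.
  have [q] : exists q, ratr q \in `](x ord0 i - m.+1%:R^-1), (x ord0 i + m.+1%:R^-1)[.
    by apply: rat_in_itvoo; rewrite ltrBlDr -addrA ltrDl addr_gt0.
  rewrite in_itv/= => qx; exists q; rewrite ltr_distl.
  by [].
pose q : 'rV[rat]_n := \row_i projT1 (cid (q_ i)).
have qx i : `|ratr (q ord0 i) - x ord0 i| < m.+1%:R^-1.
  by rewrite mxE; case: cid.
exists (q, m) => //; rewrite /F ifT => [i|].
  by rewrite mxE distrC.
rewrite inE => y yq; apply: xeA => i; have := yq i; rewrite mxE => yqi.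
rewrite [ltRHS](splitr e) (le_lt_trans (ler_distD (ratr (q ord0 i)) _ _))//.
by rewrite ltrD// (lt_trans _ em)//.
Qed.

Lemma closed_measurable_rV A : closed A -> measurable A.
Proof.
by move=> cA; rewrite -(setCK A); apply: measurableC;
  apply: open_measurable_rV; exact: closed_openC.
Qed.

Lemma continuous_measurable_rV (f : 'rV[R]_n -> R) :
  continuous f -> measurable_fun setT f.
Proof.
move=> cf; apply: (measurability _ (RGenOpens.measurableE R)).
move=> _ [_ [a [b ->] <-]]; rewrite setTI; apply: open_measurable_rV.
by apply: open_comp => // x _; exact: cf.
Qed.

Lemma bounded_sub_box A : bounded_set A -> exists2 e : R, 0 < e & A `<=` box 0 e.
Proof.
move=> [M [_ MA]]; exists (`|M| + 2) => [|x Ax i]; first by rewrite ltr_wpDl.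
have /MA/(_ _ Ax) : M < `|M| + 1 by rewrite ltr_pwDr// ler_norm.
move=> xM; rewrite mxE subr0 (@le_lt_trans _ _ (`|M| + 1)) ?ltrD2l ?ltr1n//.
by apply: le_trans xM; exact: coord_le_norm.
Qed.

Lemma box_bounded a e : bounded_set (box a e).
Proof.
exists (`|a| + `|e|); split; first by rewrite num_real.
move=> M aM x xa /=; have M0 : 0 <= M.
  by rewrite ltW// (le_lt_trans _ aM)// addr_ge0.
apply: rV_norm_le => // j.
rewrite (le_trans _ (ltW aM))// -[x _ _](subrK (a ord0 j)).
rewrite (le_trans (ler_normD _ _))// addrC lerD ?coord_le_norm//.
by rewrite (le_trans (ltW (xa j)))// ler_norm.
Qed.

Lemma sub_box_bounded A a e : A `<=` box a e -> bounded_set A.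
Proof.
move=> Ae; have [M [Mr MA]] := box_bounded a e.
by exists M; split => // N MN x /Ae; exact: MA.
Qed.

End rV_box.

Lemma lebesgue_box {R : realType} n (a : 'rV[R]_n) (e : R) : 0 <= e ->
  (@lebesgue_rV R n) (box a e) = ((e *+ 2) ^+ n)%:E.
Proof.
move=> e0; elim: n a => [|n IH] a.
  rewrite expr0 (_ : box a e = setT); first by rewrite [LHS]diracT.
  by apply/seteqP; split => // x _ [].
rewrite (lebesgue_rV_ins ord0); last exact: measurable_box.
rewrite (_ : _ @^-1` _ = [set t | `|t - a ord0 ord0| < e] `*`
                         box (\row_j a ord0 (lift ord0 j)) e).
  rewrite (_ : [set _ | _] = ball (a ord0 ord0 : R) e); last first.
    by apply/seteqP; split=> t /=; rewrite /ball/= distrC.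
  rewrite product_measure1E; [|exact: open_measurable (ball_open _ _)|exact: measurable_box].
  rewrite exprS EFinM -(lebesgue_measure_ball (a ord0 ord0) e0).
  by congr (_ * _)%E; exact: IH.
apply/seteqP; split => [[t y]/= xa|[t y] /= [ta ya] i].
  split; first by have := xa ord0; rewrite ins_rV_id.
  by move=> i; have := xa (lift ord0 i); rewrite ins_rV_lift/= mxE.
case: (unliftP ord0 i) => [j ->|->]; last by rewrite ins_rV_id.
by rewrite ins_rV_lift/=; have := ya j; rewrite mxE.
Qed.

Lemma lebesgue_bounded {R : realType} n (A : set 'rV[R]_n) :
  measurable A -> bounded_set A -> (@lebesgue_rV R n A < +oo)%E.
Proof.
move=> mA /bounded_sub_box[e e0 Ae].
rewrite (@le_lt_trans _ _ (@lebesgue_rV R n (box 0 e)))//; last first.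
  by rewrite lebesgue_box ?ltry// ltW.
by apply: le_measure => //; rewrite inE//; exact: measurable_box.
Qed.

Lemma lebesgue_open_gt0 {R : realType} n (A : set 'rV[R]_n) :
  open A -> A !=set0 -> (0 < @lebesgue_rV R n A)%E.
Proof.
move=> oA [x Ax]; have /nbhs_boxP[e e0 xeA] : nbhs x A by exact: open_nbhs_nbhs.
rewrite (@lt_le_trans _ _ (@lebesgue_rV R n (box x e)))//.
  by rewrite lebesgue_box ?lte_fin ?exprn_gt0 ?mulrn_wgt0// ltW.
by apply: le_measure; rewrite ?inE//; [exact: measurable_box|exact: open_measurable_rV].
Qed.

(** * Multivariate polynomial functions *)

Section polynomials.
Context {R : realType}.

(** Monomials are products of variables, so that continuity and differentiability of evaluation
    reduce to the ring operations. *)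
Lemma mpoly_ring_ind n (P : mpoly n R -> Prop) :
  (forall c, P (mpolyC n c)) -> (forall i, P (mpolyX R (mnm1 i))) ->
  (forall p q, P p -> P q -> P (p + q)) ->
  (forall p q, P p -> P q -> P (p * q)) -> forall p, P p.
Proof.
move=> PC PX PD PM; elim/mpolyind => [|c m p _ _ Pp].
  by rewrite -(mpolyC0 n R); exact: PC.
apply: PD => //; rewrite -mul_mpolyC; apply: (PM) => //.
rewrite mpolyXE_id; apply: big_rec => [|i q _ Pq]; first by rewrite -(mpolyC1 n R); exact: PC.
apply: (PM) => //; elim: (m i) => [|k IH].
  by rewrite expr0 -(mpolyC1 n R); exact: PC.
by rewrite exprS; exact: (PM).
Qed.

Lemma continuous_peval n (p : mpoly n R) : continuous (peval p).
Proof.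
elim/mpoly_ring_ind : p => [c|i|p q cp cq|p q cp cq] x.
- rewrite (_ : peval _ = cst c); first exact: cst_continuous.
  by apply/funext => y; rewrite /peval mevalC.
- rewrite (_ : peval _ = fun y : 'rV[R]_n => y ord0 i); first exact: coord_continuous.
  by apply/funext => y; rewrite /peval mevalXU.
- rewrite (_ : peval _ = peval p \+ peval q).
    by apply: continuousD; [exact: cp|exact: cq].
  by apply/funext => y; rewrite /peval mevalD.
- rewrite (_ : peval _ = peval p \* peval q).
    by apply: continuousM; [exact: cp|exact: cq].
  by apply/funext => y; rewrite /peval mevalM.
Qed.

Lemma measurable_peval n (p : mpoly n R) (D : set 'rV[R]_n) : measurable_fun D (peval p).
Proof.
apply: measurable_funTS; apply: continuous_measurable_rV.
exact: continuous_peval.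
Qed.

Lemma is_derive_peval_ins n (p : mpoly n.+1 R) (i : 'I_n.+1) (y : 'rV[R]_n) (t : R) :
  is_derive t (1 : R) (fun t : R => peval p (ins_rV i (t, y)))
    (peval (mderiv i p) (ins_rV i (t, y))).
Proof.
elim/mpoly_ring_ind : p => [c|j|p q dp dq|p q dp dq].
- rewrite mderivC /peval meval0.
  by under eq_fun do rewrite mevalC; exact: is_derive_cst.
- rewrite /peval; under eq_fun do rewrite mevalXU.
  rewrite mderivX mevalZ mevalX.
  case: (unliftP i j) => [k ->|->].
    under eq_fun do rewrite ins_rV_lift.
    rewrite mnm1E eq_sym (negbTE (neq_lift _ _)) mul0r; exact: is_derive_cst.
  under eq_fun do rewrite ins_rV_id.
  rewrite mnm1E eqxx mul1r big1 => [|k _].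
    exact: is_derive_id.
  by rewrite mnmBE subnn expr0.
- rewrite mderivD /peval mevalD; under eq_fun do rewrite mevalD.
  exact: is_deriveD.
- rewrite mderivM /peval mevalD !mevalM; under eq_fun do rewrite mevalM.
  apply: (@is_derive_eq _ _ _ _ _ _ _ _ (is_deriveM dp dq)).
  by rewrite addrC mulrC.
Qed.

(** If [m] is the leading monomial of the derivative, then [m] times the variable [i] occurs in [p],
    which bounds the degree of [m]. *)
Lemma msize_mderiv n (p : mpoly n R) i : (msize (mderiv i p) <= (msize p).-1)%N.
Proof.
rewrite leqNgt; apply/negP => lpd.
have d0 : mderiv i p != 0.
  by rewrite -(mmeasure_poly_eq0 mdeg) -lt0n (leq_ltn_trans _ lpd).
have := mlead_supp d0; rewrite mcoeff_msupp mcoeff_mderiv => /eqP h.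
have : mnm_add (mlead (mderiv i p)) (mnm1 i) \in msupp p.
  by rewrite mcoeff_msupp; apply/eqP => h0; apply: h; rewrite h0 mul0rn.
move=> /msize_mdeg_lt; rewrite mdegD mdeg1 addn1 mlead_deg// => lt.
by have := leq_trans lt (leq_trans (leqSpred _) lpd); rewrite ltnn.
Qed.

(** Characteristic zero: the coefficient of a monomial [m] with [m i > 0], multiplied by [m i], is a
    coefficient of the derivative in direction [i]. *)
Lemma mderiv_eq0_polyC n (p : mpoly n R) :
  (forall i, mderiv i p = 0) -> p = mpolyC n (mcoeff mnm0 p).
Proof.
move=> dp0; apply/mpolyP => m; rewrite mcoeffC.
have [->|m0] := eqVneq m mnm0; first by rewrite mulr1.
rewrite mulr0; have [i mi] : exists i, (0 < m i)%N.
  apply/not_existsP => h; move/eqP : m0; apply; apply/mnmP => i.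
  by rewrite mnm0E; case: (posnP (m i)) => // mi; exfalso; exact: h mi.
have := mcoeff_mderiv i p (mnm_sub m (mnm1 i)).
rewrite dp0 mcoeff0 mnmBE mnm1E eqxx subn1 prednK// submK.
  move=> /esym/eqP; rewrite mulrn_eq0 => /orP[|/eqP//].
  by rewrite eqn0Ngt mi.
apply/mnm_lepP => j; rewrite mnm1E.
by have [<-|] := eqVneq i j.
Qed.

(** The partial derivatives vanish on [U] as well and have smaller size; by induction they are zero,
    so that [p] is constant. *)
Lemma peval_open_eq0 n (p : mpoly n R) (U : set 'rV[R]_n) :
  open U -> U !=set0 -> (forall x, U x -> peval p x = 0) -> p = 0.
Proof.
move=> oU U0; have [k] := ubnP (msize p).
elim: k p => // k IH p pk pU.
have dp0 i : mderiv i p = 0.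
  have [p0|p0] := eqVneq p 0; first by rewrite p0 mderiv0.
  apply: IH => [|x Ux].
    rewrite (leq_ltn_trans (msize_mderiv p i))// -ltnS prednK//.
    by rewrite lt0n mmeasure_poly_eq0.
  case: n U i p pk pU p0 oU U0 x Ux => [|n] U i p _ pU p0 oU U0 x Ux.
    by case: i.
  set y := \row_j x ord0 (lift i j).
  have xE : x = ins_rV i (x ord0 i, y).
    apply/rowP => j; case: (unliftP i j) => [l ->|->].
      by rewrite ins_rV_lift /= mxE.
    by rewrite ins_rV_id.
  have [e e0 eU] : exists2 e : R, 0 < e & box x e `<=` U.
    by apply/nbhs_boxP; exact: open_nbhs_nbhs.
  have := is_derive_peval_ins p i y (x ord0 i); rewrite -xE => -[dp <-].
  transitivity ('D_1 (cst 0 : R -> R) (x ord0 i)); last by rewrite derive_cst.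
  apply: near_eq_derive.
  exists e => //= t; rewrite /ball/= => xt; apply: pU; apply: eU => j.
  case: (unliftP i j) => [l ->|->].
    by rewrite ins_rV_lift /= mxE subrr normr0.
  by rewrite ins_rV_id distrC.
have pC := mderiv_eq0_polyC dp0.
case: U0 => x Ux; have := pU x Ux.
by rewrite {1}pC /peval mevalC => p0; rewrite pC p0 mpolyC0.
Qed.

End polynomials.

(** * Hyperplanes and their surface measure *)

Section affine.
Context {R : realType}.
Local Open Scope ereal_scope.
Local Notation leb1 := (@lebesgue_measure R).

Lemma measurable_affine (a b : R) :
  measurable_fun [set: measurableTypeR R] (fun t : measurableTypeR R => (a * t + b)%R : measurableTypeR R).
Proof. by apply: measurable_funD => //; exact: measurable_funM. Qed.

(** Both sides are measures that agree on the intervals []u, v]]; the sign of [a] decides which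
    endpoint of the preimage is closed. *)
Lemma lebesgue_affine (a b : R) (A : set (measurableTypeR R)) : a != 0%R -> measurable A ->
  leb1 A = `|a|%:E * leb1 ((fun t => a * t + b)%R @^-1` A).
Proof.
move=> a0 mA.
have a0' : (0 < `|a|)%R by rewrite normr_gt0.
pose nu := mscale (NngNum (ltW a0'))
  (measure_function_pushforward__canonical__measure_function_Measure leb1 (measurable_affine a b)).
rewrite (@lebesgue_measure_unique R nu)// => _ [[u v] /= uv <-].
rewrite /nu/= /mscale/= /pushforward.
rewrite (lebesgue_measure_itv `]u, v]) /= lte_fin.
have [a_gt0|a_lt0] : (0 < a)%R \/ (a < 0)%R by apply/orP; rewrite -neq_lt eq_sym.
  rewrite (_ : _ @^-1` _ = [set` `](u - b) / a, (v - b) / a]%R]).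
    rewrite lebesgue_measure_itv/= lte_fin ltr_pM2r ?invr_gt0// ltrD2r.
    case: ifPn => // _; last by rewrite mule0.
    by rewrite -!EFinB -EFinM gtr0_norm//; congr EFin; field.
  apply/seteqP; split=> t /=; rewrite !in_itv/= ltr_pdivrMr// ler_pdivlMr//;
    by rewrite ltrBlDr lerBrDr mulrC.
rewrite (_ : _ @^-1` _ = [set` `[(v - b) / a, (u - b) / a[%R]).
  rewrite lebesgue_measure_itv/= lte_fin ltr_nM2r ?invr_lt0// ltrD2r.
  case: ifPn => // _; last by rewrite mule0.
  by rewrite -!EFinB -EFinM ltr0_norm//; congr EFin; field; rewrite lt_eqF.
apply/seteqP; split=> t /=; rewrite !in_itv/= ltr_ndivlMr// ler_ndivrMr//;
  by rewrite ltrBlDr lerBrDr mulrC andbC.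
Qed.

End affine.

Section lebesgue_sections.
Context {R : realType}.
Local Open Scope ereal_scope.
Local Notation leb1 := (@lebesgue_measure R).

(** Integration over lines parallel to axis [i]: the other order of integration, equal by uniqueness
    of the product measure. *)
Lemma lebesgue_rV_ysection n (i : 'I_n.+1) (A : set 'rV[R]_n.+1) : measurable A ->
  @lebesgue_rV R _ A = \int[@lebesgue_rV R n]_y leb1 [set t | A (ins_rV i (t, y))].
Proof.
move=> mA; rewrite (lebesgue_rV_ins i)//.
rewrite (@product_measure_unique _ _ _ _ _ leb1 (@lebesgue_rV R n) (leb1 \x^ (@lebesgue_rV R n))).
- rewrite /product_measure2; apply: eq_integral => y _ /=; congr (leb1 _).
  by apply/seteqP; split=> t /=; rewrite /ysection/= inE.
- move=> B C mB mC.
  exact: (@product_measure2E _ _ _ _ _ leb1 (@lebesgue_rV R n)).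
- by rewrite -[X in measurable X]setTI; exact: measurable_ins_rV.
Qed.

Lemma measurable_ysection_ins n (i : 'I_n.+1) (A : set 'rV[R]_n.+1) y : measurable A ->
  measurable [set t | A (ins_rV i (t, y))].
Proof. by move=> mA; rewrite -[X in measurable X]setTI; exact: measurable_ins_rV2. Qed.

Lemma measurable_lebesgue_ysection n (i : 'I_n.+1) (A : set 'rV[R]_n.+1) :
  measurable A -> measurable_fun setT (fun y => leb1 [set t | A (ins_rV i (t, y))]).
Proof.
move=> mA; rewrite (_ : (fun _ => _) = leb1 \o ysection (ins_rV i @^-1` A)).
  apply: measurable_fun_ysection.
  by rewrite -[X in measurable X]setTI; exact: measurable_ins_rV.
apply/funext => y /=; congr (leb1 _).
by apply/seteqP; split=> t /=; rewrite /ysection/= inE.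
Qed.

End lebesgue_sections.

Section hyperplane.
Context {R : realType} (n : nat).
Implicit Types nu x : 'rV[R]_n.+1.

Lemma dot_lift nu x i :
  dot nu x = nu ord0 i * x ord0 i + \sum_l nu ord0 (lift i l) * x ord0 (lift i l).
Proof. by rewrite /dot (bigD1_ord i). Qed.

Lemma graph_pt_ins nu c i y : graph_pt nu c i y =
  ins_rV i ((c - \sum_l nu ord0 (lift i l) * y ord0 l) / nu ord0 i, y).
Proof. by apply/rowP => j; rewrite !mxE. Qed.

Lemma dot_ins nu i t (y : 'rV[R]_n) :
  dot nu (ins_rV i (t, y)) = nu ord0 i * t + \sum_l nu ord0 (lift i l) * y ord0 l.
Proof.
rewrite (dot_lift _ _ i) ins_rV_id; congr (_ + _).
by apply: eq_bigr => l _; rewrite ins_rV_lift.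
Qed.

Lemma dot_graph_pt nu c i y : nu ord0 i != 0 -> dot nu (graph_pt nu c i y) = c.
Proof.
by move=> nui; rewrite graph_pt_ins dot_ins mulrCA divff// mulr1 subrK.
Qed.

Lemma graph_pt_lift nu c i y j : graph_pt nu c i y ord0 (lift i j) = y ord0 j.
Proof. by rewrite graph_pt_ins ins_rV_lift. Qed.

Lemma graph_ptK nu c i x : nu ord0 i != 0 -> dot nu x = c ->
  graph_pt nu c i (\row_l x ord0 (lift i l)) = x.
Proof.
move=> nui; rewrite (dot_lift _ _ i) => <-; apply/rowP => j.
case: (unliftP i j) => [l ->|->]; first by rewrite graph_pt_lift mxE.
rewrite graph_pt_ins ins_rV_id /=.
under [X in _ - X]eq_bigr do rewrite mxE.
by rewrite addrK mulrC mulKf.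
Qed.

(** Every line parallel to an axis [i] with [nu_i != 0] meets the hyperplane in one point. The
    superset [N] spares the measurability of [A]. *)
Lemma hyperplane_lebesgue0 nu c (A : set 'rV[R]_n.+1) : nu != 0 ->
  A `<=` [set x | dot nu x = c] ->
  exists N, [/\ measurable N, @lebesgue_rV R _ N = 0%E & A `<=` N].
Proof.
move=> nu0 AH; have [i nui] : exists i, nu ord0 i != 0.
  apply/not_existsP => h; move/eqP : nu0; apply; apply/rowP => i.
  by rewrite mxE; apply/eqP/negPn/negP; exact: h.
exists [set x | dot nu x = c].
have mH : measurable [set x | dot nu x = c].
  rewrite (_ : [set _ | _] = (dot nu) @^-1` [set c])//.
  rewrite -[X in measurable X]setTI.
  have : measurable_fun [set: 'rV[R]_n.+1] (dot nu).
    apply: measurable_sum => l; apply: measurable_funM => //.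
    exact: measurable_coord.
  by apply.
split => //.
rewrite (lebesgue_rV_ysection i)// (eq_integral (cst 0%E)) ?integral0// => y _ /=.
rewrite (_ : [set t | _] = [set (c - \sum_l nu ord0 (lift i l) * y ord0 l) / nu ord0 i]).
  exact: lebesgue_measure_set1.
apply/seteqP; split => t /=; rewrite dot_ins.
  by move=> <-; rewrite addrK mulrC mulKf.
by move=> ->; rewrite mulrCA divff// mulr1 subrK.
Qed.

End hyperplane.

Section surface_measure.
Context {R : realType}.

Lemma bump_swap (a b a' b' l : nat) :
  a = bump b a' -> b = bump a b' -> bump a (bump b' l) = bump b (bump a' l).
Proof.
rewrite /bump; case: (leqP b a') => ?; case: (leqP a b') => ? /=;
  case: (leqP b' l) => ?; case: (leqP a' l) => ? /= => ? ?; lia.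
Qed.

(** Here [i'] is the position of [i] once [j] is removed, and [j'] that of [j] once [i] is removed;
    the remaining indices are enumerated alike in both orders of removal. *)
Lemma lift_swap m (i j : 'I_m.+2) (i' j' : 'I_m.+1) l :
  i = lift j i' -> j = lift i j' -> lift i (lift j' l) = lift j (lift i' l).
Proof.
move=> /(congr1 val)/= ij /(congr1 val)/= ji; apply/val_inj => /=.
exact: bump_swap.
Qed.

Local Notation leb n := (@lebesgue_rV R n).
Local Open Scope ereal_scope.

(* The surface measure of a hyperplane can therefore be computed over any
   coordinate i with nu_i != 0, as the divergence theorem requires. *)
Lemma push_graph_swap n (nu : 'rV[R]_n.+1) c (i j : 'I_n.+1) (A : set 'rV[R]_n.+1) :
  nu ord0 i != 0%R -> nu ord0 j != 0%R -> measurable A ->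
  `|nu ord0 i|^-1%:E * leb n (graph_pt nu c i @^-1` A) =
  `|nu ord0 j|^-1%:E * leb n (graph_pt nu c j @^-1` A).
Proof.
move=> nui nuj mA; have [->//|ij] := eqVneq i j.
case: n => [|m] in nu i j A nui nuj mA ij *; first by move: ij; rewrite !ord1.
have [i' iE] : exists i', i = lift j i'.
  by case: (unliftP j i) ij => [i' ->|->]; [exists i'|rewrite eqxx].
have [j' jE] : exists j', j = lift i j'.
  by case: (unliftP i j) ij => [j' ->|->]; [exists j'|rewrite eqxx].
have mg k : measurable (graph_pt nu c k @^-1` A).
  by rewrite -[X in measurable X]setTI; exact: measurable_graph_pt.
pose r (z : 'rV[R]_m) := (\sum_l nu ord0 (lift i (lift j' l)) * z ord0 l)%R.
(* [u z t] is the coordinate [i] of the point of the hyperplane with coordinate [j] equal to [t] and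
   the others equal to [z]. Its slope in [t] is the ratio of the two density factors up to sign. *)
pose u (z : 'rV[R]_m) (t : R) := (- (nu ord0 j / nu ord0 i) * t + (c - r z) / nu ord0 i)%R.
have gE z t : graph_pt nu c i (ins_rV j' (t, z)) = graph_pt nu c j (ins_rV i' (u z t, z)).
  rewrite -[LHS](@graph_ptK _ _ nu c j)//; last exact: dot_graph_pt.
  congr graph_pt; apply/rowP => l; rewrite mxE.
  case: (unliftP i' l) => [k ->|->].
    by rewrite -(lift_swap k iE jE) graph_pt_lift !ins_rV_lift.
  rewrite -iE ins_rV_id graph_pt_ins ins_rV_id /=.
  rewrite (bigD1_ord j')//= -jE ins_rV_id /=.
  rewrite (eq_bigr (fun l => nu ord0 (lift i (lift j' l)) * z ord0 l)%R); last first.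
    by move=> k _; rewrite ins_rV_lift.
  by rewrite -/(r z) /u; field.
rewrite (lebesgue_rV_ysection j' (mg i)) (lebesgue_rV_ysection i' (mg j)).
have sE z : lebesgue_measure [set t | A (graph_pt nu c j (ins_rV i' (t, z)))] =
    `|nu ord0 j / nu ord0 i|%:E *
    lebesgue_measure [set t | A (graph_pt nu c i (ins_rV j' (t, z)))].
  rewrite (@lebesgue_affine _ (- (nu ord0 j / nu ord0 i))%R ((c - r z) / nu ord0 i)%R
    [set t | A (graph_pt nu c j (ins_rV i' (t, z)))]); last 2 first.
  - by rewrite oppr_eq0 mulf_neq0// invr_eq0.
  - exact: (measurable_ysection_ins i' z (mg j)).
  rewrite normrN; congr (_ * lebesgue_measure _).
  by apply/seteqP; split => t /=; rewrite gE.
rewrite [in RHS](eq_integral _ _ (fun z _ => sE z)).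
rewrite ge0_integralZl_EFin; last 4 first.
- exact: measurableT.
- by move=> z _; exact: measure_ge0.
- exact: (measurable_lebesgue_ysection j' (mg i)).
- exact: normr_ge0.
rewrite muleA -EFinM normrM normfV mulrA mulVf ?normr_eq0// mul1r.
by [].
Qed.

End surface_measure.

(** * Compact sets with flat endpoints on the line *)

(** The intersection of [I] and [A] is relatively open and relatively closed in [I], and
    nonempty. *)
Lemma connected_sub_closed (T : topologicalType) (I A : set T) :
  connected I -> closed A -> (forall x, I x -> A x -> A° x) ->
  (exists2 x, I x & A x) -> I `<=` A.
Proof.
move=> cI cA IA [x Ix Ax].
suff : I `&` A = I by move=> <- y [].
apply: cI; first by exists x.
- exists A°; first exact: open_interior.
  apply/seteqP; split=> y [Iy Ay]; split => //; first exact: IA.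
  exact: interior_subset.
- by exists A.
Qed.

Section flat_endpoints.
Context {R : realType}.
Local Notation mu := (@lebesgue_measure R).
Variables (f g : R -> R) (A : set R) (sg : R -> R).
Hypothesis fg : forall t, is_derive t (1 : R) f (g t).
Hypothesis cg : continuous g.
Hypothesis cA : compact A.

(* sg t is the outer normal of A at t. *)
Definition flat_at t :=
  (sg t = 1 /\ \forall v \near t, A v <-> v <= t) \/
  (sg t = -1 /\ \forall v \near t, A v <-> t <= v).

Let cf : continuous f.
Proof.
move=> t; apply: differentiable_continuous; apply/derivable1_diffP.
exact: ex_derive.
Qed.

Let iA : mu.-integrable A (EFin \o g).
Proof. by apply: continuous_compact_integrable => //; exact: continuous_subspaceT. Qed.

Let clA : closed A.
Proof. by apply: compact_closed => //; exact: Rhausdorff. Qed.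

Let mA : measurable A.
Proof. exact: closed_measurable. Qed.

Lemma Rintegral_FTC a b : a <= b ->
  \int[mu]_(x in `]a, b]) g x = f b - f a.
Proof.
rewrite le_eqVlt => /predU1P[->|ab].
  by rewrite set_itvoc0 Rintegral_set0 subrr.
rewrite Rintegral_itv_obnd_cbnd; last first.
  apply: (@integrableS _ _ _ mu [set` `[a, b]]) => //.
    by apply: subset_itvr; rewrite bnd_simp.
  apply: continuous_compact_integrable; first exact: segment_compact.
  exact: continuous_subspaceT.
rewrite /Rintegral (@continuous_FTC2 _ g f)//.
- exact: continuous_subspaceT.
- split; first by move=> x _; exact: ex_derive.
  + exact/cvg_at_right_filter/cf.
  + exact/cvg_at_left_filter/cf.
- by move=> x _; rewrite derive1E derive_val.
Qed.

(* c tells whether A contains a right neighbourhood of a. *)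
Lemma Rintegral_flat_path (s : seq R) (a : R) (c : bool) :
  path <%R a s ->
  (forall t, A t -> ~ A° t -> a < t -> t \in s) ->
  (forall t, t \in s -> flat_at t) ->
  (\forall v \near a^'+, A v <-> c) ->
  \int[mu]_(x in A `&` `]a, +oo[) g x = \sum_(t <- s) sg t * f t - c%:R * f a.
Proof.
elim: s a c => [|t s IH] a c /=.
  (* Without frontier points beyond [a], the set [A] contains all of []a, +oo[] or none of it; being
     bounded, it contains none. *)
  move=> _ frA _ Aa; have AI0 : A `&` `]a, +oo[ = set0.
    apply/seteqP; split=> // x [Ax ax].
    have : `]a, +oo[ `<=` A.
      apply: connected_sub_closed => //; last by exists x.
        by apply/connected_intervalP; exact: interval_is_interval.
      move=> y; rewrite /= in_itv/= andbT => ay Ay; apply: contrapT => nAy.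
      by have := frA y Ay nAy ay.
    have /compact_bounded[M [_ MA]] := cA.
    have := MA _ (ltr_pwDr ltr01 (ler_norm M)).
    move=> {}MA /(_ (`|M| + `|a| + 2)).
    rewrite /= in_itv/= andbT => AM.
    have a1 : a <= `|a| by exact: ler_norm.
    have M0 : 0 <= `|M| by [].
    have a0 : 0 <= `|a| by [].
    have /MA : A (`|M| + `|a| + 2) by apply: AM; lra.
    by rewrite /= ger0_norm => [|]; lra.
  rewrite AI0 Rintegral_set0 big_nil; case: c Aa => Aa.
    have [v []] : exists v, A v /\ a < v.
      have := @filter_ex _ a^'+ _ _ (filterI Aa (nbhs_right_gt a)).
      by move=> [v [vA av]]; exists v; split => //; exact/vA.
    move=> Av av; suff : set0 v by [].
    by rewrite -AI0; split => //=; rewrite in_itv/= andbT.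
  by rewrite mul0r subr0.
move=> /andP[at_ ts] frA flA Aa.
have st u : u \in s -> t < u.
  by move: ts; rewrite lt_path_sortedE => /andP[/allP/(_ u) tu _] /tu.
have IHt (c' : bool) : (\forall v \near t^'+, A v <-> c') ->
    \int[mu]_(x in A `&` `]t, +oo[) g x = \sum_(t <- s) sg t * f t - c'%:R * f t.
  move=> At; apply: IH => // [u Au nAu tu|u us]; last first.
    by apply: flA; rewrite in_cons us orbT.
  have := frA u Au nAu (lt_trans at_ tu).
  by rewrite in_cons => /predU1P[uE|//]; rewrite uE ltxx in tu.
have tR : t \in t :: s by rewrite mem_head.
have tleft (P : set R) : (\forall v \near t, P v) -> exists v, [/\ P v, a < v & v < t].
  move=> Pt; have := @filter_ex _ t^'- _ _ (filterI (cvg_within _ Pt : t^'- P)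
    (filterI (nbhs_left_gt at_) (nbhs_left_lt t))).
  by move=> [v [? [? ?]]]; exists v.
have aright (P : set R) : (\forall v \near a^'+, P v) -> exists v, [/\ P v, a < v & v < t].
  move=> Pt; have := @filter_ex _ a^'+ _ _ (filterI Pt
    (filterI (nbhs_right_gt a) (nbhs_right_lt at_))).
  by move=> [v [? [? ?]]]; exists v.
have tright (P : set R) : (\forall v \near t, P v) -> \forall v \near t^'+, P v.
  by move=> Pt; exact: (cvg_within _ Pt).
have intI : \int[mu]_(x in A `&` `]a, +oo[) g x =
   \int[mu]_(x in A `&` `]a, t]) g x + \int[mu]_(x in A `&` `]t, +oo[) g x.
  rewrite -Rintegral_setU; first 1 last.
  - by apply: measurableI.
  - by apply: measurableI.
  - apply: integrableS iA => //; first by apply: measurableU; exact: measurableI.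
    by move=> x [] [].
  - apply/disj_setPS => x [[_ /=]]; rewrite in_itv/= => /andP[_ xt] [_ /=].
    by rewrite in_itv/= andbT ltNge xt.
  - congr (Rintegral _ _ _); rewrite -setIUr; congr (_ `&` _).
    by rewrite -itv_bndbnd_setU// bnd_simp// ltW.
(* No frontier point lies in []a, t[], which is therefore contained in [A] or disjoint from it. *)
have [[x [ax xt] Ax]|nI] := pselect (exists2 x, a < x /\ x < t & A x).
  have IA : `]a, t[ `<=` A.
    apply: connected_sub_closed => //.
    - by apply/connected_intervalP; exact: interval_is_interval.
    - move=> y; rewrite /= in_itv/= => /andP[ay yt] Ay; apply: contrapT => nAy.
      have := frA y Ay nAy ay; rewrite in_cons => /predU1P[yE|/st].
        by rewrite yE ltxx in yt.
      by rewrite ltNge (ltW yt).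
    - by exists x => //=; rewrite in_itv/= ax xt.
  have {Aa} -> : c.
    have [v [vA av vt]] := aright _ Aa; apply/vA/IA => /=.
    by rewrite in_itv/= av vt.
  case: (flA t tR) => -[sgt At]; last first.
    have [v [vA av vt]] := tleft _ At.
    have /vA : A v by apply: IA; rewrite /= in_itv/= av vt.
    by rewrite leNgt vt.
  have {}At' : A t by apply/(nbhs_singleton At).
  rewrite intI (_ : A `&` `]a, t] = `]a, t]%classic).
    rewrite Rintegral_FTC ?(ltW at_)// (IHt false) ?big_cons ?sgt.
      by rewrite mul0r subr0 !mul1r; ring.
    apply: filterS2 (nbhs_right_gt t) (tright _ At) => v tv [vA _].
    by split => // /vA; rewrite leNgt tv.
  apply/seteqP; split=> [y []//|y /= yat]; split => //; move: yat.
  rewrite in_itv/= => /andP[ay]; rewrite le_eqVlt => /predU1P[->//|yt].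
  by apply: IA; rewrite /= in_itv/= ay yt.
(* In the disjoint case the half-open interval up to [t] contributes only the null set of the point
   [t], and [A] continues to the right of [t]. *)
have {Aa} -> : c = false.
  apply/negbTE/negP => cT; have [v [vA av vt]] := aright _ Aa.
  by apply: nI; exists v => //; exact/vA.
case: (flA t tR) => -[sgt At].
  have [v [vA av vt]] := tleft _ At.
  by exfalso; apply: nI; exists v => //; apply/vA; exact: ltW.
have {}At' : A t by apply/(nbhs_singleton At).
rewrite intI (_ : A `&` `]a, t] = [set t]).
  rewrite Rintegral_set1 (IHt true) ?big_cons ?sgt.
    by rewrite mul0r mul1r; ring.
  apply: filterS2 (nbhs_right_gt t) (tright _ At) => v tv [_ vA].
  by split => // _; apply: vA; exact: ltW.
apply/seteqP; split=> [y [Ay /=]|y -> /=]; last by split => //=; rewrite in_itv/= at_ lexx.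
rewrite in_itv/= => /andP[ay]; rewrite le_eqVlt => /predU1P[->//|yt].
by exfalso; apply: nI; exists y.
Qed.

(** The divergence theorem in dimension one: each endpoint contributes the primitive times the outer
    normal. It follows by scanning the sorted endpoints from a point to the left of [A]. *)
Lemma Rintegral_flat (s : seq R) : uniq s ->
  (forall t, A t -> ~ A° t -> t \in s) ->
  (forall t, t \in s -> flat_at t) ->
  \int[mu]_(x in A) g x = \sum_(t <- s) sg t * f t.
Proof.
move=> us frA flA.
have /compact_bounded[M [_ MA]] := cA.
have {}MA := MA _ (ltr_pwDr ltr01 (ler_norm M)).
(* [|M| + 1] bounds [A] and the sum bounds each endpoint, so [m] lies strictly to the left of all of
   them. *)
pose m := - (`|M| + 2 + \sum_(t <- s) `|t|).
have s0 : 0 <= \sum_(t <- s) `|t| by exact: sumr_ge0.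
have sm t : t \in s -> m < t.
  move=> ts; rewrite /m ltrNl (le_lt_trans (ler_norm _))// normrN.
  rewrite (perm_big _ (perm_to_rem ts)) big_cons/=.
  have : 0 <= \sum_(t <- rem t s) `|t| by exact: sumr_ge0.
  by have : 0 <= `|M| by []; lra.
have Am v : A v -> m < v.
  move=> /MA/=; rewrite ler_norml => /andP[+ _].
  by rewrite /m; lra.
have AE : A `&` `]m, +oo[ = A.
  apply/seteqP; split => [v []//|v Av]; split => //=.
  by rewrite in_itv/= andbT; exact: Am.
rewrite -[in LHS]AE (@Rintegral_flat_path (sort <=%R s) m false).
- by rewrite mul0r subr0 (perm_big s)//= perm_sort.
- rewrite lt_path_sortedE; apply/andP; split.
    by apply/allP => t; rewrite mem_sort => /sm.
  by rewrite lt_sorted_uniq_le sort_uniq us sort_le_sorted.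
- by move=> t At nAt _; rewrite mem_sort; exact: frA.
- by move=> t; rewrite mem_sort; exact: flA.
- have mN : ~ A m by move=> /Am; rewrite ltxx.
  near=> v; split => // Av.
  have : v < m + 1 by near: v; apply: nbhs_right_lt; rewrite ltrDl.
  have := MA _ Av; rewrite /= ler_norml => /andP[+ _].
  by rewrite /m; lra.
Unshelve. all: by end_near. Qed.

End flat_endpoints.

Lemma continuous_bigsum (R : realType) (T : topologicalType) (V : normedModType R)
    (I : Type) (r : seq I) (F : I -> T -> V) :
  (forall i, continuous (F i)) -> continuous (fun x => \sum_(i <- r) F i x).
Proof.
move=> cF; elim: r => [|i r IH].
  by under eq_fun do rewrite big_nil; exact: cst_continuous.
by under eq_fun do rewrite big_cons; move=> x; apply: continuousD; [exact: cF|exact: IH].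
Qed.

(** * Polytopes *)

Section polytopes.
Context {R : realType} {n : nat}.
Implicit Types (s : seq 'rV[R]_n) (A K : set 'rV[R]_n).

(** The hull is the continuous image of the simplex of coefficients, which is compact. *)
Lemma convex_hull_closed s : closed (convex_hull s).
Proof.
apply: compact_closed; first exact: norm_hausdorff.
pose C : set 'rV[R]_(size s) :=
  [set c | (forall i, 0 <= c ord0 i) /\ \sum_i c ord0 i = 1].
pose h (c : 'rV[R]_(size s)) := \sum_i c ord0 i *: s`_i.
rewrite (_ : convex_hull s = h @` C).
  apply: continuous_compact.
    apply: continuous_subspaceT; apply: continuous_bigsum => i c.
    by apply: continuousZr_tmp; exact: coord_continuous.
  apply: bounded_closed_compact.
    exists 1; split; first exact: num_real.
    move=> M M1 c [c0 c1] /=; apply: rV_norm_le => [|i]; first by rewrite ltW// (lt_trans _ M1).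
    rewrite ger0_norm// (le_trans _ (ltW M1))// -c1 (bigD1 i)//= lerDl.
    exact: sumr_ge0.
  rewrite (_ : C = (\bigcap_i [set c | 0 <= c ord0 i]) `&` [set c | \sum_i c ord0 i = 1]).
    apply: closedI.
      apply: closed_bigI => i _; apply: (@preimage_closed _ _ _ [set t : R | 0 <= t]).
        by move=> c _; exact: coord_continuous.
      exact: closed_ge.
    apply: (@preimage_closed _ _ (fun c : 'rV[R]_(size s) => \sum_i c ord0 i) [set 1 : R]).
      by move=> c _; apply: continuous_bigsum => i; exact: coord_continuous.
    exact: closed_eq.
  by apply/seteqP; split => c [c0 c1]; split => // i; [move=> _|]; exact: c0.
apply/seteqP; split => x.
  move=> [c [c0 c1 ->]]; exists (\row_i c i).
    by split=> [i|]; [rewrite mxE|under eq_bigr do rewrite mxE].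
  by rewrite /h; under eq_bigr do rewrite mxE.
by move=> [c [c0 c1] <-]; exists (c ord0).
Qed.

Lemma convex_hull_convex s x y (t : R) : convex_hull s x -> convex_hull s y ->
  0 <= t <= 1 -> convex_hull s ((1 - t) *: x + t *: y).
Proof.
move=> [c [c0 c1 ->]] [d [d0 d1 ->]] /andP[t0 t1].
exists (fun i => (1 - t) * c i + t * d i); split.
- by move=> i; rewrite addr_ge0// mulr_ge0// subr_ge0.
- by rewrite big_split/= -!mulr_sumr c1 d1 !mulr1 subrK.
- rewrite !scaler_sumr -big_split/=; apply: eq_bigr => i _.
  by rewrite !scalerA -scalerDl.
Qed.

(** On the segment from [x] to an interior point [x0], every point except possibly [x] is
    interior. *)
Lemma convex_hull_regular s x (U : set 'rV[R]_n) : (convex_hull s)° !=set0 ->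
  convex_hull s x -> nbhs x U -> exists2 z, U z & (convex_hull s)° z.
Proof.
move=> [x0 /nbhs_boxP[e e0 x0e]] sx /nbhs_boxP[d d0 xU].
pose t := Num.min 1 (d / (`|x0 - x| + 1)).
have xx0 : 0 < `|x0 - x| + 1 by rewrite ltr_wpDl.
have t0 : 0 < t by rewrite lt_min ltr01 divr_gt0.
have t1 : t <= 1 by rewrite ge_min lexx.
exists ((1 - t) *: x + t *: x0).
  apply: xU => i; rewrite !mxE (_ : _ - _ = t * (x0 - x) ord0 i); last first.
    by rewrite !mxE; ring.
  rewrite normrM gtr0_norm// (@le_lt_trans _ _ (t * `|x0 - x|))//.
    by rewrite ler_pM2l// coord_le_norm.
  rewrite (@lt_le_trans _ _ (t * (`|x0 - x| + 1)))//.
    by rewrite ltr_pM2l// ltrDl.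
  by rewrite -ler_pdivlMr// ge_min lexx orbT.
apply/nbhs_boxP; exists (t * e); first by rewrite mulr_gt0.
(* [w'] is the preimage of [w] under the homothety with centre [x] and ratio [t], which maps the box
   around [x0] onto the one around the chosen point. *)
move=> w wz; pose w' := x0 + t^-1 *: (w - ((1 - t) *: x + t *: x0)).
rewrite (_ : w = (1 - t) *: x + t *: w').
  apply: convex_hull_convex => //; last by rewrite (ltW t0).
  apply: x0e => i; have := wz i; rewrite !mxE addrAC subrr add0r.
  by rewrite normrM gtr0_norm ?invr_gt0// ltr_pdivrMl.
by apply/rowP => i; rewrite !mxE; field; rewrite gt_eqF.
Qed.

Lemma polytope_closed K : polytope K -> closed K.
Proof.
move=> [_ [ss [_ ->]]]; apply: closed_bigcup; first exact: finite_seq.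
by move=> s _; exact: convex_hull_closed.
Qed.

(** A polytope has no lower-dimensional parts: near each of its points it has interior, hence
    positive measure. *)
Lemma polytope_regular K x (U : set 'rV[R]_n) : polytope K ->
  K x -> nbhs x U -> exists2 z, U z & K° z.
Proof.
move=> [_ [ss [ssI ->]]] [s sss sx] Ux.
have [z Uz sz] := convex_hull_regular (ssI s sss) sx Ux.
exists z => //; apply: interiorS sz => y sy.
by exists s.
Qed.

End polytopes.

(** * Integration on hyperplanes and along lines *)

Section Rintegral_complements.
Context d (T : measurableType d) (R : realType) (mu : {measure set T -> \bar R}).
Variable D : set T.
Hypothesis mD : measurable D.

Lemma integrable_Rsum (I : Type) (s : seq I) (P : pred I) (F : I -> T -> R) :
  (forall i, P i -> mu.-integrable D (EFin \o F i)) ->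
  mu.-integrable D (EFin \o (fun x => \sum_(i <- s | P i) F i x)).
Proof.
move=> iF; rewrite (_ : _ \o _ = fun x => (\sum_(i <- s | P i) (F i x)%:E)%E).
  by apply: (@integrable_sum _ _ _ mu D mD I s P (fun i => EFin \o F i)).
by apply/funext => x /=; rewrite sumEFin.
Qed.

Lemma Rintegral_sum (I : Type) (s : seq I) (P : pred I) (F : I -> T -> R) :
  (forall i, P i -> mu.-integrable D (EFin \o F i)) ->
  \int[mu]_(x in D) (\sum_(i <- s | P i) F i x) =
  \sum_(i <- s | P i) \int[mu]_(x in D) F i x.
Proof.
move=> iF; elim: s => [|i s IH].
  rewrite big_nil; under eq_Rintegral do rewrite big_nil.
  by rewrite Rintegral_cst// mul0r.
rewrite big_cons; under eq_Rintegral do rewrite big_cons.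
case: ifPn => // Pi; rewrite RintegralD ?IH//; first exact: iF.
exact: integrable_Rsum.
Qed.

Lemma ae_eq_Rintegral (f g : T -> R) :
  measurable_fun D f -> measurable_fun D g ->
  {ae mu, forall x, D x -> f x = g x} ->
  \int[mu]_(x in D) f x = \int[mu]_(x in D) g x.
Proof.
move=> mf mg fg; congr fine; apply: ae_eq_integral => //.
- exact/measurable_EFinP.
- exact/measurable_EFinP.
- by apply: filterS fg => x fg Dx; rewrite fg.
Qed.

Lemma Rintegral_mscale (k : {nonneg R}) (f : T -> R) :
  mu.-integrable D (EFin \o f) ->
  \int[mscale k mu]_(x in D) f x = k%:num * \int[mu]_(x in D) f x.
Proof.
move=> /[dup] iF /integrableP[mf _].
rewrite /Rintegral integralE !ge0_integral_mscale//; first last.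
- exact: measurable_funepos.
- exact: measurable_funeneg.
rewrite -muleBr//; last exact: integrable_add_def.
by rewrite -integralE fineM//; exact: integrable_fin_num.
Qed.

Lemma bounded_integrable (f : T -> R) (b : R) :
  (mu D < +oo)%E -> measurable_fun D f -> (forall x, D x -> `|f x| <= b) ->
  mu.-integrable D (EFin \o f).
Proof.
move=> Doo mf fb; apply: measurable_bounded_integrable => //.
exists b; split; first exact: num_real.
by move=> M bM x Dx /=; rewrite (le_trans (fb x Dx))// ltW.
Qed.

End Rintegral_complements.

Section surface_integral.
Context {R : realType} (n : nat).
Implicit Types (nu : 'rV[R]_n.+1) (c : R) (i : 'I_n.+1) (A : set 'rV[R]_n.+1).

Lemma measurable_preimage_graph nu c i A :
  measurable A -> measurable (graph_pt nu c i @^-1` A).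
Proof. by move=> mA; rewrite -[X in measurable X]setTI; exact: measurable_graph_pt. Qed.

Lemma hyperplane_measureE nu c i A : nu ord0 i != 0 -> measurable A ->
  hyperplane_measure nu c A =
  (`|nu ord0 i|^-1%:E * @lebesgue_rV R n (graph_pt nu c i @^-1` A))%E.
Proof.
move=> nui mA; rewrite /hyperplane_measure; case: pickP => [j nuj|/(_ i)].
  exact: push_graph_swap.
by rewrite nui.
Qed.

(** The density [|nu_i|^-1] does not vanish, so that null sets of the hyperplane have null
    projections along axis [i]. *)
Lemma hyperplane_measure_ae nu c i (P : 'rV[R]_n.+1 -> Prop) : nu ord0 i != 0 ->
  {ae hyperplane_measure nu c, forall x, P x} ->
  {ae @lebesgue_rV R n, forall y, P (graph_pt nu c i y)}.
Proof.
move=> nui [N [mN N0 PN]]; exists (graph_pt nu c i @^-1` N); split.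
- exact: measurable_preimage_graph.
- move: N0; rewrite (hyperplane_measureE c nui mN) => /eqP.
  by rewrite mule_eq0 eqe invr_eq0 normr_eq0 (negbTE nui) /= => /eqP.
- by move=> y /= Py; apply: PN.
Qed.

Lemma bounded_preimage_graph nu c i A :
  bounded_set A -> bounded_set (graph_pt nu c i @^-1` A).
Proof.
move=> /bounded_sub_box[e e0 Ae].
apply: (@sub_box_bounded _ _ _ 0 e) => y /= /Ae Ay l.
by have := Ay (lift i l); rewrite graph_pt_lift !mxE.
Qed.

Lemma hyperplane_measure_bounded nu c i A : nu ord0 i != 0 ->
  measurable A -> bounded_set A -> (hyperplane_measure nu c A < +oo)%E.
Proof.
move=> nui mA bA.
rewrite (hyperplane_measureE c nui mA) lte_mul_pinfty// ?lee_fin ?invr_ge0//.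
apply: lebesgue_bounded; first exact: measurable_preimage_graph.
exact: bounded_preimage_graph.
Qed.

(** From ds = |nu_i|^-1 dx' one gets nu_i ds = sg(nu_i) dx', which is how the surface integrals of
    the divergence theorem arise after integration along axis [i]. *)
Lemma Rintegral_hyperplane nu c i A (f : 'rV[R]_n.+1 -> R) (b : R) :
  nu ord0 i != 0 -> measurable A -> bounded_set A ->
  measurable_fun setT f -> (forall x, A x -> `|f x| <= b) ->
  nu ord0 i * \int[hyperplane_measure nu c]_(x in A) f x =
  Num.sg (nu ord0 i) *
    \int[@lebesgue_rV R n]_(y in graph_pt nu c i @^-1` A) f (graph_pt nu c i y).
Proof.
move=> nui mA bA mf fb.
have if1 : (@lebesgue_rV R n).-integrable (graph_pt nu c i @^-1` A)
    (EFin \o f \o graph_pt nu c i).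
  apply: (@bounded_integrable _ _ _ _ _ _ (f \o graph_pt nu c i) b).
  - exact: measurable_preimage_graph.
  - apply: lebesgue_bounded; first exact: measurable_preimage_graph.
    exact: bounded_preimage_graph.
  - apply: measurable_funTS; apply: (measurableT_comp mf).
    exact: measurable_graph_pt.
  - by move=> y; exact: fb.
have k0 : 0 <= `|nu ord0 i|^-1 by rewrite invr_ge0.
pose pg := measure_function_pushforward__canonical__measure_function_Measure
  (@lebesgue_rV R n) (measurable_graph_pt nu c i).
have mf' : measurable_fun setT (EFin \o f) by exact/measurable_EFinP.
have ipg : pg.-integrable A (EFin \o f).
  exact: (integrable_pushforward (measurable_graph_pt nu c i) mf' if1 mA).
rewrite [X in _ * X = _](_ : _ = \int[mscale (NngNum k0) pg]_(x in A) f x).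
  rewrite Rintegral_mscale// mulrA.
  rewrite (_ : nu ord0 i * _ = Num.sg (nu ord0 i)); last first.
    by rewrite /= {1}[nu ord0 i]numEsg mulfK// normr_eq0.
  congr (_ * fine _).
  exact: (integral_pushforward (measurable_graph_pt nu c i) mf' if1 mA).
congr fine; apply: eq_measure_integral => B mB _.
by rewrite (hyperplane_measureE c nui mB).
Qed.

End surface_integral.

Section Fubini_ins.
Context {R : realType} (n : nat).
Local Notation leb1 := (@lebesgue_measure R).
Local Notation leb k := (@lebesgue_rV R k).
Variables (i : 'I_n.+1) (f : 'rV[R]_n.+1 -> R).
Hypothesis mf : measurable_fun setT f.
Hypothesis iF : (leb n.+1).-integrable setT (EFin \o f).
Hypothesis iFy : forall y, leb1.-integrable setT (fun t => (f (ins_rV i (t, y)))%:E).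

Let pf := measure_function_pushforward__canonical__measure_function_Measure
  (leb1 \x leb n)%E (measurable_ins_rV i).

Let iF2 : (leb1 \x leb n)%E.-integrable setT (fun p => (f (ins_rV i p))%:E).
Proof.
apply/integrableP; split.
  by apply/measurable_EFinP; apply: (measurableT_comp mf); exact: measurable_ins_rV.
move/integrableP : iF => [_]; rewrite (eq_measure_integral pf); last first.
  by move=> A mA _; exact: (lebesgue_rV_ins i mA).
rewrite [X in (X < _)%E]ge0_integral_pushforward//; first exact: measurable_ins_rV.
by apply/measurable_EFinP; exact: measurableT_comp.
Qed.

Let FE y : (\int[leb1]_t f (ins_rV i (t, y)))%:E =
   fubini_G leb1 (fun p => (f (ins_rV i p))%:E) y.
Proof. by rewrite /Rintegral fineK//; exact: integrable_fin_num. Qed.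

Lemma measurable_Rintegral_ins :
  measurable_fun setT (fun y => \int[leb1]_t f (ins_rV i (t, y))).
Proof.
apply/measurable_EFinP.
rewrite (_ : _ \o _ = fubini_G leb1 (fun p => (f (ins_rV i p))%:E)).
  exact: (measurable_fubini_G iF2).
by apply/funext => y /=; rewrite FE.
Qed.

(** Since every section is integrable, and not only almost every one, the real-valued inner integral
    agrees everywhere with the extended one in Fubini's theorem. *)
Lemma Rintegral_ins :
  \int[leb n.+1]_x f x = \int[leb n]_y \int[leb1]_t f (ins_rV i (t, y)).
Proof.
congr fine; rewrite [RHS](eq_integral _ _ (fun y _ => FE y)).
rewrite (integral21_prod_meas1 iF2) (eq_measure_integral pf); last first.
  by move=> A mA _; exact: (lebesgue_rV_ins i mA).
rewrite [LHS]integral_pushforward//; first exact: measurable_ins_rV.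
exact/measurable_EFinP.
Qed.

End Fubini_ins.

Section dot_theory.
Context {R : realType} {n : nat}.
Implicit Types (x y nu : 'rV[R]_n) (A : set 'rV[R]_n).

Lemma conv_lt (a b e t : R) : a < e -> b < e -> 0 <= t <= 1 -> (1 - t) * a + t * b < e.
Proof.
move=> ae be /andP[t0 t1]; rewrite -subr_gt0.
rewrite (_ : _ - _ = (1 - t) * (e - a) + t * (e - b)); last by ring.
have [tlt1|t1'] := ltP t 1.
  by rewrite ltr_pwDl ?mulr_gt0 ?mulr_ge0 ?subr_gt0 ?subr_ge0// ltW.
by rewrite ltr_pwDr ?mulr_gt0 ?mulr_ge0 ?subr_gt0 ?subr_ge0 ?(lt_le_trans ltr01)// ltW.
Qed.

Lemma dotC x y : dot x y = dot y x.
Proof. by apply: eq_bigr => i _; rewrite mulrC. Qed.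

Lemma dotDr nu x y : dot nu (x + y) = dot nu x + dot nu y.
Proof. by rewrite /dot -big_split/=; apply: eq_bigr => i _; rewrite mxE mulrDr. Qed.

Lemma dotZr nu (a : R) x : dot nu (a *: x) = a * dot nu x.
Proof. by rewrite /dot mulr_sumr; apply: eq_bigr => i _; rewrite mxE mulrCA. Qed.

Lemma dotNr nu x : dot nu (- x) = - dot nu x.
Proof. by rewrite -scaleN1r dotZr mulN1r. Qed.

Lemma dotBr nu x y : dot nu (x - y) = dot nu x - dot nu y.
Proof. by rewrite dotDr dotNr. Qed.

Lemma dotNl nu x : dot (- nu) x = - dot nu x.
Proof. by rewrite dotC dotNr dotC. Qed.

Lemma continuous_dot nu : continuous (dot nu).
Proof.
apply: continuous_bigsum => i x; apply: continuousM; first exact: cst_continuous.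
exact: coord_continuous.
Qed.

Lemma nbhs_shift x nu (U : set 'rV[R]_n) : nbhs x U ->
  exists2 e : R, 0 < e & U (x - e *: nu).
Proof.
move=> /nbhs_boxP[e e0 xU]; exists (e / (`|nu| + 1)).
  by rewrite divr_gt0// ltr_wpDl.
apply: xU => i; rewrite !mxE addrAC subrr add0r normrN normrM ger0_norm.
  rewrite mulrAC ltr_pdivrMr ?ltr_wpDl// ltr_pM2l//.
  by rewrite (le_lt_trans (coord_le_norm nu i))// ltrDl.
by rewrite divr_ge0// ?ltW// ltr_wpDl.
Qed.

(** A convex set is the union of the segments issuing from one of its points. *)
Lemma convex_connected A :
  (forall x y (t : R), A x -> A y -> 0 <= t <= 1 -> A ((1 - t) *: x + t *: y)) ->
  connected A.
Proof.
move=> cA; have [[a Aa]|nA] := pselect (A !=set0); last first.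
  rewrite (_ : A = set0); first exact: connected0.
  by apply/seteqP; split => // x Ax; apply: nA; exists x.
pose f (b : 'rV[R]_n) (t : R) := (1 - t) *: a + t *: b.
rewrite (_ : A = \bigcup_(b in A) (f b @` `[0, 1])).
  apply: bigcup_connected.
    exists a => b Ab; exists 0; first by rewrite /= in_itv/= lexx ler01.
    by rewrite /f subr0 scale1r scale0r addr0.
  move=> b Ab; apply: connected_continuous_connected.
    by apply/connected_intervalP; exact: interval_is_interval.
  apply: continuous_subspaceT => t; apply: cvgD.
    apply: cvgZr_tmp; apply: cvgB; first exact: cvg_cst.
    exact: cvg_id.
  by apply: cvgZr_tmp; exact: cvg_id.
apply/seteqP; split => [b Ab|_ [b Ab [t t01 <-]]].
  exists b => //; exists 1; first by rewrite /= in_itv/= lexx ler01.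
  by rewrite /f subrr scale0r add0r scale1r.
by apply: cA => //; move: t01; rewrite /= in_itv.
Qed.

Lemma closure_bounded A : bounded_set A -> bounded_set (closure A).
Proof.
move=> /bounded_sub_box[e e0 Ae]; apply: (@sub_box_bounded _ _ _ 0 (e + 1)).
move=> x /(_ (box x 1)) [|y [Ay xy] i].
  by apply/nbhs_boxP; exists 1.
have := Ae y Ay i; have := xy i; rewrite !mxE !subr0 => yx y0.
rewrite -[x _ _](subrK (y ord0 i)) addrC (le_lt_trans (ler_normD _ _))//.
by rewrite ltrD// distrC.
Qed.

End dot_theory.

(** * Geometry of the mesh *)

Section mesh_geometry.
Context {R : realType} {m : nat} (Om : set 'rV[R]_m.+2) (M : mesh R m.+2).
Hypothesis Om_dom : polyhedral_lipschitz_domain Om.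
Hypothesis M_mesh : is_mesh M Om.
Local Notation V := 'rV[R]_m.+2.
Local Notation leb := (@lebesgue_rV R m.+2).
Implicit Types (K : cellT M) (S : faceT M) (x : V).

Lemma domain_bounded : bounded_set Om.
Proof. by case: Om_dom => -[]. Qed.

Lemma domain_open : open Om.
Proof. by case: Om_dom => -[]. Qed.

Lemma cell_polytope K : polytope (cell K).
Proof. by case: M_mesh => -[]. Qed.

Lemma cell_closed K : closed (cell K).
Proof. by apply: polytope_closed; exact: cell_polytope. Qed.

Lemma cell_sub K : cell K `<=` closure Om.
Proof. by case: M_mesh => -[_ _ _ <-] _ _ x Kx; exists K. Qed.

Lemma cell_bounded K : bounded_set (cell K).
Proof.
have [r [rr rOm]] := closure_bounded domain_bounded.
by exists r; split => // s rs x /cell_sub; exact: rOm.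
Qed.

Lemma cell_measurable K : measurable (cell K).
Proof. by apply: closed_measurable_rV; exact: cell_closed. Qed.

Lemma cell_overlap K L : K != L -> leb (cell K `&` cell L) = 0%E.
Proof. by case: M_mesh => -[_ _ + _ ] _ _; apply. Qed.

Lemma frontier_cell_face K x : cell K x -> ~ (cell K)° x -> exists S, face S x.
Proof.
move=> Kx nKx; case: M_mesh => _ [_ _ _ _ fE] _.
have [S _ Sx] : (\bigcup_(S in [set: faceT M]) face S) x.
  by rewrite fE; exists K => //; split => //; exact: subset_closure.
by exists S.
Qed.

Lemma face_closed S : closed (face S).
Proof. by case: M_mesh => _ [+ _ _ _ _] _ => /(_ S) []. Qed.

Lemma face_measurable S : measurable (face S).
Proof. by apply: closed_measurable_rV; exact: face_closed. Qed.

Lemma normal_unit S : dot (normal S) (normal S) = 1.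
Proof. by case: M_mesh => _ [_ + _ _ _] _ => /(_ S) []. Qed.

Lemma normal_neq0 S : normal S != 0.
Proof.
apply/eqP => n0; have := normal_unit S; rewrite n0 /dot big1 => [/eqP|i _].
  by rewrite eq_sym oner_eq0.
by rewrite mxE mul0r.
Qed.

Lemma face_hyperplane S x : face S x -> dot (normal S) x = offset S.
Proof. by case: M_mesh => _ [_ + _ _ _] _ => /(_ S) [_]; apply. Qed.

Lemma face_overlap S T : S != T -> surf S (face S `&` face T) = 0%E.
Proof. by case: M_mesh => _ [_ _ _ + _] _; apply. Qed.

Lemma face_Kplus S : face S `<=` cell (Kplus S).
Proof.
case: M_mesh => _ _ /(_ S); case: Kminus => [K [_ + _ _] x Sx|[+ _] x Sx].
  by move=> /(_ x Sx) [].
by move=> /(_ x Sx) [].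
Qed.

Lemma face_bounded S : bounded_set (face S).
Proof.
have [r [rr rK]] := cell_bounded (Kplus S).
by exists r; split => // s rs x /face_Kplus; exact: rK.
Qed.

(** The points at which the local geometry is that of a hyperplane. On a boundary face the flatness
    is that of the domain, as the mesh provides it; that of the cell has to be derived. *)
Definition generic_point S x := [/\ face S x, forall T, T != S -> ~ face T x &
  if Kminus S is Some K
  then outer_normal_at (cell (Kplus S)) x (normal S) /\
       outer_normal_at (cell K) x (- normal S)
  else outer_normal_at (closure Om) x (normal S)].

Lemma ae_generic_point S : {ae surf S, forall x, face S x -> generic_point S x}.
Proof.
have nT : {ae surf S, forall x, forall T, T != S -> face S x -> ~ face T x}.
  apply: (@filter_forall _ _ (fun T x => T != S -> face S x -> ~ face T x)) => T.
  have [->|TS] := eqVneq T S; first by apply: aeW => x /eqP.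
  exists (face S `&` face T); split.
  - by apply: measurableI; exact: face_measurable.
  - by apply: face_overlap; rewrite eq_sym.
  - move=> x; apply: contra_notP => /not_andP nST _ Sx Tx.
    by case: nST.
case: M_mesh => _ _ /(_ S); rewrite /generic_point.
case: Kminus => [K [_ _ n1 n2]|[_ n1]].
  apply: filterS3 nT n1 n2 => x nT n1 n2 Sx; split => //.
    by move=> T TS; exact: nT.
  by split; [exact: n1|exact: n2].
apply: filterS2 nT n1 => x nT n1 Sx; split => //; last exact: n1.
by move=> T TS; exact: nT.
Qed.

(** Arbitrarily close to [x] the cell [K] has interior, which cannot be covered by its null overlaps
    with two other cells. *)
Lemma cell_overlap_interior K L1 L2 (U : set V) x : cell K x -> nbhs x U ->
  (forall z, U z -> cell K z -> cell L1 z \/ cell L2 z) -> K = L1 \/ K = L2.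
Proof.
move=> Kx xU UKL; apply: contrapT => /not_orP[/eqP KL1 /eqP KL2].
have [z Uz Kz] := polytope_regular (cell_polytope K) Kx (nbhs_interior xU).
have oI : open ((cell K)° `&` U°) by apply: openI; exact: open_interior.
have : (0 < leb ((cell K)° `&` U°))%E by apply: lebesgue_open_gt0 => //; exists z.
apply/negP; rewrite -leNgt.
have mI (L : cellT M) : measurable (cell K `&` cell L).
  by apply: measurableI; exact: cell_measurable.
apply: (@le_trans _ _ (leb ((cell K `&` cell L1) `|` (cell K `&` cell L2)))).
  apply: le_measure.
  - by rewrite inE; exact: open_measurable_rV.
  - by rewrite inE; apply: measurableU; exact: mI.
  - move=> y [/interior_subset Ky /interior_subset Uy].
    by have [?|?] := UKL y Uy Ky; [left|right].
apply: (le_trans (measureU2 _ (mI L1) (mI L2))).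
have e1 : (leb (cell K `&` cell L1) <= 0)%E by rewrite (cell_overlap KL1).
have e2 : (leb (cell K `&` cell L2) <= 0)%E by rewrite (cell_overlap KL2).
by have := leeD e1 e2; rewrite adde0.
Qed.

Lemma near_no_face S x : (forall T, T != S -> ~ face T x) ->
  \forall z \near x, forall T, T != S -> ~ face T z.
Proof.
move=> nT; apply: (@filter_forall _ _ (fun T z => T != S -> ~ face T z) _ (nbhs_filter x)) => T.
have [->|TS] := eqVneq T S; first exact: nearW.
have : nbhs x (~` face T).
  by apply: open_nbhs_nbhs; split; [exact/closed_openC/face_closed|exact: nT].
by apply: filterS => z nTz _.
Qed.

(* Near x, the open half box below the face meets no face and is connected, so
   that it lies in the cell as soon as it meets it. *)
Lemma generic_boundary_normal S x : Kminus S = None -> generic_point S x ->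
  outer_normal_at (cell (Kplus S)) x (normal S).
Proof.
move=> Km [Sx nT]; rewrite Km => -[nn Omn]; split => //.
have Kx := face_Kplus Sx.
have /nbhs_boxP[e e0 xe] : nbhs x
    ([set z | closure Om z <-> dot (normal S) (z - x) <= 0] `&`
     [set z | forall T, T != S -> ~ face T z]).
  by apply: filterI => //; exact: near_no_face.
set nu := normal S in nn Omn xe *.
pose I := box x e `&` [set z | dot nu (z - x) < 0].
have KI z : box x e z -> cell (Kplus S) z -> dot nu (z - x) <= 0.
  by move=> /xe[Oz _] /cell_sub /Oz.
have ox : open (box x e) by rewrite -ball_boxE//; exact: ball_open.
have IK : I `<=` cell (Kplus S).
  apply: connected_sub_closed.
  - apply: convex_connected => y z t [yx yn] [zx zn] t01; split.
      move=> i; rewrite !mxE.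
      rewrite (_ : _ - _ = (1 - t) * (y ord0 i - x ord0 i) + t * (z ord0 i - x ord0 i)); last by ring.
      have := yx i; have := zx i; rewrite !ltr_norml => /andP[z1 z2] /andP[y1 y2].
      by rewrite conv_lt// andbT ltrNl opprD -!mulrN conv_lt// ltrNl.
    rewrite /= (_ : _ - x = (1 - t) *: (y - x) + t *: (z - x)); last first.
      by apply/rowP => i; rewrite !mxE; ring.
    by rewrite dotDr !dotZr conv_lt.
  - exact: cell_closed.
  - move=> z [/xe[_ nTz] zn] Kz; apply: contrapT => nKz.
    have [T Tz] := frontier_cell_face Kz nKz.
    have [TS|/nTz//] := eqVneq T S; rewrite TS in Tz.
    move: zn => /=; rewrite dotBr (face_hyperplane Tz) (face_hyperplane Sx) subrr.
    by rewrite ltxx.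
  - have bx : nbhs x (box x e) by apply/nbhs_boxP; exists e.
    (* An interior point of the cell near [x] may lie on the hyperplane; a small shift along minus
       the normal stays in the cell and goes strictly below. *)
    have [z zx Kz] := polytope_regular (cell_polytope _) Kx bx.
    have zb : nbhs z (box x e `&` cell (Kplus S)).
      by apply: filterI => //; exact: open_nbhs_nbhs.
    have [d d0 [zd Kzd]] := nbhs_shift nu zb.
    exists (z - d *: nu) => //; split => //=.
    rewrite addrAC dotBr dotZr nn mulr1.
    have := KI z zx (interior_subset Kz).
    by lra.
apply/nbhs_boxP; exists e => // z zx; split => [Kz|zn]; first exact: KI.
(* A point on or below the hyperplane is a limit of points strictly below it, and the cell is
   closed. *)
rewrite (closure_id (cell _)).1; last exact: cell_closed.
move=> U zU; have zb : nbhs z (box x e `&` U).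
  by apply: filterI => //; exact: open_nbhs_nbhs.
have [d d0 [zd Uz]] := nbhs_shift nu zb.
exists (z - d *: nu); split => //; apply: IK; split => //=.
by rewrite addrAC dotBr dotZr nn mulr1; lra.
Qed.

Lemma generic_Kplus_normal S x : generic_point S x ->
  outer_normal_at (cell (Kplus S)) x (normal S).
Proof.
move=> gx; case Km : (Kminus S) => [K|]; last exact: generic_boundary_normal.
by case: gx => _ _; rewrite Km => -[].
Qed.

Lemma generic_Kminus_normal S K x : generic_point S x -> Kminus S = Some K ->
  outer_normal_at (cell K) x (- normal S).
Proof. by move=> [_ _] + KS; rewrite KS => -[]. Qed.

(** Near a generic point the adjacent cells fill a neighbourhood, taken relative to the closed
    domain at the boundary, and leave no room for another cell. *)
Lemma generic_cell S x K : generic_point S x -> cell K x ->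
  K = Kplus S \/ Kminus S = Some K.
Proof.
move=> gx Kx; have [_ np] := generic_Kplus_normal gx.
case Km : (Kminus S) => [L|].
  have [_ nm] := generic_Kminus_normal gx Km.
  suff [->|->] : K = Kplus S \/ K = L by [left|right].
  apply: (cell_overlap_interior Kx (filterI np nm)) => z [[_ zp] [_ zm]] _.
  have [z0|z0] := leP (dot (normal S) (z - x)) 0; first by left; exact: zp.
  by right; apply: zm; rewrite dotNl oppr_le0 ltW.
left; case: gx => _ _; rewrite Km => -[_ nO].
suff [] : K = Kplus S \/ K = Kplus S by [].
apply: (cell_overlap_interior Kx (filterI np nO)) => z [[_ zp] [zO _]] Kz.
by left; apply: zp; apply: zO; exact: (cell_sub Kz).
Qed.

End mesh_geometry.

Section ins_continuity.
Context {R : realType} (n : nat) (i : 'I_n.+1) (y : 'rV[R]_n).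

Lemma continuous_ins_rV : continuous (fun t : R => ins_rV i (t, y)).
Proof.
move=> t U /nbhs_boxP[e e0 xU]; exists e => //= v tv; apply: xU => j.
case: (unliftP i j) => [l ->|->]; first by rewrite !ins_rV_lift subrr normr0.
by rewrite !ins_rV_id distrC.
Qed.

End ins_continuity.

(** * The divergence theorem on a cell *)

Section cell_divergence.
Context {R : realType} {m : nat} (Om : set 'rV[R]_m.+2) (M : mesh R m.+2).
Hypothesis Om_dom : polyhedral_lipschitz_domain Om.
Hypothesis M_mesh : is_mesh M Om.
Local Notation V := 'rV[R]_m.+2.
Local Notation leb n := (@lebesgue_rV R n).
Local Notation leb1 := (@lebesgue_measure R).
Implicit Types (K : cellT M) (S : faceT M) (x : V).

(** A face parallel to axis [i] projects along it into a hyperplane, a null set; on any other face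
    the nongeneric points project onto a null set. *)
Lemma ae_generic_line (i : 'I_m.+2) : {ae leb m.+1, forall y S t,
  face S (ins_rV i (t, y)) ->
  normal S ord0 i != 0 /\ generic_point Om S (ins_rV i (t, y))}.
Proof.
apply: (@filter_forall _ _ (fun S y => forall t, face S (ins_rV i (t, y)) ->
  normal S ord0 i != 0 /\ generic_point Om S (ins_rV i (t, y)))) => S.
have [nui|nui] := eqVneq (normal S ord0 i) 0; last first.
  apply: filterS (hyperplane_measure_ae nui (ae_generic_point M_mesh S)).
  move=> y gy t Sy; split => //.
  suff xE : ins_rV i (t, y) = graph_pt (normal S) (offset S) i y.
    by move: Sy; rewrite xE; exact: gy.
  rewrite -(graph_ptK nui (face_hyperplane M_mesh Sy)); congr graph_pt.
  by apply/rowP => l; rewrite mxE ins_rV_lift.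
pose nu' := \row_l normal S ord0 (lift i l).
have nu'0 : nu' != 0.
  apply/eqP => nu'0; move/eqP : (normal_neq0 M_mesh S); apply; apply/rowP => j.
  rewrite mxE; case: (unliftP i j) => [l ->|->//].
  by move/rowP : nu'0 => /(_ l); rewrite !mxE.
have [N [mN N0 AN]] := hyperplane_lebesgue0 nu'0 (@subset_refl _ [set y | dot nu' y = offset S]).
exists N; split => // y /existsNP[t /not_implyP[Sy _]]; apply: AN => /=.
rewrite -(face_hyperplane M_mesh Sy) dot_ins nui mul0r add0r.
by apply: eq_bigr => l _; rewrite mxE.
Qed.

(** [face_sign K S *: normal S] is the outer normal of [K] on [S], and zero if [S] is not a face of
    [K]. *)
Definition face_sign K S : R := (K == Kplus S)%:R - (Kminus S == Some K)%:R.

Lemma Kminus_neq S K : Kminus S = Some K -> K != Kplus S.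
Proof. by case: M_mesh => _ _ /(_ S) + KS; rewrite KS => -[/eqP]. Qed.

Lemma generic_face_normal S x K : generic_point Om S x -> face_sign K S != 0 ->
  (face_sign K S = 1 \/ face_sign K S = -1) /\
  outer_normal_at (cell K) x (face_sign K S *: normal S).
Proof.
rewrite /face_sign => gx; have [->|KS] := eqVneq K (Kplus S).
  have -> : (Kminus S == Some (Kplus S)) = false.
    by apply/negP => /eqP/Kminus_neq; rewrite eqxx.
  rewrite subr0 scale1r => _; split; first by left.
  exact: (generic_Kplus_normal M_mesh gx).
have [KS'|] := eqVneq (Kminus S) (Some K); last by rewrite subrr eqxx.
rewrite sub0r scaleN1r => _; split; first by right.
exact: (generic_Kminus_normal gx).
Qed.

Lemma generic_face_sign S x K : generic_point Om S x -> cell K x -> face_sign K S != 0.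
Proof.
move=> gx Kx; rewrite /face_sign.
have [->|KS] := generic_cell M_mesh gx Kx.
  have -> : (Kminus S == Some (Kplus S)) = false.
    by apply/negP => /eqP/Kminus_neq; rewrite eqxx.
  by rewrite eqxx subr0 oner_eq0.
by rewrite (negbTE (Kminus_neq KS)) KS eqxx sub0r oppr_eq0 oner_eq0.
Qed.

Section line.
Variables (i : 'I_m.+2) (K : cellT M) (p : mpoly m.+2 R) (y : 'rV[R]_m.+1).
Hypothesis gy : forall S t, face S (ins_rV i (t, y)) ->
  normal S ord0 i != 0 /\ generic_point Om S (ins_rV i (t, y)).

Let gr S := graph_pt (normal S) (offset S) i y.
Let tS S := gr S ord0 i.
Let grE S : gr S = ins_rV i (tS S, y).
Proof. by rewrite /tS /gr graph_pt_ins ins_rV_id. Qed.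

Let P S := `[< face S (gr S) >] && (face_sign K S != 0).
Let coef S := face_sign K S * Num.sg (normal S ord0 i).

(** A generic point lies on a single face. Hence distinct faces give distinct endpoints, and the
    outer sign is a function of the parameter [t]. *)
Let tS_inj S T : P S -> P T -> tS S = tS T -> S = T.
Proof.
move=> /andP[/asboolP Sx _] /andP[/asboolP Tx _] tST.
apply/eqP/negPn/negP => ST; move: Sx Tx; rewrite !grE tST => Sx Tx.
by have [_ [_ /(_ S ST)]] := gy Tx.
Qed.

Let sg t := if [pick T | P T && (tS T == t)] is Some T then coef T else 0.

Let sgE S : P S -> sg (tS S) = coef S.
Proof.
move=> PS; rewrite /sg; case: pickP => [T /andP[PT /eqP TS]|/(_ S)].
  by rewrite (tS_inj PT PS TS).
by rewrite PS eqxx.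
Qed.

Let A := [set t : R | cell K (ins_rV i (t, y))].

Lemma line_section_compact : compact A.
Proof.
have /bounded_sub_box[e e0 Ke] := cell_bounded Om_dom M_mesh K.
apply: (@subclosed_compact _ _ `[- e, e]).
- apply: (@preimage_closed _ _ (fun t : R => ins_rV i (t, y)) (cell K)).
    by move=> t _; exact: continuous_ins_rV.
  exact: (cell_closed M_mesh).
- exact: segment_compact.
- move=> t /Ke/(_ i); rewrite ins_rV_id mxE subr0 /= in_itv/= => te.
  by rewrite -ler_norml ltW.
Qed.

(** [Rintegral_flat] on one line. The sum runs over all faces: those missed by the line vanish
    through the restriction, those not adjacent to [K] through [face_sign]. *)
Lemma Rintegral_line_section :
  \int[leb1]_(t in A) peval (mderiv i p) (ins_rV i (t, y)) =
  \sum_S face_sign K S * Num.sg (normal S ord0 i) *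
    ((fun y => peval p (graph_pt (normal S) (offset S) i y)) \_
      (graph_pt (normal S) (offset S) i @^-1` (face S))) y.
Proof.
pose s := [seq tS T | T <- enum P].
rewrite (@Rintegral_flat _ (fun t => peval p (ins_rV i (t, y))) _ A sg _ _ _ s).
- rewrite /s big_map big_enum_cond /= big_mkcond /=; apply: eq_bigr => S _.
  rewrite patchE andbT unfold_in; case: ifPn => [PS|].
    rewrite (sgE PS) -grE; case/andP : PS => /asboolP Sx _.
    by rewrite ifT//; apply/mem_set.
  rewrite negb_and => /orP[/asboolPn nSx|/negPn/eqP ->]; last by rewrite !mul0r.
  by rewrite ifF ?mulr0//; apply/negP => /set_mem.
- by move=> t; exact: is_derive_peval_ins.
- move=> t; apply: (@continuous_comp _ _ _ (fun t : R => ins_rV i (t, y))).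
    exact: continuous_ins_rV.
  exact: continuous_peval.
- exact: line_section_compact.
- rewrite map_inj_in_uniq ?enum_uniq// => S T.
  by rewrite !mem_enum; exact: tS_inj.
(* An endpoint of the section cannot be interior to the cell, since lines are continuous; so it lies
   on a face. *)
- move=> t At nAt; have [|S Sx] := @frontier_cell_face _ _ _ _ M_mesh K _ At.
    move=> /(@continuous_ins_rV _ _ i y t) Ki; apply: nAt.
    by apply: filterS Ki => v.
  have [nui gx] := gy Sx.
  have tE : ins_rV i (t, y) = gr S.
    rewrite -(graph_ptK nui (face_hyperplane M_mesh Sx)) /gr; congr graph_pt.
    by apply/rowP => l; rewrite mxE ins_rV_lift.
  have -> : t = tS S by rewrite /tS -tE ins_rV_id.
  apply: map_f; rewrite mem_enum; apply/andP; split; last exact: generic_face_sign gx At.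
  by apply/asboolP; rewrite -tE.
- move=> _ /mapP[S + ->]; rewrite mem_enum => PS; rewrite /flat_at (sgE PS).
  case/andP : PS => /asboolP; rewrite grE => Sx fs.
  have [nui gx] := gy Sx.
  have [fs1 [_ nK]] := generic_face_normal gx fs.
  have {nK} nA : \forall v \near tS S, A v <-> coef S * (v - tS S) <= 0.
    have nK' : \forall v \near tS S, cell K (ins_rV i (v, y)) <->
        dot (face_sign K S *: normal S) (ins_rV i (v, y) - ins_rV i (tS S, y)) <= 0.
      exact: (continuous_ins_rV nK).
    apply: filterS nK' => v; rewrite /A /= => ->.
    rewrite dotBr !dot_ins opprD addrACA subrr addr0 -mulrBr mxE.
    rewrite (_ : _ * _ * (v - tS S) = `|normal S ord0 i| * (coef S * (v - tS S))).
      by rewrite pmulr_rle0// normr_gt0.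
    by rewrite /coef {1}[normal S ord0 i]numEsg; ring.
  have sgp : Num.sg (normal S ord0 i) = 1 \/ Num.sg (normal S ord0 i) = -1.
    by case: sgrP nui => // _ _; [left|right].
  rewrite -/(coef S); have : coef S = 1 \/ coef S = -1.
    rewrite /coef; case: fs1 => ->; case: sgp => ->;
      rewrite ?mulrNN ?mul1r ?mulr1; by [left|right].
  case=> cE; rewrite cE in nA *; [left|right]; split => //;
    apply: filterS nA => v ->; rewrite ?mul1r ?mulN1r ?oppr_le0.
    by rewrite subr_le0.
  by rewrite subr_ge0.
Qed.

End line.

Lemma peval_bounded (p : mpoly m.+2 R) (D : set V) : bounded_set D ->
  exists2 b : R, 0 <= b & forall x, D x -> `|peval p x| <= b.
Proof.
move=> bD; have cD : compact (closure D).
  by apply: bounded_closed_compact; [exact: closure_bounded|exact: closed_closure].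
have /compact_bounded[b [_ Db]] : compact (peval p @` closure D).
  apply: continuous_compact => //; apply: continuous_subspaceT.
  exact: continuous_peval.
exists (`|b| + 1) => // x Dx; apply: (Db (`|b| + 1)).
  by rewrite (le_lt_trans (ler_norm _))// ltrDl.
by exists x => //; exact: subset_closure.
Qed.

Lemma integrable_peval (p : mpoly m.+2 R) (D : set V) :
  measurable D -> bounded_set D -> (leb m.+2).-integrable D (EFin \o peval p).
Proof.
move=> mD bD; have [b _ Db] := peval_bounded p bD.
apply: (bounded_integrable mD _ _ Db); last exact: measurable_peval.
exact: lebesgue_bounded.
Qed.

(* Almost every line in direction i meets the faces in finitely many generic
   points, so that Fubini reduces this to the fundamental theorem of calculus. *)
Lemma cell_divergence (i : 'I_m.+2) K (p : mpoly m.+2 R) :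
  \int[leb m.+2]_(x in cell K) peval (mderiv i p) x =
  \sum_S face_sign K S * normal S ord0 i * \int[surf S]_(x in face S) peval p x.
Proof.
pose q := mderiv i p.
have mK := cell_measurable M_mesh K.
have mf : measurable_fun setT (peval q \_ (cell K)).
  apply/(measurable_restrictT _ _).1 => //; exact: measurable_peval.
have fE y : (fun t => (peval q \_ (cell K)) (ins_rV i (t, y))) =
   (fun t => peval q (ins_rV i (t, y))) \_ [set t | cell K (ins_rV i (t, y))].
  by apply/funext => t; rewrite !patchE; congr (if _ then _ else _); apply/idP/idP;
    rewrite !inE.
have iF : (leb m.+2).-integrable setT (EFin \o (peval q \_ (cell K))).
  rewrite -restrict_EFin; apply: (integrable_mkcond _ mK).1.
  exact: (integrable_peval _ mK (cell_bounded Om_dom M_mesh K)).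
have iFy y : leb1.-integrable setT (fun t => ((peval q \_ (cell K)) (ins_rV i (t, y)))%:E).
  rewrite (_ : (fun _ => _) = EFin \o (fun t => (peval q \_ (cell K)) (ins_rV i (t, y))))//.
  rewrite fE -restrict_EFin.
  have cA : compact [set t : R | cell K (ins_rV i (t, y))] by exact: line_section_compact.
  have mA : measurable ([set t | cell K (ins_rV i (t, y))] : set (measurableTypeR R)).
    exact: compact_measurable cA.
  apply: (integrable_mkcond _ mA).1.
  apply: continuous_compact_integrable => //; apply: continuous_subspaceT => t.
  apply: (@continuous_comp _ _ _ (fun t : R => ins_rV i (t, y))).
    exact: continuous_ins_rV.
  exact: continuous_peval.
rewrite Rintegral_mkcond (Rintegral_ins mf iF iFy).
pose h S := (fun y => peval p (graph_pt (normal S) (offset S) i y)) \_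
      (graph_pt (normal S) (offset S) i @^-1` (face S)).
have ih S : (leb m.+1).-integrable setT (EFin \o h S).
  rewrite -restrict_EFin; have mS := measurable_preimage_graph (normal S) (offset S) i (face_measurable M_mesh S).
  apply: (integrable_mkcond _ mS).1.
  have [c c0 Sc] := peval_bounded p (face_bounded Om_dom M_mesh S).
  apply: (@bounded_integrable _ _ _ _ _ mS _ c).
  - apply: lebesgue_bounded => //; apply: bounded_preimage_graph.
    exact: (face_bounded Om_dom M_mesh).
  - apply: measurable_funTS.
    apply: (@measurableT_comp _ _ _ _ _ _ (peval p)); last exact: measurable_graph_pt.
    exact: measurable_peval.
  - by move=> y; exact: Sc.
have iZ S : (leb m.+1).-integrable setT
    (EFin \o (fun y => face_sign K S * Num.sg (normal S ord0 i) * h S y)).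
  exact: (integrableZl measurableT (face_sign K S * Num.sg (normal S ord0 i)) (ih S)).
rewrite (@ae_eq_Rintegral _ _ _ _ _ measurableT _ (fun y => \sum_S face_sign K S * Num.sg (normal S ord0 i) * h S y)).
- rewrite Rintegral_sum.
    apply: eq_bigr => S _; rewrite RintegralZl// -Rintegral_mkcond -!mulrA.
    (* A face parallel to axis [i] contributes zero to both sides. *)
    have [->|nui] := eqVneq (normal S ord0 i) 0; first by rewrite sgr0 !mul0r.
    congr (_ * _); have [c c0 Sc] := peval_bounded p (face_bounded Om_dom M_mesh S).
    rewrite -(Rintegral_hyperplane _ nui _ _ _ Sc)//.
    - exact: (face_measurable M_mesh).
    - exact: (face_bounded Om_dom M_mesh).
    - exact: measurable_peval.
  exact: measurableT.
  by move=> S _; exact: iZ.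
- exact: (measurable_Rintegral_ins mf iF iFy).
- apply/measurable_EFinP; apply: (measurable_int (leb m.+1)).
  by apply: (integrable_Rsum measurableT) => S _; exact: iZ.
- apply: filterS (ae_generic_line i) => y gy _.
  by rewrite fE -Rintegral_mkcond (Rintegral_line_section K p gy).
Qed.

End cell_divergence.

(** * Bounded measurable functions *)

Section bounded_measurable_functions.
Context d (T : measurableType d) (R : realType) (mu : {measure set T -> \bar R}).
Implicit Types (D : set T) (f g : T -> R).

(** A class closed under products, unlike integrability, and integrable on sets of finite measure;
    it contains the piecewise polynomials on the domain and their traces on faces. *)
Definition bounded_measurable D f :=
  measurable_fun D f /\ exists b : R, forall x, D x -> `|f x| <= b.

Lemma bounded_measurable_integrable D f : measurable D -> (mu D < +oo)%E ->
  bounded_measurable D f -> mu.-integrable D (EFin \o f).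
Proof. by move=> mD Doo [mf [b fb]]; exact: bounded_integrable fb. Qed.

Lemma bounded_measurable_cst D (c : R) : bounded_measurable D (fun=> c).
Proof. by split; [exact: measurable_cst|exists `|c|]. Qed.

Lemma bounded_measurableD D f g : bounded_measurable D f -> bounded_measurable D g ->
  bounded_measurable D (fun x => f x + g x).
Proof.
move=> [mf [a fa]] [mg [b gb]]; split; first exact: measurable_funD.
by exists (a + b) => x Dx; rewrite (le_trans (ler_normD _ _))// lerD ?fa ?gb.
Qed.

Lemma bounded_measurableM D f g : bounded_measurable D f -> bounded_measurable D g ->
  bounded_measurable D (fun x => f x * g x).
Proof.
move=> [mf [a fa]] [mg [b gb]]; split; first exact: measurable_funM.
by exists (a * b) => x Dx; rewrite normrM ler_pM ?fa ?gb.
Qed.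

Lemma bounded_measurableN D f : bounded_measurable D f -> bounded_measurable D (fun x => - f x).
Proof.
move=> bf; under eq_fun do rewrite -mulN1r.
by apply: bounded_measurableM => //; exact: bounded_measurable_cst.
Qed.

Lemma bounded_measurableB D f g : bounded_measurable D f -> bounded_measurable D g ->
  bounded_measurable D (fun x => f x - g x).
Proof. by move=> bf bg; apply: bounded_measurableD => //; exact: bounded_measurableN. Qed.

Lemma bounded_measurable_sum D (I : Type) (s : seq I) (P : pred I) (F : I -> T -> R) :
  (forall i, P i -> bounded_measurable D (F i)) ->
  bounded_measurable D (fun x => \sum_(i <- s | P i) F i x).
Proof.
move=> bF; elim: s => [|i s IH].
  by under eq_fun do rewrite big_nil; exact: bounded_measurable_cst.
case Pi : (P i); under eq_fun do rewrite big_cons Pi; last exact: IH.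
by apply: bounded_measurableD => //; exact: bF.
Qed.

Lemma integrable_bounded_mul D f g : measurable D -> bounded_measurable D f ->
  mu.-integrable D (EFin \o g) -> mu.-integrable D (EFin \o (fun x => f x * g x)).
Proof.
move=> mD [mf [b fb]] ig.
have bf : [bounded f x | x in D].
  exists b; split; first exact: num_real.
  by move=> c bc x Dx /=; rewrite (le_trans (fb x Dx))// ltW.
exact: (integrableMr mD mf bf ig).
Qed.

(** The chosen index is the first one in the enumeration, so the function is an iterated conditional
    on measurable sets. *)
Lemma measurable_fun_pick (I : finType) (A : I -> set T) (f : I -> T -> R) :
  (forall i, measurable (A i)) -> (forall i, measurable_fun setT (f i)) ->
  measurable_fun setT
    (fun x => if [pick i | `[< A i x >]] is Some i then f i x else 0).
Proof.
move=> mA mf.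
pose F (s : seq I) x := if ohead [seq i <- s | `[< A i x >]] is Some i then f i x else 0.
have mF s : measurable_fun setT (F s).
  elim: s => [|i s IH]; first exact: measurable_cst.
  rewrite (_ : F _ = fun x => if x \in A i then f i x else F s x).
    apply: measurable_fun_ifT => //; apply: (measurable_fun_bool true).
    rewrite setTI (_ : _ @^-1` _ = A i)//.
    by apply/seteqP; split => x /=; [move=> /set_mem|move=> /mem_set].
  by apply/funext => x; rewrite /F /= (_ : (x \in A i) = `[< A i x >])//; case: ifP.
rewrite (_ : (fun _ => _) = F (enum I))//; apply/funext => x; rewrite /F.
by rewrite enumT.
Qed.

End bounded_measurable_functions.

(** * Piecewise polynomials *)

Section pointwise_pwpoly.
Context {R : realType} {n : nat} (M : mesh R n).
Implicit Types (v w : pwpoly M) (F : 'I_n -> pwpoly M) (x : 'rV[R]_n).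

Lemma pwevalD v w x : pweval (fun K => v K + w K) x = pweval v x + pweval w x.
Proof. by rewrite /pweval; case: pickP => [K _|_]; rewrite ?addr0// /peval mevalD. Qed.

Lemma pwevalZ (a : R) v x : pweval (fun K => a *: v K) x = a * pweval v x.
Proof. by rewrite /pweval; case: pickP => [K _|_]; rewrite ?mulr0// /peval mevalZ. Qed.

Lemma pweval0 x : pweval (fun K : cellT M => 0) x = 0.
Proof. by rewrite /pweval; case: pickP => // K _; rewrite /peval meval0. Qed.

Lemma pweval_bounded v (D : set 'rV[R]_n) : bounded_set D ->
  (forall p, exists2 b : R, 0 <= b & forall x, D x -> `|peval p x| <= b) ->
  exists b : R, forall x, D x -> `|pweval v x| <= b.
Proof.
move=> bD pb.
pose b K := s2val (cid2 (pb (v K))).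
have b0 K : 0 <= b K by rewrite /b; case: cid2.
exists (\sum_K b K) => x Dx; rewrite /pweval; case: pickP => [K _|_].
  rewrite (bigD1 K)//= (le_trans (_ : _ <= b K))//; last by rewrite lerDl sumr_ge0.
  by rewrite /b; case: cid2 => /= c _; exact.
by rewrite normr0 sumr_ge0.
Qed.

End pointwise_pwpoly.

Section euclidean_continuity.
Context {R : realType} {n : nat}.
Implicit Types (x y : 'rV[R]_n).

Lemma continuous_enorm : continuous (@enorm R n).
Proof.
move=> x; apply: (@continuous_comp _ _ _ (fun x : 'rV[R]_n => dot x x)).
  apply: continuous_bigsum => i y.
  by apply: continuousM; exact: coord_continuous.
exact: sqrt_continuous.
Qed.

Lemma enorm0 : enorm (0 : 'rV[R]_n) = 0.
Proof. by rewrite /enorm /dot big1 ?sqrtr0// => i _; rewrite mxE mul0r. Qed.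

Lemma enorm_lipschitz_continuous (g : 'rV[R]_n -> R) (L : R) :
  (forall y z, `|g y - g z| <= L * enorm (y - z)) -> continuous g.
Proof.
move=> gL; have csub (x : 'rV[R]_n) : continuous (fun y : 'rV[R]_n => x - y).
  by move=> z; apply: continuousB; [exact: cst_continuous|move=> ?; exact: cvg_id].
move=> x U /nbhs_ballP[e /= e0 eU].
have L0 : 0 < `|L| + 1 by rewrite ltr_wpDl.
have : enorm (x - y) @[y --> x] --> enorm (0 : 'rV[R]_n).
  rewrite -(subrr x); apply: (@continuous_comp _ _ _ (fun y => x - y) _ x).
    exact: csub.
  exact: continuous_enorm.
rewrite enorm0 => /(_ (ball 0 (e / (`|L| + 1)))) h.
have {h} : \forall y \near x, ball 0 (e / (`|L| + 1)) (enorm (x - y)).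
  by apply: h; apply: nbhsx_ballx; rewrite divr_gt0.
apply: filterS => y; rewrite /ball/= sub0r normrN => yx; apply: eU.
rewrite /ball/= (le_lt_trans (gL _ _))// (le_lt_trans (ler_norm _))// normrM.
rewrite (@le_lt_trans _ _ ((`|L| + 1) * `|enorm (x - y)|))//.
  by rewrite ler_wpM2r// lerDl.
by rewrite mulrC -ltr_pdivlMr.
Qed.

(** Just above the graph that bounds it locally, a Lipschitz domain has no points; hence a frontier
    point is not interior to the closure. *)
Lemma lipschitz_domain_interior (Om : set 'rV[R]_n) x : lipschitz_domain Om ->
  (closure Om)° x -> Om x.
Proof.
move=> [oOm _ _ _ fr] iOm; apply: contrapT => nOm.
have [|e [g [L [ee gL]]]] := fr x.
  split; first exact: interior_subset iOm.
  by move=> /interior_subset.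
have cg := enorm_lipschitz_continuous gL.
pose phi y := dot y e - g (y - dot y e *: e).
have cdot : continuous (fun y : 'rV[R]_n => dot y e).
  rewrite (_ : (fun _ => _) = dot e); first exact: continuous_dot.
  by apply/funext => y; rewrite dotC.
have cphi : continuous phi.
  move=> y; apply: (@continuousB _ _ _ (fun y => dot y e)
    (fun y => g (y - dot y e *: e))); first exact: cdot.
  apply: (@continuous_comp _ _ _ (fun y : 'rV[R]_n => y - dot y e *: e)); last exact: cg.
  apply: (@continuousB _ _ _ id (fun y => dot y e *: e)); first by move=> ?; exact: cvg_id.
  by apply: continuousZr_tmp; exact: cdot.
move=> nearx.
have phix : 0 <= phi x.
  rewrite subr_ge0 leNgt; apply/negP => ltx; apply: nOm.
  by have := nbhs_singleton nearx; move=> [_]; apply.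
(* The point [x] lies on or above the graph. Moving it by [d] along the unit vector [e] raises it
   without changing its projection, so [phi] becomes positive. *)
have [d d0 [Ox nx]] : exists2 d : R, 0 < d &
    ((closure Om) `&` nbhs^~ [set y | Om y <-> dot y e < g (y - dot y e *: e)]) (x - d *: (- e)).
  apply: nbhs_shift; apply: filterI => //.
  exact: nbhs_interior nearx.
rewrite scalerN opprK in Ox nx.
have phid : 0 < phi (x + d *: e).
  rewrite /phi dotC dotDr dotZr ee mulr1 scalerDl opprD addrACA.
  rewrite [X in x - _ + X](_ : _ = 0) ?subrr ?addr0//.
  rewrite dotC; move: phix; rewrite /phi; lra.
have [y [Oy [ny py]]] := Ox _ (filterI nx (cphi _ _ (lt_nbhsr phid))).
move: py; rewrite /= /phi subr_gt0 => py.
by have /ny := Oy; rewrite ltNge ltW.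
Qed.

End euclidean_continuity.

(** * Integrals over the domain as sums over the cells *)

Section domain_integral.
Context {R : realType} {m : nat} (Om : set 'rV[R]_m.+2) (M : mesh R m.+2).
Hypothesis Om_dom : polyhedral_lipschitz_domain Om.
Hypothesis M_mesh : is_mesh M Om.
Local Notation V := 'rV[R]_m.+2.
Local Notation leb := (@lebesgue_rV R m.+2).
Implicit Types (K : cellT M) (S : faceT M) (x : V).

Lemma domain_measurable : measurable Om.
Proof. by apply: open_measurable_rV; exact: domain_open Om_dom. Qed.

Lemma domain_finite : (leb Om < +oo)%E.
Proof. exact: lebesgue_bounded domain_measurable (domain_bounded Om_dom). Qed.

Lemma domain_cell x : Om x -> exists K, cell K x.
Proof.
move=> Ox; have : closure Om x by exact: subset_closure.
by case: M_mesh => -[_ _ _ <-] _ _ [K _ Kx]; exists K.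
Qed.

Lemma ae_not_face : {ae leb, forall x S, ~ face S x}.
Proof.
apply: (@filter_forall _ _ (fun S x => ~ face S x)) => S.
have [N [mN N0 SN]] := hyperplane_lebesgue0 (normal_neq0 M_mesh S)
  (fun x (Sx : face S x) => face_hyperplane M_mesh Sx).
by exists N; split => // x /= /contrapT Sx; exact: SN.
Qed.

Lemma cell_domain K x : cell K x -> (forall S, ~ face S x) -> Om x.
Proof.
move=> Kx nS; have [Om_lip _] := Om_dom.
apply: (lipschitz_domain_interior Om_lip).
apply: (@interiorS _ (cell K)); first exact: (cell_sub M_mesh).
by apply: contrapT => /(frontier_cell_face M_mesh Kx)[S]; exact: nS.
Qed.

Lemma ae_cell_uniq : {ae leb, forall x K L, cell K x -> cell L x -> K = L}.
Proof.
apply: (@filter_forall _ _ (fun K x => forall L, cell K x -> cell L x -> K = L)) => K.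
apply: (@filter_forall _ _ (fun L x => cell K x -> cell L x -> K = L)) => L.
have [->|KL] := eqVneq K L; first exact: aeW.
exists (cell K `&` cell L); split.
- by apply: measurableI; exact: (cell_measurable M_mesh).
- exact: (cell_overlap M_mesh).
- by move=> x /= /not_implyP[Kx /not_implyP[Lx _]].
Qed.

Lemma ae_pweval : {ae leb, forall x, forall (v : pwpoly M) K, cell K x ->
  pweval v x = peval (v K) x}.
Proof.
apply: filterS ae_cell_uniq => x xu v K Kx; rewrite /pweval.
case: pickP => [L /asboolP Lx|/(_ K)]; first by rewrite (xu L K).
by move=> /asboolP.
Qed.

Lemma measurable_pweval (v : pwpoly M) (D : set V) : measurable_fun D (pweval v).
Proof.
apply: measurable_funTS; apply: measurable_fun_pick => K.
  exact: (cell_measurable M_mesh).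
exact: measurable_peval.
Qed.

Lemma bounded_measurable_pweval (v : pwpoly M) : bounded_measurable Om (pweval v).
Proof.
split; first exact: measurable_pweval.
have bO := domain_bounded Om_dom.
by apply: (pweval_bounded v bO) => q; exact: peval_bounded.
Qed.

Lemma bounded_measurable_peval (q : mpoly m.+2 R) (D : set V) :
  bounded_set D -> bounded_measurable D (peval q).
Proof.
move=> bD; split; first exact: measurable_peval.
by have [b _ Db] := peval_bounded q bD; exists b.
Qed.

Lemma integrable_domain (f : V -> R) :
  bounded_measurable Om f -> leb.-integrable Om (EFin \o f).
Proof. exact: (bounded_measurable_integrable domain_measurable domain_finite). Qed.

(** Cells overlap in null sets and, off the faces, are contained in the open domain, not only in its
    closure. *)
Lemma Rintegral_domain_cells (f : V -> R) (g : cellT M -> V -> R) :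
  measurable_fun Om f -> (forall K, bounded_measurable (cell K) (g K)) ->
  {ae leb, forall x, Om x -> forall K, cell K x -> f x = g K x} ->
  \int[leb]_(x in Om) f x = \sum_K \int[leb]_(x in cell K) g K x.
Proof.
move=> mf bg fg; have mK K := cell_measurable M_mesh K.
have mO := domain_measurable.
have iK K : leb.-integrable (cell K) (EFin \o g K).
  apply: bounded_measurable_integrable => //.
  exact: lebesgue_bounded (mK K) (cell_bounded Om_dom M_mesh K).
have iT K : leb.-integrable setT (EFin \o (g K \_ (cell K))).
  by rewrite -restrict_EFin; apply: (integrable_mkcond _ (mK K)).1.
have iO K : leb.-integrable Om (EFin \o (g K \_ (cell K))).
  exact: (integrableS measurableT mO (@subsetT _ Om) (iT K)).
transitivity (\int[leb]_(x in Om) \sum_K (g K \_ (cell K)) x).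
  apply: ae_eq_Rintegral => //.
    apply/measurable_EFinP; apply: (measurable_int leb).
    by apply: (integrable_Rsum mO) => K _; exact: iO.
  apply: filterS2 fg ae_cell_uniq => x fg xu Ox.
  have [K Kx] := domain_cell Ox.
  rewrite (fg Ox K Kx) (bigD1 K)//= big1 => [|L LK].
    by rewrite addr0 patchE mem_set.
  rewrite patchE; case: ifPn => // /set_mem Lx.
  by move: LK; rewrite (xu L K Lx Kx) eqxx.
rewrite (Rintegral_sum mO) => [|K _]; last exact: iO.
apply: eq_bigr => K _; rewrite [RHS]Rintegral_mkcond [LHS]Rintegral_mkcond.
apply: (ae_eq_Rintegral measurableT).
- apply: (measurable_restrictT _ mO).1; apply/measurable_EFinP.
  exact: (measurable_int leb (iO K)).
- by apply/measurable_EFinP; exact: (measurable_int leb (iT K)).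
- apply: filterS ae_not_face => x nS _; rewrite [LHS]patchE.
  case: ifPn => // /negP nO; rewrite patchE; case: ifPn => // /set_mem Kx.
  by exfalso; apply: nO; rewrite mem_set//; exact: cell_domain Kx nS.
Qed.

End domain_integral.

(* For G the Gram matrix of a basis, c is the Riesz representative of l. *)
Lemma finite_riesz (R : realType) (I : finType) (G : I -> I -> R) (l : I -> R) :
  (forall c : I -> R, (forall j, \sum_i c i * G i j = 0) -> forall i, c i = 0) ->
  exists c : I -> R, forall j, \sum_i c i * G i j = l j.
Proof.
move=> G0; pose A : 'M[R]_#|I| := \matrix_(i, j) G (enum_val i) (enum_val j).
pose b : 'rV[R]_#|I| := \row_j l (enum_val j).
have mulA (u : 'rV[R]_#|I|) j : \sum_i u ord0 (enum_rank i) * G i j = (u *m A) ord0 (enum_rank j).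
  rewrite mxE (reindex_onto (@enum_val I I) (@enum_rank I)) /=; last by move=> i _; rewrite enum_rankK.
  apply: eq_big => [i|i _]; first by rewrite enum_valK eqxx.
  by rewrite mxE enum_valK enum_rankK.
have uA : A \in unitmx.
  rewrite -row_free_unit -kermx_eq0; apply/rowV0P => u /sub_kermxP uA0.
  apply/rowP => i; rewrite mxE -[i]enum_valK.
  apply: (G0 (fun i => u ord0 (enum_rank i))) => j.
  by rewrite mulA uA0 mxE.
exists (fun i => (b *m invmx A) ord0 (enum_rank i)) => j.
by rewrite mulA mulmxKV// mxE enum_rankK.
Qed.

Section pwpoly_space.
Context {R : realType} {n : nat} (M : mesh R n).
Implicit Types (v w : pwpoly M) (x : 'rV[R]_n) (S : faceT M) (K : cellT M).

Lemma P_lin k v w (a : R) : P_ k v -> P_ k w -> P_ k (fun K => a *: v K + w K).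
Proof.
move=> Pv Pw K; rewrite (leq_trans (msizeD_le _ _))// geq_max Pw andbT.
exact: leq_trans (msizeZ_le _ _) (Pv K).
Qed.

Lemma P_0 k : P_ k (fun K : cellT M => 0).
Proof. by move=> K; rewrite mmeasure0. Qed.

Lemma P_sum k (I : Type) (s : seq I) (c : I -> R) (e : I -> pwpoly M) :
  (forall i, P_ k (e i)) -> P_ k (fun K => \sum_(i <- s) c i *: e i K).
Proof.
move=> Pe; elim: s => [|i s IH].
  by under eq_fun do rewrite big_nil; exact: P_0.
by under eq_fun do rewrite big_cons; apply: P_lin.
Qed.

Lemma pweval_lin v w (a : R) x :
  pweval (fun K => a *: v K + w K) x = a * pweval v x + pweval w x.
Proof. by rewrite (pwevalD (fun K => a *: v K)) pwevalZ. Qed.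

Lemma jump_lin S v w (a : R) x :
  jump S (fun K => a *: v K + w K) x = a * jump S v x + jump S w x.
Proof.
by rewrite /jump; case: Kminus => [L|]; rewrite /peval !mevalD !mevalZ; ring.
Qed.

Lemma pweval_sum (I : Type) (s : seq I) (P : pred I) (e : I -> pwpoly M) x :
  pweval (fun K => \sum_(i <- s | P i) e i K) x = \sum_(i <- s | P i) pweval (e i) x.
Proof.
rewrite /pweval; case: pickP => [K _|_]; last by rewrite big1.
by rewrite /peval raddf_sum.
Qed.

Definition linear_on k (l : pwpoly M -> R) := forall (a : R) v w,
  P_ k v -> P_ k w -> l (fun K => a *: v K + w K) = a * l v + l w.

Lemma linear_on0 k l : linear_on k l -> l (fun=> 0) = 0.
Proof.
move=> ll; have := ll (-1) _ _ (P_0 k) (P_0 k).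
by rewrite (_ : (fun K => _) = fun=> 0); [lra|apply/funext => K; rewrite scaler0 addr0].
Qed.

Lemma linear_on_sum k l (I : Type) (s : seq I) (c : I -> R) (e : I -> pwpoly M) :
  linear_on k l -> (forall i, P_ k (e i)) ->
  l (fun K => \sum_(i <- s) c i *: e i K) = \sum_(i <- s) c i * l (e i).
Proof.
move=> ll Pe.
have l0 := linear_on0 ll.
elim: s => [|i s IH].
  by rewrite big_nil -[RHS]l0; congr l; apply/funext => K; rewrite big_nil.
rewrite big_cons -IH -ll//; last exact: P_sum.
by congr l; apply/funext => K; rewrite big_cons.
Qed.

Definition pwbasis k (j : cellT M * bmultinom n k.+1) : pwpoly M :=
  fun K => if K == j.1 then mpolyX R (bmnm j.2) else 0.

Lemma P_pwbasis k j : P_ k (@pwbasis k j).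
Proof.
move=> K; rewrite /pwbasis; case: ifP => _; last by rewrite mmeasure0.
by rewrite msizeX bmdeg.
Qed.

Lemma pwbasis_sumE k (c : cellT M * bmultinom n k.+1 -> R) K :
  \sum_j c j *: pwbasis j K = \sum_mm c (K, mm) *: mpolyX R (bmnm mm).
Proof.
rewrite (eq_bigr (fun j => c (j.1, j.2) *: @pwbasis k (j.1, j.2) K)); last by case.
rewrite -(pair_bigA _ (fun L mm => c (L, mm) *: @pwbasis k (L, mm) K)) /=.
rewrite (bigD1 K)//= [X in _ + X]big1 => [|L LK].
  by rewrite addr0; apply: eq_bigr => mm _; rewrite /pwbasis eqxx.
by rewrite big1// => mm _; rewrite /pwbasis /= eq_sym (negbTE LK) scaler0.
Qed.

Lemma pwbasis_span k v : P_ k v ->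
  v = fun K => \sum_(j : cellT M * bmultinom n k.+1) mcoeff (bmnm j.2) (v j.1) *: pwbasis j K.
Proof.
move=> Pv; apply/funext => K.
by rewrite (pwbasis_sumE (fun j => mcoeff (bmnm j.2) (v j.1))) /= -mpolywE//; exact: Pv.
Qed.

Lemma pwbasis_free k (c : cellT M * bmultinom n k.+1 -> R) :
  (forall K, \sum_j c j *: pwbasis j K = 0) -> forall j, c j = 0.
Proof.
move=> c0 [K mm]; have := c0 K; rewrite pwbasis_sumE => /(congr1 (mcoeff (bmnm mm))).
rewrite raddf_sum mcoeff0 (bigD1 mm)//= big1 ?addr0 => [|l lm].
  by rewrite mcoeffZ mcoeffX eqxx mulr1.
by rewrite mcoeffZ mcoeffX (inj_eq val_inj) (negbTE lm) mulr0.
Qed.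

End pwpoly_space.

Section riesz.
Context {R : realType} {m : nat} (Om : set 'rV[R]_m.+2) (M : mesh R m.+2).
Hypothesis Om_dom : polyhedral_lipschitz_domain Om.
Hypothesis M_mesh : is_mesh M Om.
Local Notation V := 'rV[R]_m.+2.
Local Notation leb := (@lebesgue_rV R m.+2).
Implicit Types (K : cellT M) (S : faceT M) (x : V) (v w : pwpoly M).

Definition pwdot v w : R := \int[leb]_(x in Om) (pweval v x * pweval w x).

Lemma linear_on_pwdot k v : linear_on k (pwdot v).
Proof.
move=> a w u _ _; rewrite /pwdot.
have mO := domain_measurable Om_dom.
have bv := bounded_measurable_pweval Om_dom M_mesh.
have ivw w' : leb.-integrable Om (EFin \o (fun x => pweval v x * pweval w' x)).
  by apply: (integrable_domain Om_dom); apply: bounded_measurableM; exact: bv.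
rewrite -RintegralZl// -RintegralD//; last exact: (integrableZl mO a (ivw w)).
by apply: eq_Rintegral => x _; rewrite pweval_lin; ring.
Qed.

Lemma pwdotC v w : pwdot v w = pwdot w v.
Proof. by apply: eq_Rintegral => x _; rewrite mulrC. Qed.

Lemma cell_interior K : (cell K)° !=set0.
Proof.
have [x Kx] : cell K !=set0.
  apply/set0P/negP => /eqP K0; case: M_mesh => -[_ /(_ K) + _ _] _ _.
  by rewrite K0 measure0 ltxx.
have [z _ Kz] := polytope_regular (cell_polytope M_mesh K) Kx filterT.
by exists z.
Qed.

(** On each cell the integral of the square vanishes. By continuity the polynomial vanishes on the
    interior of the cell, since a nonempty open set has positive measure, and is therefore zero. *)
Lemma pwdot_definite v : pwdot v v = 0 -> forall K, v K = 0.
Proof.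
have bK K : bounded_measurable (cell K) (fun x => peval (v K) x * peval (v K) x).
  by apply: bounded_measurableM; apply: bounded_measurable_peval; exact: (cell_bounded Om_dom M_mesh).
have -> : pwdot v v = \sum_K \int[leb]_(x in cell K) (peval (v K) x * peval (v K) x).
  apply: (Rintegral_domain_cells Om_dom M_mesh) => //.
    by apply: measurable_funM; exact: (measurable_pweval M_mesh).
  by apply: filterS (ae_pweval M_mesh) => x xv _ K Kx; rewrite (xv v K Kx).
move=> /psumr_eq0P v0 K; have {v0} := v0 _ K erefl.
have mK := cell_measurable M_mesh K.
have iK : leb.-integrable (cell K) (EFin \o (fun x => peval (v K) x * peval (v K) x)).
  apply: bounded_measurable_integrable => //.
  exact: lebesgue_bounded mK (cell_bounded Om_dom M_mesh K).
move=> vK; have {}vK : \int[leb]_(x in cell K) (peval (v K) x * peval (v K) x) = 0.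
  by apply: vK => L _; apply: Rintegral_ge0 => x _; rewrite -expr2 sqr_ge0.
apply: (@peval_open_eq0 _ _ _ (cell K)°); [exact: open_interior|exact: cell_interior|].
move=> x Kx; apply/eqP/negPn/negP => vx.
pose U := (cell K)° `&` (peval (v K) @^-1` [set t | t != 0]).
have oU : open U.
  apply: openI; first exact: open_interior.
  by apply: open_comp; [move=> y _; exact: continuous_peval|exact: open_neq].
have : (0 < leb U)%E by apply: lebesgue_open_gt0 => //; exists x.
rewrite (measure_negligible (open_measurable_rV oU)) ?ltxx//.
pose f x := peval (v K) x * peval (v K) x.
have mf : measurable_fun (cell K) (EFin \o f) by exact: (measurable_int leb iK).
have [+ _] := ae_eq_integral_abs leb mK mf.
have f0 : (\int[leb]_(x in cell K) `|(EFin \o f) x| = 0)%E.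
  rewrite (eq_integral (EFin \o f)) => [|y _]; last first.
    by rewrite /= ger0_norm// /f -expr2 sqr_ge0.
  rewrite -[LHS]fineK; first by congr EFin.
  exact: (integrable_fin_num mK iK).
move=> /(_ f0); apply: negligibleS => y [Ky /= vy] /(_ (interior_subset Ky)).
by case=> /eqP; rewrite mulf_eq0 orbb (negbTE vy).
Qed.

Lemma pwdot_uniq k v w : P_ k v -> P_ k w ->
  (forall phi, P_ k phi -> pwdot v phi = pwdot w phi) -> v = w.
Proof.
move=> Pv Pw vw; pose u := fun K => (-1) *: v K + w K.
have Pu : P_ k u by exact: P_lin.
have u0 : pwdot u u = 0.
  have -> : pwdot u u = -1 * pwdot u v + pwdot u w := @linear_on_pwdot k u (-1) v w Pv Pw.
  by rewrite !(pwdotC u) vw//; ring.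
apply/funext => K; apply/eqP; rewrite -subr_eq0 -oppr_eq0 opprB addrC -scaleN1r.
by have /(_ K) := pwdot_definite u0; rewrite /u => ->.
Qed.

(** The source of existence for the projection, the discrete gradient and the discrete divergence,
    which are defined by a choice. *)
Lemma pwpoly_riesz k (l : pwpoly M -> R) : linear_on k l ->
  exists2 q : pwpoly M, P_ k q & forall phi, P_ k phi -> pwdot q phi = l phi.
Proof.
move=> ll; pose e := @pwbasis R _ M k.
have Pe j : P_ k (e j) by exact: P_pwbasis.
pose comb c : pwpoly M := fun K => \sum_j c j *: e j K.
have dotl c j : pwdot (comb c) (e j) = \sum_i c i * pwdot (e i) (e j).
  rewrite pwdotC (linear_on_sum _ _ (@linear_on_pwdot k (e j)))//.
  by apply: eq_bigr => i _; rewrite pwdotC.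
have [c cE] : exists c, forall j, \sum_i c i * pwdot (e i) (e j) = l (e j).
  apply: finite_riesz => c c0; apply: pwbasis_free => K.
  apply: (@pwdot_definite (comb c)).
  rewrite {2}/comb (linear_on_sum _ _ (@linear_on_pwdot k (comb c)))// big1// => j _.
  by rewrite dotl c0 mulr0.
exists (comb c) => [|phi Pphi]; first exact: P_sum.
rewrite (pwbasis_span Pphi) (linear_on_sum _ _ (@linear_on_pwdot k _))//.
rewrite (linear_on_sum _ _ ll)//; apply: eq_bigr => j _; congr (_ * _).
by rewrite dotl cE.
Qed.

End riesz.

(** * Discrete gradient and divergence *)

Section mesh_faces.
Context {R : realType} {m : nat} (Om GammaD : set 'rV[R]_m.+2) (M : mesh R m.+2).
Hypothesis Om_dom : polyhedral_lipschitz_domain Om.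
Hypothesis M_mesh : is_mesh M Om.
Local Notation V := 'rV[R]_m.+2.
Local Notation leb := (@lebesgue_rV R m.+2).
Implicit Types (K : cellT M) (S : faceT M) (x : V) (v w phi : pwpoly M).

(** On a set of finite measure, |f| is bounded by the integrable function 1 + |f|^q. *)
Lemma in_Lp_integrable (mu : {measure set V -> \bar R}) (D : set V) (q : R) (f : V -> R) :
  1 <= q -> measurable D -> (mu D < +oo)%E -> in_Lp mu D q f ->
  mu.-integrable D (EFin \o f).
Proof.
move=> q1 mD Doo [mf fq].
have mp : measurable_fun D (fun x => `|f x| `^ q).
  apply: (@measurableT_comp _ _ _ _ _ _ (fun t : R => t `^ q)); first exact: measurable_powR.
  exact: measurableT_comp.
apply/integrableP; split; first exact/measurable_EFinP.
apply: (@le_lt_trans _ _ (\int[mu]_(x in D) (1%:E + (`|f x| `^ q)%:E))%E).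
  apply: ge0_le_integral => //.
  - by apply: measurableT_comp => //; exact/measurable_EFinP.
  - by apply/measurable_EFinP; exact: measurable_funD.
  - move=> x _ /=; rewrite lee_fin; have [f1|f1] := leP `|f x| 1.
      by rewrite (le_trans f1)// lerDl powR_ge0.
    rewrite (@le_trans _ _ (`|f x| `^ q))//; last by rewrite lerDr.
    by rewrite -{1}(powRr1 (normr_ge0 (f x))) ler_powR// ltW.
rewrite ge0_integralD//; last exact/measurable_EFinP.
by rewrite lte_add_pinfty// integral_cst// mul1e.
Qed.

Lemma normal_coord S : exists i, normal S ord0 i != 0.
Proof.
apply/not_existsP => h; have /eqP := normal_neq0 M_mesh S; apply.
by apply/rowP => i; rewrite mxE; apply/eqP/negPn/negP; exact: h.
Qed.

Lemma surf_face_finite S : (surf S (face S) < +oo)%E.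
Proof.
have [i nui] := normal_coord S; apply: (hyperplane_measure_bounded _ nui).
  exact: (face_measurable M_mesh).
exact: (face_bounded Om_dom M_mesh).
Qed.

Lemma integrable_face S f : bounded_measurable (face S) f ->
  (surf S).-integrable (face S) (EFin \o f).
Proof.
exact: bounded_measurable_integrable (face_measurable M_mesh S) (surf_face_finite S).
Qed.

Lemma bounded_measurable_jump S v : bounded_measurable (face S) (jump S v).
Proof.
have bp K := bounded_measurable_peval (v K) (face_bounded Om_dom M_mesh S).
rewrite /jump; case: Kminus => [K|]; last exact: bp.
exact: bounded_measurableB.
Qed.

Lemma bounded_measurable_avg S v : bounded_measurable (face S) (avg S v).
Proof.
have bp K := bounded_measurable_peval (v K) (face_bounded Om_dom M_mesh S).
rewrite /avg; case: Kminus => [K|]; last exact: bp.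
apply: bounded_measurableM; first exact: bounded_measurableD.
exact: bounded_measurable_cst.
Qed.

Lemma generic_point_exists S : exists x, generic_point Om S x.
Proof.
have [N [mN N0 SN]] := ae_generic_point M_mesh S.
apply: contrapT => ng; have : (0 < surf S (face S))%E.
  by case: M_mesh => _ [_ _ + _ _] _; apply.
rewrite (subset_measure0 (face_measurable M_mesh S) mN _ N0) ?ltxx//.
move=> x Sx; apply: SN => /= /(_ Sx) gx.
by apply: ng; exists x.
Qed.

(** Near a generic point of an interior face the two cells cover a neighbourhood, so the point
    belongs to the open domain, whereas [GammaD] lies in the frontier. Thus interior faces occur in
    the sums of both discrete operators. *)
Lemma interior_not_dirichlet S : dirichlet_boundary M Om GammaD ->
  interior_face S -> ~~ dirichlet_face GammaD S.
Proof.
move=> [Gf _ _] iS; apply/negP => /asboolP SG.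
have [x gx] := generic_point_exists S.
have [_ nO] : frontier Om x by apply/Gf/SG; case: gx.
apply: nO; rewrite (interior_id Om).1; last exact: domain_open Om_dom.
have [Om_lip _] := Om_dom; apply: (lipschitz_domain_interior Om_lip).
have [_ np] := generic_Kplus_normal M_mesh gx.
move: iS; rewrite /interior_face; case Km : (Kminus S) => [L|//] _.
have [_ nm] := generic_Kminus_normal gx Km.
apply: filterS2 np nm => z [_ zp] [_ zm].
have [z0|z0] := leP (dot (normal S) (z - x)) 0.
  by apply: (cell_sub M_mesh); exact: zp.
by apply: (cell_sub M_mesh); apply: zm; rewrite dotNl oppr_le0 ltW.
Qed.

(** The divergence theorem for the product on each cell. After exchanging the sums over cells and
    faces, each face collects its plus trace minus its minus trace. *)
Lemma partial_ibp (i : 'I_m.+2) v phi :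
  pwdot Om phi (grad_pw v i) + pwdot Om v (fun K => mderiv i (phi K)) =
  \sum_S \int[surf S]_(x in face S)
    (jump S (fun K => v K * phi K) x * normal S ord0 i).
Proof.
have bO := bounded_measurable_pweval Om_dom M_mesh.
have mO := domain_measurable Om_dom.
have iO w w' : leb.-integrable Om (EFin \o (fun x => pweval w x * pweval w' x)).
  by apply: (integrable_domain Om_dom); apply: bounded_measurableM; exact: bO.
rewrite /pwdot -RintegralD//.
rewrite (Rintegral_domain_cells Om_dom M_mesh
    (g := fun K => peval (mderiv i (v K * phi K)))); first 1 last.
- by apply: measurable_funD; apply: measurable_funM; exact: (measurable_pweval M_mesh).
- by move=> K; apply: bounded_measurable_peval; exact: (cell_bounded Om_dom M_mesh).
- apply: filterS (ae_pweval M_mesh) => x xv _ K Kx.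
  by rewrite !(xv _ K Kx) /grad_pw mderivM /peval mevalD !mevalM; ring.
under eq_bigr do rewrite (cell_divergence Om_dom M_mesh).
rewrite exchange_big /=; apply: eq_bigr => S _.
have mS := face_measurable M_mesh S.
have iS w : (surf S).-integrable (face S) (EFin \o jump S w).
  by apply: integrable_face; exact: bounded_measurable_jump.
rewrite RintegralZr// mulrC.
under eq_bigr do rewrite mulrAC mulrC.
rewrite -mulr_sumr; congr (_ * _).
have iK K : (surf S).-integrable (face S) (EFin \o peval (v K * phi K)).
  apply: integrable_face; apply: bounded_measurable_peval.
  exact: (face_bounded Om_dom M_mesh).
rewrite /jump /face_sign; under eq_bigr do rewrite mulrBl.
rewrite sumrB (bigD1 (Kplus S))//= eqxx mul1r big1 ?addr0 => [|K /negbTE ->]; last by rewrite mul0r.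
case Km : (Kminus S) => [L|]; last by rewrite big1 ?subr0// => K _; rewrite mul0r.
rewrite RintegralB//; congr (_ - _).
rewrite (bigD1 L)//= eqxx mul1r big1 ?addr0// => K KL.
by rewrite (_ : (Some L == Some K) = false) ?mul0r//; apply/negbTE; rewrite eq_sym; apply: contra KL => /eqP[->].
Qed.

(** The right-hand side in the definition of grad_h v for a test field with the single component
    [phi] in position [i]. *)
Definition gradient_functional (i : 'I_m.+2) v phi : R :=
  - pwdot Om v (fun K => mderiv i (phi K)) +
  \sum_(S | ~~ dirichlet_face GammaD S)
    \int[surf S]_(x in face S) (avg S v x * (jump S phi x * normal S ord0 i)).

(** On interior faces [v phi] = {v} [phi] + [v] {phi}. On boundary faces jump and average are the
    same trace, so the term {v} [phi] cancels [v phi] on Neumann faces, and [v] {phi} remains on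
    Dirichlet faces. *)
Lemma gradient_functionalE (i : 'I_m.+2) v phi : dirichlet_boundary M Om GammaD ->
  gradient_functional i v phi = pwdot Om phi (grad_pw v i) -
  \sum_(S | ~~ neumann_face GammaD S)
    \int[surf S]_(x in face S) (jump S v x * (avg S phi x * normal S ord0 i)).
Proof.
move=> GD; rewrite /gradient_functional.
have -> : pwdot Om phi (grad_pw v i) = \sum_S \int[surf S]_(x in face S)
    (jump S (fun K => v K * phi K) x * normal S ord0 i)
    - pwdot Om v (fun K => mderiv i (phi K)).
  by rewrite -partial_ibp addrK.
rewrite addrAC [RHS]addrC; congr (_ + _).
rewrite [in LHS]big_mkcond [in X in _ - X]big_mkcond -sumrB; apply: eq_bigr => S _.
have mS := face_measurable M_mesh S.
have bc := bounded_measurable_cst (face S) (normal S ord0 i).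
have bj w := bounded_measurable_jump S w.
have ba w := bounded_measurable_avg S w.
have i1 : (surf S).-integrable (face S) (EFin \o (fun x => jump S (fun K => v K * phi K) x * normal S ord0 i)).
  by apply: integrable_face; apply: bounded_measurableM.
have i2 : (surf S).-integrable (face S) (EFin \o (fun x => jump S v x * (avg S phi x * normal S ord0 i))).
  by apply: integrable_face; apply: bounded_measurableM => //; apply: bounded_measurableM.
rewrite /neumann_face; have := interior_not_dirichlet GD (S := S).
have [iS /(_ isT) ->|bS _] /= := boolP (interior_face S).
  rewrite -RintegralB//; apply: eq_Rintegral => x _.
  move: iS; rewrite /interior_face /jump /avg; case: Kminus => // L _.
  by rewrite /peval !mevalM; field.
have jE x : jump S (fun K => v K * phi K) x = peval (v (Kplus S)) x * peval (phi (Kplus S)) x.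
  by move: bS; rewrite /interior_face negbK /jump => /eqP ->; rewrite /peval mevalM.
case: (boolP (dirichlet_face GammaD S)) => dS /=.
  apply/eqP; rewrite eq_sym subr_eq0; apply/eqP; apply: eq_Rintegral => x _.
  rewrite jE; move: bS; rewrite /interior_face negbK /jump /avg => /eqP ->.
  by rewrite mulrA.
rewrite subr0; apply: eq_Rintegral => x _.
rewrite jE; move: bS; rewrite /interior_face negbK /jump /avg => /eqP ->.
by rewrite mulrA.
Qed.

End mesh_faces.

Section discrete_operators.
Context {R : realType} {m : nat} (Om GammaD : set 'rV[R]_m.+2) (M : mesh R m.+2).
Hypothesis Om_dom : polyhedral_lipschitz_domain Om.
Hypothesis M_mesh : is_mesh M Om.
Variable k : nat.
Local Notation V := 'rV[R]_m.+2.
Local Notation leb := (@lebesgue_rV R m.+2).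
Local Notation grad := (discrete_gradient Om GammaD k).
Local Notation functional := (gradient_functional Om GammaD).
Implicit Types (K : cellT M) (S : faceT M) (x : V) (v w phi : pwpoly M).

Let mO := domain_measurable Om_dom.
Let bO := bounded_measurable_pweval Om_dom M_mesh.
Let mS S := face_measurable M_mesh S.
Let bj S v := bounded_measurable_jump Om_dom M_mesh S v.
Let ba S v := bounded_measurable_avg Om_dom M_mesh S v.

Lemma integrable_mul_pweval (f : V -> R) v : leb.-integrable Om (EFin \o f) ->
  leb.-integrable Om (EFin \o (fun x => f x * pweval v x)).
Proof.
move=> fi; rewrite (_ : (fun x => _) = (fun x => pweval v x * f x)).
  exact: integrable_bounded_mul.
by apply/funext => x; rewrite mulrC.
Qed.

Lemma L2_projectionP j (f : V -> R) : leb.-integrable Om (EFin \o f) ->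
  is_L2_projection Om j f (L2_projection Om j f : pwpoly M).
Proof.
move=> fi; rewrite /L2_projection; apply: xgetPex.
have [|q Pq qE] := @pwpoly_riesz _ _ Om M Om_dom M_mesh j
    (fun phi => \int[leb]_(x in Om) (f x * pweval phi x)); last by exists q.
move=> a v w _ _; rewrite -RintegralZl//; last exact: integrable_mul_pweval.
rewrite -RintegralD//; last 2 first.
- exact: (integrableZl mO a (integrable_mul_pweval v fi)).
- exact: integrable_mul_pweval.
by apply: eq_Rintegral => x _; rewrite pweval_lin; ring.
Qed.

Lemma pwdot_L2_projection j (f : V -> R) phi : leb.-integrable Om (EFin \o f) ->
  P_ j phi -> pwdot Om (L2_projection Om j f) phi = \int[leb]_(x in Om) (f x * pweval phi x).
Proof. by move=> /(L2_projectionP j)[_]; apply. Qed.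

Lemma linear_on_functional j i v : linear_on j (functional i v).
Proof.
move=> a w u Pw Pu; rewrite /gradient_functional mulrDr addrACA; congr (_ + _).
  rewrite mulrN -opprD; congr (- _).
  rewrite -(linear_on_pwdot Om_dom M_mesh v a (k := \max_K maxn (msize (mderiv i (w K))) (msize (mderiv i (u K))))).
  - by congr pwdot; apply/funext => K; rewrite mderivD mderivZ.
  - move=> K; rewrite (leq_trans (leq_maxl _ (msize (mderiv i (u K)))))//.
    by rewrite leqW// (leq_bigmax K).
  - move=> K; rewrite (leq_trans (leq_maxr (msize (mderiv i (w K))) _))//.
    by rewrite leqW// (leq_bigmax K).
rewrite mulr_sumr -big_split/=; apply: eq_bigr => S _.
have ij z : (surf S).-integrable (face S)
    (EFin \o (fun x => avg S v x * (jump S z x * normal S ord0 i))).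
  apply: (integrable_face Om_dom M_mesh); apply: bounded_measurableM => //.
  by apply: bounded_measurableM => //; exact: bounded_measurable_cst.
rewrite -RintegralZl// -RintegralD//; last exact: (integrableZl (mS S) a (ij w)).
by apply: eq_Rintegral => x _; rewrite jump_lin; ring.
Qed.

Lemma functional_sum v (F : 'I_m.+2 -> pwpoly M) :
  - (\int[leb]_(x in Om) (pweval v x * pweval (div_pw F) x))
    + \sum_(S : faceT M | ~~ dirichlet_face GammaD S)
        \int[surf S]_(x in face S) (avg S v x * dot (jumpV S F x) (normal S)) =
  \sum_i functional i v (F i).
Proof.
rewrite /gradient_functional big_split/= sumrN; congr (- _ + _).
  rewrite /pwdot -(Rintegral_sum mO) => [|i _].
    by apply: eq_Rintegral => x _; rewrite pweval_sum mulr_sumr.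
  by apply: (integrable_domain Om_dom); apply: bounded_measurableM.
rewrite exchange_big/=; apply: eq_bigr => S _.
rewrite -(Rintegral_sum (mS S)) => [|i _].
  apply: eq_Rintegral => x _; rewrite -mulr_sumr; congr (_ * _).
  by apply: eq_bigr => i _; rewrite mxE.
apply: (integrable_face Om_dom M_mesh); apply: bounded_measurableM => //.
by apply: bounded_measurableM => //; exact: bounded_measurable_cst.
Qed.

Lemma Rintegral_dot_pweval (G F : 'I_m.+2 -> pwpoly M) :
  \int[leb]_(x in Om) dot (pwevalV G x) (pwevalV F x) = \sum_i pwdot Om (G i) (F i).
Proof.
rewrite -(Rintegral_sum mO) => [|i _].
  by apply: eq_Rintegral => x _; apply: eq_bigr => i _; rewrite !mxE.
by apply: (integrable_domain Om_dom); apply: bounded_measurableM.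
Qed.

Lemma discrete_gradientP v :
  PV_ k.-1 (grad v) /\
  forall i phi, P_ k.-1 phi -> pwdot Om (grad v i) phi = functional i v phi.
Proof.
have [PG GE] : is_discrete_gradient Om GammaD k v (grad v).
  apply: xgetPex.
  have r i := pwpoly_riesz Om_dom M_mesh (linear_on_functional (j := k.-1) i v).
  exists (fun i => s2val (cid2 (r i))); split.
    by move=> i; case: cid2.
  move=> F PF; rewrite functional_sum Rintegral_dot_pweval; apply: eq_bigr => i _.
  by case: cid2 => q Pq /= qE; rewrite qE.
split => // i phi Pphi.
(* Test fields with one nonzero component decouple the components of the discrete gradient. *)
have := GE (fun j => if j == i then phi else fun=> 0).
rewrite functional_sum Rintegral_dot_pweval.
rewrite (bigD1 i)//= eqxx big1 => [|j /negbTE ji]; last first.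
  by rewrite ji (linear_on0 (linear_on_pwdot Om_dom M_mesh (k := k) _)).
rewrite (bigD1 i)//= eqxx big1 => [|j /negbTE ji]; last first.
  by rewrite ji (linear_on0 (linear_on_functional (j := k) _ _)).
rewrite !addr0; apply => j; case: eqP => // _; exact: P_0.
Qed.

Lemma functional_lin i v w (a : R) phi :
  functional i (fun K => a *: v K + w K) phi = a * functional i v phi + functional i w phi.
Proof.
rewrite /gradient_functional mulrDr addrACA; congr (_ + _).
  rewrite mulrN -opprD; congr (- _); rewrite !(pwdotC _ _ (fun K => mderiv i (phi K))).
  apply: (linear_on_pwdot Om_dom M_mesh (k := \max_K maxn (msize (v K)) (msize (w K)))).
  - move=> K; rewrite (leq_trans (leq_maxl _ (msize (w K))))//.
    by rewrite leqW// (leq_bigmax K).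
  - move=> K; rewrite (leq_trans (leq_maxr (msize (v K)) _))//.
    by rewrite leqW// (leq_bigmax K).
rewrite mulr_sumr -big_split/=; apply: eq_bigr => S _.
have ij z : (surf S).-integrable (face S)
    (EFin \o (fun x => avg S z x * (jump S phi x * normal S ord0 i))).
  apply: (integrable_face Om_dom M_mesh); apply: bounded_measurableM => //.
  by apply: bounded_measurableM => //; exact: bounded_measurable_cst.
rewrite -RintegralZl// -RintegralD//; last exact: (integrableZl (mS S) a (ij v)).
apply: eq_Rintegral => x _; rewrite /avg; case: Kminus => [L|];
  rewrite /peval !mevalD !mevalZ; by field.
Qed.

Lemma discrete_gradient_lin v w (a : R) i :
  grad (fun K => a *: v K + w K) i = (fun K => a *: grad v i K + grad w i K).
Proof.
have [Pv vE] := discrete_gradientP v; have [Pw wE] := discrete_gradientP w.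
have [Pu uE] := discrete_gradientP (fun K => a *: v K + w K).
apply: (pwdot_uniq Om_dom M_mesh (Pu i)); first exact: P_lin.
move=> phi Pphi; rewrite uE// pwdotC (linear_on_pwdot Om_dom M_mesh _ _ (Pv i) (Pw i)).
by rewrite !(pwdotC _ phi) vE// wE// functional_lin.
Qed.

End discrete_operators.

(** * Comparison of integrals without measurability *)

Section lower_integral.
Context d (T : measurableType d) (R : realType) (mu : {measure set T -> \bar R}).
Implicit Types (f g : T -> \bar R) (D N : set T).
Local Open Scope ereal_scope.
Import HBNNSimple.

Lemma ge0_le_integralT f g : (forall x, 0 <= f x) -> (forall x, f x <= g x) ->
  \int[mu]_x f x <= \int[mu]_x g x.
Proof.
move=> f0 fg; have g0 x : 0 <= g x by exact: le_trans (fg x).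
rewrite !ge0_integralTE//; apply: le_ereal_sup => _ [h hf <-].
by exists h => // x; exact: le_trans (fg x).
Qed.

(* The integral of a nonnegative function is a supremum over simple functions
   below it, so no measurability is needed. *)
Lemma ge0_le_integral_ae f g N : measurable N -> mu N = 0 ->
  (forall x, 0 <= f x) -> (forall x, 0 <= g x) ->
  (forall x, ~ N x -> f x <= g x) -> \int[mu]_x f x <= \int[mu]_x g x.
Proof.
move=> mN N0 f0 g0 fg; rewrite ge0_integralTE//.
apply: ge_ereal_sup => _ [h hf <-].
apply: (@le_trans _ _ (\int[mu]_x (h x)%:E)).
  rewrite ge0_integralTE => [|x]; last by rewrite lee_fin.
  by apply: ereal_sup_ubound; exists h.
have mh : measurable_fun setT (EFin \o h) by exact/measurable_EFinP.
(* A simple function below [f] is restricted to the complement of [N], which keeps its integral and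
   puts it below [g]. *)
rewrite (@ge0_negligible_integral _ _ _ mu _ N (EFin \o h))//; last first.
  by move=> x _; rewrite /= lee_fin.
rewrite integral_mkcond; apply: ge0_le_integralT => x; rewrite patchE.
  by case: ifP => //= _; rewrite lee_fin.
case: ifPn => // /set_mem[_ /= nN].
by apply: (le_trans (hf x)); exact: fg.
Qed.

(** Applied to the positive and negative parts separately; it serves for the integrand of the dual
    energy, which contains the conjugates. *)
Lemma le_integral_ae D f g : measurable D ->
  {ae mu, forall x, D x -> f x <= g x} ->
  \int[mu]_(x in D) f x <= \int[mu]_(x in D) g x.
Proof.
move=> mD [N [mN N0 fgN]].
have fg x : ~ N x -> D x -> f x <= g x.
  by move=> nN; apply: contrapT => nfg; apply: nN; exact: fgN.
rewrite [leLHS]integralE [leRHS]integralE; apply: leeB.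
  rewrite [leLHS]integral_mkcond [leRHS]integral_mkcond.
  apply: (ge0_le_integral_ae mN N0) => x.
  - by rewrite patchE; case: ifP.
  - by rewrite patchE; case: ifP.
  - move=> nN; rewrite !patchE; case: ifPn => // /set_mem Dx.
    by rewrite !funeposE ge_max le_max fg//= le_max lexx orbT.
rewrite [leLHS]integral_mkcond [leRHS]integral_mkcond.
apply: (ge0_le_integral_ae mN N0) => x.
- by rewrite patchE; case: ifP.
- by rewrite patchE; case: ifP.
- move=> nN; rewrite !patchE; case: ifPn => // /set_mem Dx.
  by rewrite !funenegE ge_max le_max leeN2 fg//= le_max lexx orbT.
Qed.

Lemma eq_integral_ae D f g : measurable D ->
  {ae mu, forall x, D x -> f x = g x} ->
  \int[mu]_(x in D) f x = \int[mu]_(x in D) g x.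
Proof.
move=> mD fg; apply/eqP; rewrite eq_le !le_integral_ae//.
- by apply: filterS fg => x fg Dx; rewrite fg.
- by apply: filterS fg => x fg Dx; rewrite fg.
Qed.

(** If the integral of the positive or of the negative part were infinite, so would be their
    difference in the extended reals. *)
Lemma fin_num_integrable D f : measurable D -> measurable_fun D f ->
  \int[mu]_(x in D) f x \is a fin_num -> mu.-integrable D f.
Proof.
move=> mD mf; rewrite integralE => fi.
have p0 : 0 <= \int[mu]_(x in D) f^\+ x by exact: integral_ge0.
have n0 : 0 <= \int[mu]_(x in D) f^\- x by exact: integral_ge0.
have [pf nf] : \int[mu]_(x in D) f^\+ x < +oo /\ \int[mu]_(x in D) f^\- x < +oo.
  move: fi p0 n0; case: (\int[mu]_(x in D) f^\+ x) => [a| |]//;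
    by case: (\int[mu]_(x in D) f^\- x) => [b| |]//; rewrite !ltry.
apply/integrableP; split => //.
rewrite (eq_integral (f^\+ \+ f^\-)) => [|x _]; last by rewrite -/((abse \o f) x) fune_abse.
rewrite ge0_integralD//; first exact: lte_add_pinfty.
- exact: measurable_funepos.
- exact: measurable_funeneg.
Qed.

End lower_integral.

Section discrete_identity.
Context {R : realType} {m : nat} (Om GammaD : set 'rV[R]_m.+2) (M : mesh R m.+2).
Hypothesis Om_dom : polyhedral_lipschitz_domain Om.
Hypothesis M_mesh : is_mesh M Om.
Hypothesis GD : dirichlet_boundary M Om GammaD.
Variable k : nat.
Hypothesis k_ge1 : (1 <= k)%N.
Local Notation V := 'rV[R]_m.+2.
Local Notation leb := (@lebesgue_rV R m.+2).
Local Notation grad := (discrete_gradient Om GammaD k).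
Implicit Types (K : cellT M) (S : faceT M) (x : V) (v w phi : pwpoly M).

Let mO := domain_measurable Om_dom.
Let bO := bounded_measurable_pweval Om_dom M_mesh.
Let mS S := face_measurable M_mesh S.
Let bj S v := bounded_measurable_jump Om_dom M_mesh S v.
Let ba S v := bounded_measurable_avg Om_dom M_mesh S v.

Lemma P_grad_pw v i : P_ k v -> P_ k.-1 (grad_pw v i).
Proof.
move=> Pv K; rewrite (leq_trans (msize_mderiv _ _))// prednK//.
by rewrite -ltnS; case: (msize (v K)) (Pv K).
Qed.

Lemma Y_integrable p tau : 1 < p -> Y Om GammaD M p tau ->
  (forall i, leb.-integrable Om (EFin \o (fun x => tau.1 x ord0 i))) /\
  (forall S, (surf S).-integrable (face S) (EFin \o tau.2)).
Proof.
move=> p1 [t1 t2 _]; split=> [i|S].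
  apply: (in_Lp_integrable _ mO (domain_finite Om_dom) (t1 i)).
  by rewrite /conj_exp ler_pdivlMr ?subr_gt0// mul1r gerBl.
apply: (in_Lp_integrable _ (mS S) (surf_face_finite Om_dom M_mesh S) (t2 S)).
by rewrite ler1n.
Qed.

Section dual_variable.
Variable tau : (V -> V) * (V -> R).
Hypothesis t1 : forall i, leb.-integrable Om (EFin \o (fun x => tau.1 x ord0 i)).
Hypothesis t2 : forall S, (surf S).-integrable (face S) (EFin \o tau.2).

Let PI : 'I_m.+2 -> pwpoly M := L2_projectionV Om k.-1 tau.1.

Lemma integrable_dot (F : 'I_m.+2 -> pwpoly M) :
  leb.-integrable Om (EFin \o (fun x => dot (tau.1 x) (pwevalV F x))).
Proof.
apply: (integrable_Rsum mO) => i _.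
rewrite (_ : (fun x => _) = (fun x => tau.1 x ord0 i * pweval (F i) x)).
  exact: (integrable_mul_pweval Om_dom M_mesh).
by apply/funext => x; rewrite mxE.
Qed.

Lemma integrable_mul_jump S v :
  (surf S).-integrable (face S) (EFin \o (fun x => tau.2 x * jump S v x)).
Proof.
rewrite (_ : (fun x => _) = (fun x => jump S v x * tau.2 x)).
  by apply: integrable_bounded_mul.
by apply/funext => x; rewrite mulrC.
Qed.

Lemma Rintegral_dot (F : 'I_m.+2 -> pwpoly M) :
  \int[leb]_(x in Om) dot (tau.1 x) (pwevalV F x) =
  \sum_i \int[leb]_(x in Om) (tau.1 x ord0 i * pweval (F i) x).
Proof.
rewrite -(Rintegral_sum mO) => [|i _]; last exact: (integrable_mul_pweval Om_dom M_mesh).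
by apply: eq_Rintegral => x _; apply: eq_bigr => i _; rewrite mxE.
Qed.

Lemma Rintegral_dot_projection (F : 'I_m.+2 -> pwpoly M) : PV_ k.-1 F ->
  \int[leb]_(x in Om) dot (tau.1 x) (pwevalV F x) = \sum_i pwdot Om (PI i) (F i).
Proof.
move=> PF; rewrite Rintegral_dot; apply: eq_bigr => i _.
by rewrite (pwdot_L2_projection Om_dom M_mesh (t1 i) (PF i)).
Qed.

Lemma discrete_divergenceP :
  is_discrete_divergence Om GammaD k tau (discrete_divergence Om GammaD k tau : pwpoly M).
Proof.
apply: xgetPex.
have [|q Pq qE] := @pwpoly_riesz _ _ Om M Om_dom M_mesh k
    (fun phi => - (\int[leb]_(x in Om) dot (tau.1 x) (pwevalV (grad_pw phi) x))
    + \sum_(S : faceT M | ~~ neumann_face GammaD S)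
        \int[surf S]_(x in face S) (tau.2 x * jump S phi x)); last by exists q.
move=> a v w _ _; rewrite mulrDr addrACA; congr (_ + _).
  rewrite mulrN -opprD; congr (- _).
  rewrite -RintegralZl//; last exact: integrable_dot.
  rewrite -RintegralD//; last 2 first.
  - exact: (integrableZl mO a (integrable_dot _)).
  - exact: integrable_dot.
  apply: eq_Rintegral => x _; rewrite /dot mulr_sumr -big_split/=.
  apply: eq_bigr => i _; rewrite !mxE.
  rewrite (_ : grad_pw _ i = fun K => a *: grad_pw v i K + grad_pw w i K).
    by rewrite pweval_lin; ring.
  by apply/funext => K; rewrite /grad_pw mderivD mderivZ.
rewrite mulr_sumr -big_split/=; apply: eq_bigr => S _.
rewrite -RintegralZl//; last exact: integrable_mul_jump.
rewrite -RintegralD//; last 2 first.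
- exact: (integrableZl (mS S) a (integrable_mul_jump S _)).
- exact: integrable_mul_jump.
by apply: eq_Rintegral => x _; rewrite jump_lin; ring.
Qed.

Lemma discrete_divergence_eq (q : pwpoly M) : is_discrete_divergence Om GammaD k tau q ->
  discrete_divergence Om GammaD k tau = q.
Proof.
move=> [Pq qE]; have [Pd dE] := discrete_divergenceP.
apply: (pwdot_uniq Om_dom M_mesh Pd Pq) => phi Pphi.
by rewrite /pwdot dE// qE.
Qed.

Lemma integrable_normal_residual S :
  (surf S).-integrable (face S)
    (EFin \o (fun x => tau.2 x - dot (avgV S PI x) (normal S))).
Proof.
rewrite (_ : EFin \o _ = (EFin \o tau.2) \- (EFin \o (fun x => dot (avgV S PI x) (normal S))))%E.
  apply: integrableB => //; apply: (integrable_face Om_dom M_mesh).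
  rewrite (_ : (fun x => _) = fun x => \sum_i avg S (PI i) x * normal S ord0 i).
    apply: bounded_measurable_sum => i _; apply: bounded_measurableM => //.
    exact: bounded_measurable_cst.
  by apply/funext => x; apply: eq_bigr => i _; rewrite mxE.
by apply/funext => x /=; rewrite EFinB.
Qed.

(** Both gradients have degree at most k - 1, so tau_M can be replaced by its projection; testing
    grad_h v with this projection produces the face terms. *)
Lemma Rintegral_gradient_residual v : P_ k v ->
  \int[leb]_(x in Om) dot (tau.1 x) (pwevalV (grad v) x) =
  \int[leb]_(x in Om) dot (tau.1 x) (pwevalV (grad_pw v) x) -
  \sum_(S | ~~ neumann_face GammaD S)
    \int[surf S]_(x in face S) (dot (avgV S PI x) (normal S) * jump S v x).
Proof.
move=> Pv; have [PG GE] := discrete_gradientP GammaD Om_dom M_mesh k v.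
have PPI i : P_ k.-1 (PI i) by have [] := L2_projectionP Om_dom M_mesh k.-1 (t1 i).
rewrite (Rintegral_dot_projection PG).
rewrite (Rintegral_dot_projection (fun i => P_grad_pw i Pv)).
under eq_bigr do rewrite pwdotC GE// (gradient_functionalE Om_dom M_mesh _ _ _ GD).
rewrite sumrB; congr (_ - _); rewrite exchange_big/=; apply: eq_bigr => S _.
rewrite -(Rintegral_sum (mS S)) => [|i _].
  apply: eq_Rintegral => x _; rewrite /dot mulr_suml; apply: eq_bigr => i _.
  by rewrite mxE mulrC.
apply: (integrable_face Om_dom M_mesh); apply: bounded_measurableM => //.
by apply: bounded_measurableM => //; exact: bounded_measurable_cst.
Qed.

(** The integral of tau_M against the piecewise gradient enters the two terms on the left with
    opposite signs and cancels. *)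
Lemma gradient_divergence_identity v : P_ k v ->
  \int[leb]_(x in Om) dot (tau.1 x) (pwevalV (grad v) x) +
  \int[leb]_(x in Om) (pweval (discrete_divergence Om GammaD k tau : pwpoly M) x * pweval v x) =
  \sum_(S | ~~ neumann_face GammaD S)
    \int[surf S]_(x in face S) ((tau.2 x - dot (avgV S PI x) (normal S)) * jump S v x).
Proof.
move=> Pv; have [Pd ->//] := discrete_divergenceP.
have e (a b c : R) : a - b + (- a + c) = c - b by ring.
rewrite Rintegral_gradient_residual// e -sumrB.
apply: eq_bigr => S _; rewrite -RintegralB//; last 2 first.
- exact: integrable_mul_jump.
- apply: (integrable_face Om_dom M_mesh); apply: bounded_measurableM => //.
  rewrite (_ : (fun x => _) = fun x => \sum_i avg S (PI i) x * normal S ord0 i).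
    apply: bounded_measurable_sum => i _; apply: bounded_measurableM => //.
    exact: bounded_measurable_cst.
  by apply/funext => x; apply: eq_bigr => i _; rewrite mxE.
by apply: eq_Rintegral => x _; rewrite mulrBl.
Qed.

End dual_variable.

End discrete_identity.

(** * Weak duality *)

Section powers.
Context {R : realType}.
Implicit Types (x y a b h r s : R).

Lemma powR_dual_mul x r : 1 < r -> `|x| `^ (r - 2) * x * x = `|x| `^ r.
Proof.
move=> r1; have [->|x0] := eqVneq x 0.
  by rewrite mulr0 normr0 powR0// gt_eqF// (lt_trans ltr01).
rewrite -mulrA -expr2 -real_normK ?num_real// -powR_mulrn// -powRD ?subrK//.
by rewrite normr_eq0 x0 implybT.
Qed.

Lemma conj_exp_inv r : 1 < r -> r^-1 + (conj_exp r)^-1 = 1.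
Proof.
move=> r1; have r0 : 0 < r by exact: lt_trans r1.
by rewrite /conj_exp invf_div; field; rewrite gt_eqF// subr_eq0 gt_eqF.
Qed.

Lemma conj_exp_gt1 r : 1 < r -> 1 < conj_exp r.
Proof. by move=> r1; rewrite /conj_exp ltr_pdivlMr ?subr_gt0// mul1r gtrBl. Qed.

(** Young's inequality for h^(-s/r) |b| and h^(s/r) |a|: the weights cancel in the product. *)
Lemma weighted_young h s r a b : 0 < h -> 1 < r ->
  - (a * b) <= h `^ (- s) / r * `|b| `^ r +
               h `^ (s / (r - 1)) / conj_exp r * `|a| `^ conj_exp r.
Proof.
move=> h0 r1; have r0 : 0 < r by exact: lt_trans r1.
have q0 : 0 < conj_exp r by exact: lt_trans (conj_exp_gt1 r1).
have := conjugate_powR (mulr_ge0 (powR_ge0 h (- s / r)) (normr_ge0 b))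
  (mulr_ge0 (powR_ge0 h (s / r)) (normr_ge0 a)) r0 q0 (conj_exp_inv r1).
rewrite !powRM ?powR_ge0// -!powRrM mulrVK ?unitfE ?gt_eqF//.
have -> : s / r * conj_exp r = s / (r - 1).
  by rewrite /conj_exp; field; rewrite !gt_eqF ?subr_gt0.
have -> : h `^ (- s / r) * `|b| * (h `^ (s / r) * `|a|) = `|a * b|.
  rewrite mulrACA -powRD; last by rewrite (gt_eqF h0) implybT.
  by rewrite -mulrDl addNr mul0r powRr0 mul1r mulrC -normrM.
move=> ab; apply: (le_trans (ler_norm _)); rewrite normrN (le_trans ab)//.
by rewrite ![_ * _ / _]mulrAC.
Qed.

End powers.

Lemma bounded_measurable_powR d (T : measurableType d) (R : realType) (D : set T)
  (f : T -> R) q : 0 <= q ->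
  bounded_measurable D f -> bounded_measurable D (fun x => `|f x| `^ q).
Proof.
move=> q0 [mf [c fc]]; split.
  apply: (@measurableT_comp _ _ _ _ _ _ (fun t : R => t `^ q)); first exact: measurable_powR.
  exact: measurableT_comp.
exists (c `^ q) => x Dx; rewrite ger0_norm ?powR_ge0// ge0_ler_powR ?nnegrE//.
- exact: le_trans (fc x Dx).
- exact: fc.
Qed.

Lemma EFin_Rintegral d (T : measurableType d) (R : realType)
  (mu : {measure set T -> \bar R}) (D : set T) (f : T -> R) : measurable D ->
  mu.-integrable D (EFin \o f) ->
  (\int[mu]_(x in D) f x)%:E = (\int[mu]_(x in D) (f x)%:E)%E.
Proof. by move=> mD fi; rewrite /Rintegral fineK//; exact: integrable_fin_num. Qed.

Lemma measurable_rV_set1 {R : realType} {n : nat} (x : 'rV[R]_n) : measurable [set x].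
Proof.
apply: closed_measurable_rV; apply: accessible_closed_set1.
by apply: hausdorff_accessible; exact: norm_hausdorff.
Qed.

Section weak_duality.
Context {R : realType} {m : nat} (Om GammaD : set 'rV[R]_m.+2) (M : mesh R m.+2).
Hypothesis Om_dom : polyhedral_lipschitz_domain Om.
Hypothesis M_mesh : is_mesh M Om.
Hypothesis GD : dirichlet_boundary M Om GammaD.
Variables (k : nat) (p r s : R).
Hypothesis k_ge1 : (1 <= k)%N.
Hypotheses (p_gt1 : 1 < p) (r_gt1 : 1 < r).
Variables (W : 'rV[R]_m.+2 -> R) (psi : 'rV[R]_m.+2 -> R -> \bar R).
Hypothesis W_continuous : continuous W.
Hypothesis psi_meas : psi_measurable Om psi.
Local Notation V := 'rV[R]_m.+2.
Local Notation leb := (@lebesgue_rV R m.+2).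
Local Notation grad := (discrete_gradient Om GammaD k).
Local Notation div tau := (discrete_divergence Om GammaD k tau : pwpoly M).
Implicit Types (K : cellT M) (S : faceT M) (x : V) (v w phi : pwpoly M).

Let mO := domain_measurable Om_dom.
Let bO := bounded_measurable_pweval Om_dom M_mesh.
Let mS S := face_measurable M_mesh S.
Let bj S v := bounded_measurable_jump Om_dom M_mesh S v.

(** The face lies in a hyperplane of dimension at least one, so the projection of a point is
    contained in a null hyperplane; the normal [const_mx 1] is an arbitrary nonzero choice. *)
Lemma surf_set1 S x0 : surf S [set x0] = 0%E.
Proof.
have [i nui] := normal_coord M_mesh S.
have m1 : measurable [set x0] by exact: measurable_rV_set1.
rewrite /surf (hyperplane_measureE _ nui m1).
pose nu : 'rV[R]_m.+1 := const_mx 1; pose y0 := \row_l x0 ord0 (lift i l).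
have nu0 : nu != 0.
  by apply/eqP => /rowP/(_ ord0); rewrite !mxE => /eqP; rewrite oner_eq0.
have [N [mN N0 yN]] := @hyperplane_lebesgue0 R m nu (dot nu y0) [set y0] nu0
  (fun y e => congr1 (dot nu) e).
rewrite (subset_measure0 (measurable_preimage_graph _ _ _ m1) mN _ N0) ?mule0//.
move=> y /= yx; apply: yN; apply/rowP => l.
by rewrite mxE -yx graph_pt_lift.
Qed.

(** A face has positive surface measure and so is not a single point. The powers of the diameter can
    then be multiplied and divided freely. *)
Lemma diam_face_gt0 S : 0 < diam (face S).
Proof.
have [x [y [Sx Sy xy]]] : exists x y, [/\ face S x, face S y & x != y].
  apply: contrapT => nxy; have : (0 < surf S (face S))%E.
    by case: M_mesh => _ [_ _ + _ _] _; apply.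
  have [x gx] := generic_point_exists M_mesh S; have Sx : face S x by case: gx.
  have m1 : measurable [set x] by exact: measurable_rV_set1.
  rewrite (subset_measure0 (mS S) m1 _ (surf_set1 S x)) ?ltxx// => y Sy /=.
  by apply/eqP/negPn/negP => yx; apply: nxy; exists y, x.
have [e e0 Se] := bounded_sub_box (face_bounded Om_dom M_mesh S).
rewrite /diam; apply: (@lt_le_trans _ _ (enorm (x - y))).
  rewrite /enorm sqrtr_gt0 lt_neqAle eq_sym; apply/andP; split; last first.
    by apply: sumr_ge0 => i _; rewrite -expr2 sqr_ge0.
  apply: contra xy => /eqP xy0; rewrite -subr_eq0; apply/eqP/rowP => i.
  rewrite [RHS]mxE; apply/eqP; rewrite -sqrf_eq0 expr2; apply/eqP.
  apply: (@psumr_eq0P R _ xpredT (fun i => (x - y) ord0 i * (x - y) ord0 i)) => // j _.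
  by rewrite -expr2 sqr_ge0.
apply: sup_ubound; last by exists x => //; exists y.
exists (Num.sqrt (\sum_(i < m.+2) (2 * e) ^+ 2)) => _ [z Sz [w Sw <-]].
rewrite /enorm ler_wsqrtr// /dot; apply: ler_sum => i _.
rewrite -expr2 -[leLHS]real_normK ?num_real// lerXn2r ?nnegrE ?mulr_ge0 ?(ltW e0)//.
have := Se z Sz i; have := Se w Sw i; rewrite !mxE !subr0 => we ze.
by rewrite (le_trans (ler_normB _ _))// mulr2n mulrDl mul1r lerD// ltW.
Qed.

Lemma measurable_pwevalV (G : 'I_m.+2 -> pwpoly M) : measurable_fun setT (pwevalV G).
Proof.
apply: measurable_fun_rV => i; under eq_fun do rewrite mxE.
exact: (measurable_pweval M_mesh).
Qed.

(** psi_h is measurable only off a null set, whence a measurable representative that agrees almost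
    everywhere. *)
Lemma energy_density_measurable v : exists2 d : V -> \bar R,
  measurable_fun setT d &
  {ae leb, forall x, Om x -> energy_density Om GammaD k W psi v x = d x}.
Proof.
have [N [mN N0 mpsi]] := psi_meas.
have mD : measurable (Om `\` N) by exact: measurableD.
exists (energy_density Om GammaD k W psi v \_ (Om `\` N)).
  apply: (measurable_restrictT _ mD).1; apply: emeasurable_funD.
    apply/measurable_EFinP; apply: measurable_funTS.
    apply: (@measurableT_comp _ _ _ _ _ _ W); first exact: continuous_measurable_rV.
    exact: measurable_pwevalV.
  apply: (measurable_comp _ _ mpsi (g := fun x => (x, pweval v x))) => //.
  - exact: measurableX.
  - by move=> _ [x Dx <-].
  - apply: measurable_funTS; apply: measurable_fun_pair; first exact: measurable_id.
    exact: (measurable_pweval M_mesh).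
exists N; split => // x; apply: contra_notP => nN Ox.
by rewrite patchE mem_set.
Qed.

Lemma s_hE v : s_h GammaD r s v v = \sum_(S | ~~ neumann_face GammaD S)
  diam (face S) `^ (- s) * \int[surf S]_(x in face S) (`|jump S v x| `^ r).
Proof.
by apply: eq_bigr => S _; congr (_ * _); apply: eq_Rintegral => x _; exact: powR_dual_mul.
Qed.

Lemma conjugate_ge (T : Type) (pairing : T -> T -> R) (f : T -> \bar R) (x y : T) :
  ((pairing y x)%:E - f x <= conjugate pairing f y)%E.
Proof. by apply: ereal_sup_ubound; exists x. Qed.

(** The last integral may be infinite, because tau_S is only square integrable while r' may exceed
    2; hence extended real values. *)
Lemma face_young S (a b : V -> R) :
  measurable_fun (face S) a -> bounded_measurable (face S) b ->
  (surf S).-integrable (face S) (EFin \o (fun x => a x * b x)) ->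
  ((- \int[surf S]_(x in face S) (a x * b x))%:E <=
   (diam (face S) `^ (- s) / r * \int[surf S]_(x in face S) (`|b x| `^ r))%:E +
   (diam (face S) `^ (s / (r - 1)))%:E *
     (\int[surf S]_(x in face S) (`|a x| `^ conj_exp r)%:E) * (conj_exp r)^-1%:E)%E.
Proof.
move=> ma bb iab; have r0 : 0 < r by exact: lt_trans r_gt1.
have q0 : 0 < conj_exp r by exact: lt_trans (conj_exp_gt1 r_gt1).
have h0 := diam_face_gt0 S.
have iN : (surf S).-integrable (face S) (EFin \o (fun x => -1 * (a x * b x))).
  exact: (integrableZl (mS S) (-1) iab).
have -> : (- \int[surf S]_(x in face S) (a x * b x))%:E =
    (\int[surf S]_(x in face S) (-1 * (a x * b x))%:E)%E.
  have -> : - (\int[surf S]_(x in face S) (a x * b x)) =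
      \int[surf S]_(x in face S) (-1 * (a x * b x)) by rewrite RintegralZl// mulN1r.
  exact: EFin_Rintegral.
pose A x := diam (face S) `^ (- s) / r * `|b x| `^ r.
pose B x := diam (face S) `^ (s / (r - 1)) / conj_exp r * `|a x| `^ conj_exp r.
have bA : bounded_measurable (face S) A.
  apply: bounded_measurableM; first exact: bounded_measurable_cst.
  by apply: bounded_measurable_powR => //; exact: ltW.
have ibr : (surf S).-integrable (face S) (EFin \o (fun x => `|b x| `^ r)).
  by apply: (integrable_face Om_dom M_mesh); apply: bounded_measurable_powR => //; exact: ltW.
have mp : measurable_fun (face S) (fun x => `|a x| `^ conj_exp r).
  apply: (@measurableT_comp _ _ _ _ _ _ (fun t : R => t `^ conj_exp r)).
    exact: measurable_powR.
  exact: measurableT_comp.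
have A0 x : 0 <= A x by rewrite mulr_ge0 ?powR_ge0// divr_ge0 ?powR_ge0// ltW.
have B0 x : 0 <= B x by rewrite mulr_ge0 ?powR_ge0// divr_ge0 ?powR_ge0// ltW.
apply: (@le_trans _ _ (\int[surf S]_(x in face S) ((A x)%:E + (B x)%:E))%E).
  apply: le_integral_ae => //; apply: aeW => x _.
  by rewrite -EFinD lee_fin mulN1r; exact: weighted_young.
rewrite ge0_integralD//; first last.
- by apply/measurable_EFinP; apply: measurable_funM.
- by move=> x _; rewrite lee_fin.
- by apply/measurable_EFinP; exact: bA.1.
- by move=> x _; rewrite lee_fin.
apply: leeD.
  by rewrite -EFin_Rintegral ?(RintegralZl _ _ ibr)//; exact: (integrable_face Om_dom M_mesh).
under eq_integral do rewrite EFinM.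
rewrite ge0_integralZl_EFin//; first last.
- by rewrite divr_ge0 ?powR_ge0// ltW.
- exact/measurable_EFinP.
by rewrite EFinM -!muleA [X in (_ * X)%E]muleC.
Qed.

Lemma adde_EFin_eq (x : \bar R) (c e : R) : (x + c%:E = e%:E -> x = (e - c)%:E)%E.
Proof. by case: x => // x [<-]; rewrite addrK. Qed.

Lemma weak_duality v tau (mv : R) : P_ k v ->
  E_h Om GammaD M k r s W psi v = mv%:E -> Y Om GammaD M p tau ->
  (E_h_dual Om GammaD M k r s W psi tau <= mv%:E)%E.
Proof.
move=> Pv Ev Yt; have [t1 t2] := Y_integrable Om_dom M_mesh p_gt1 Yt.
have [d md dE] := energy_density_measurable v.
set D := (\int[leb]_(x in Om) energy_density Om GammaD k W psi v x)%E in Ev.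
have DE : D = (\int[leb]_(x in Om) d x)%E by exact: eq_integral_ae.
(* A finite energy forces a finite integral of the density, which is thus integrable. *)
have Dfin : D = (mv - s_h GammaD r s v v / r)%:E.
  exact: adde_EFin_eq Ev.
have idd : leb.-integrable Om d.
  by apply: fin_num_integrable => //; [exact: measurable_funTS|rewrite -DE Dfin].
pose b x := dot (tau.1 x) (pwevalV (grad v) x) + pweval (div tau) x * pweval v x.
have ib1 := integrable_dot Om_dom M_mesh t1 (grad v).
have ib2 : leb.-integrable Om (EFin \o (fun x => pweval (div tau) x * pweval v x)).
  by apply: (integrable_domain Om_dom); apply: bounded_measurableM.
have ib : leb.-integrable Om (EFin \o b) by exact: (integrableD mO ib1 ib2).
pose a S x := tau.2 x - dot (avgV S (L2_projectionV Om k.-1 tau.1) x) (normal S).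
have bE : \int[leb]_(x in Om) b x = \sum_(S | ~~ neumann_face GammaD S)
    \int[surf S]_(x in face S) (a S x * jump S v x).
  by rewrite RintegralD// (gradient_divergence_identity Om_dom M_mesh GD k_ge1 t1 t2 Pv).
set I := (\int[leb]_(x in Om) (conjugate dot (EFin \o W) (tau.1 x) +
  conjugate *%R (psi x) (pweval (div tau) x)))%E.
(* The pointwise Fenchel inequalities are integrated; [I] is not known to be the integral of a
   measurable function. *)
have Ige : ((\int[leb]_(x in Om) b x)%:E - D <= I)%E.
  rewrite DE (_ : _%:E = \int[leb]_(x in Om) (b x)%:E)%E; last first.
    exact: EFin_Rintegral.
  rewrite -integralB//; apply: le_integral_ae => //.
  apply: filterS dE => x dE Ox; rewrite /= -dE// /energy_density.
  apply: le_trans (leeD (conjugate_ge dot (EFin \o W) (pwevalV (grad v) x) (tau.1 x))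
    (conjugate_ge *%R (psi x) (pweval v x) (pweval (div tau) x))).
  rewrite /b /=; case: (psi x (pweval v x)) => [u| |] /=.
  - by rewrite -!EFinD lee_fin; lra.
  - by rewrite leNye.
  - by rewrite leey.
have Bge : ((- \int[leb]_(x in Om) b x)%:E <=
    (s_h GammaD r s v v / r)%:E + gamma_h Om GammaD M k r s tau * (conj_exp r)^-1%:E)%E.
  rewrite bE -sumrN -sumEFin s_hE mulr_suml -sumEFin /gamma_h ge0_sume_distrl.
    rewrite -big_split/=; apply: lee_sum => S _.
    rewrite [X in (X%:E + _)%E]mulrAC; apply: face_young.
    - by apply/measurable_EFinP; apply: (measurable_int (surf S)); exact: (integrable_normal_residual Om_dom M_mesh).
    - exact: bj.
    - rewrite (_ : (fun x => _) = fun x => jump S v x * a S x).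
        apply: integrable_bounded_mul => //; exact: (integrable_normal_residual Om_dom M_mesh).
      by apply/funext => x; rewrite mulrC.
  move=> S _; apply: mule_ge0; first by rewrite lee_fin powR_ge0.
  by apply: integral_ge0 => x _; rewrite lee_fin powR_ge0.
rewrite /E_h_dual -/I; rewrite Dfin in Ige.
(* An infinite [I] or [G] can only be +oo, and then the dual energy is -oo. *)
move: Ige Bge; set B := Rintegral _ _ _; set G := (gamma_h _ _ _ _ _ _ _ * _)%E.
case: I => [i| |]//; case: G => [g| |]//=; rewrite ?lee_fin ?leNye// -?EFinB -?EFinN -?EFinD ?lee_fin; lra.
Qed.

End weak_duality.

(** * Derivatives of convex functions *)

Section convex_derivative.
Context {R : realType}.

(** The difference quotients at [y] with step at most one are bounded by f x - f y; the limit is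
    taken from the right. *)
Lemma convex_derive_le (V : normedModType R) (f : V -> R) (x y : V) :
  (forall t, 0 <= t <= 1 -> f (t *: x + (1 - t) *: y) <= t * f x + (1 - t) * f y) ->
  derivable f y (x - y) -> 'D_(x - y) f y <= f x - f y.
Proof.
move=> cf df.
have c : h^-1 *: (f (h *: (x - y) + y) - f y) @[h --> 0^'+] --> 'D_(x - y) f y.
  by apply: cvg_dnbhs_at_right; exact: df.
rewrite -(cvg_lim _ c)//; apply: limr_le; first by apply/cvg_ex; exists ('D_(x - y) f y).
near=> h; have h0 : 0 < h by near: h; exact: nbhs_right_gt.
have h1 : h <= 1 by near: h; exact: nbhs_right_le.
rewrite -[_ *: _]/(_ * _) mulrC ler_pdivrMr//.
have -> : h *: (x - y) + y = h *: x + (1 - h) *: y.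
  by rewrite scalerBr scalerBl scale1r -addrA [- _ + y]addrC.
have := cf h; rewrite (ltW h0) h1 => /(_ isT); lra.
Unshelve. all: by end_near. Qed.

Lemma derivative_scale (f : R -> R) (x y : R) : derivable f y 1 -> 'D_x f y = x * derive1 f y.
Proof.
move=> df; have dfy : differentiable f y by apply/derivable1_diffP.
by rewrite deriveE// -[x in LHS]mulr1 -[_ * 1]/(x *: 1) linearZ/= -deriveE// derive1E.
Qed.

Lemma convex_C1_real_ge (f : R -> \bar R) (x y : R) : econvex f -> C1_real f ->
  derive1 (fine \o f) y * (x - y) <= fine (f x) - fine (f y).
Proof.
move=> cf [ff df _]; rewrite mulrC -derivative_scale//.
apply: (@convex_derive_le R (fine \o f)); last first.
  by apply: diff_derivable; apply/derivable1_diffP.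
move=> t t01; have := cf t x y t01.
by rewrite -(fineK (ff x)) -(fineK (ff y)) -(fineK (ff (_ + _))) -!EFinM -EFinD lee_fin.
Qed.

Lemma derivative_rV n (W : 'rV[R]_n -> R) (x v : 'rV[R]_n) : differentiable W x ->
  'D_v W x = dot (\row_i 'D_(delta_mx ord0 i) W x) v.
Proof.
move=> dW; rewrite deriveE// [in LHS](row_sum_delta v) linear_sum/=.
apply: eq_bigr => i _; rewrite linearZ/= mxE deriveE// mulrC.
by [].
Qed.

Lemma convex_gradient_le n (W : 'rV[R]_n -> R) (x y : 'rV[R]_n) :
  convex_function [set: 'rV[R]_n] W -> differentiable W y ->
  dot (\row_i 'D_(delta_mx ord0 i) W y) (x - y) <= W x - W y.
Proof.
move=> cW dW; rewrite -derivative_rV//; apply: convex_derive_le; last exact: diff_derivable.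
move=> t /andP[t0 t1]; have t01 : Itv.spec (@Itv.num_sem R) (Itv.Real `[0%Z, 1%Z]) t.
  by rewrite /= /Itv.num_sem /= in_itv/= t0 t1 num_real.
have := cW (Itv.Def t01) x y; rewrite !in_setT => /(_ isT isT).
by rewrite convRE.
Qed.

Lemma continuous_bounded n (f : 'rV[R]_n -> R) (A : set 'rV[R]_n) : continuous f ->
  bounded_set A -> exists b : R, forall x, A x -> `|f x| <= b.
Proof.
move=> cf bA.
have cA : compact (closure A).
  by apply: bounded_closed_compact; [exact: closure_bounded|exact: closed_closure].
have : bounded_set (f @` closure A).
  apply: compact_bounded; apply: continuous_compact => //.
  exact: continuous_subspaceT.
move=> /pinfty_ex_gt0[b b0 /= fb]; exists b => x Ax; apply: fb.
by exists x => //; exact: subset_closure.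
Qed.

End convex_derivative.

Section dual_power.
Context {R : realType}.
Implicit Types (a b t r : R).

(** The derivative of |t|^r / r for r > 1. *)
Definition dual_power r t := `|t| `^ (r - 2) * t.

Lemma normr_dual_power r t : 1 < r -> `|dual_power r t| = `|t| `^ (r - 1).
Proof.
move=> r1; have [->|t0] := eqVneq t 0.
  by rewrite /dual_power mulr0 !normr0 powR0// gt_eqF// subr_gt0.
rewrite /dual_power normrM ger0_norm ?powR_ge0//.
rewrite -{2}(powRr1 (normr_ge0 t)) -powRD ?normr_eq0 ?t0 ?implybT//.
by congr (_ `^ _); lra.
Qed.

Lemma powR_dual_power r t : 1 < r -> `|dual_power r t| `^ conj_exp r = `|t| `^ r.
Proof.
move=> r1; rewrite normr_dual_power// -powRrM; congr (_ `^ _).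
by rewrite /conj_exp mulrC divfK// gt_eqF// subr_gt0.
Qed.

Lemma measurable_dual_power r : measurable_fun setT (dual_power r).
Proof.
apply: measurable_funM => //.
apply: (@measurableT_comp _ _ _ _ _ _ (fun t : R => t `^ (r - 2))).
  exact: measurable_powR.
exact: normr_measurable.
Qed.

(** The exponent r - 2 may be negative. Near 0 the modulus |t|^(r-1) is used instead, and elsewhere
    the power is an exponential of a logarithm. *)
Lemma continuous_dual_power r : 1 < r -> continuous (dual_power r).
Proof.
move=> r1 t; have r0 : 0 < r - 1 by rewrite subr_gt0.
have [->|t0] := eqVneq t 0.
  rewrite /continuous_at {2}/dual_power mulr0; apply/cvgrPdist_lt => e e0.
  near=> u; rewrite sub0r normrN normr_dual_power//.
  have <- : (e `^ (r - 1)^-1) `^ (r - 1) = e.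
    by rewrite -powRrM mulVf ?gt_eqF// powRr1// ltW.
  rewrite gt0_ltr_powR ?nnegrE ?powR_ge0//.
  near: u; exists (e `^ (r - 1)^-1) => /=; first exact: powR_gt0.
  by move=> u /=; rewrite sub0r normrN.
rewrite /continuous_at /dual_power; apply: cvgM; last exact: cvg_id.
apply: (@cvg_trans _ ((fun u : R => expR ((r - 2) * ln `|u|)) @ t)).
  apply: near_eq_cvg; near=> u.
  rewrite /powR normr_eq0 ifF//; apply/negbTE.
  near: u; exists `|t| => /=; first by rewrite normr_gt0.
  by move=> u /=; apply: contraTneq => ->; rewrite subr0 ltxx.
rewrite /powR normr_eq0 (negbTE t0).
apply: (continuous_comp (f := fun u => (r - 2) * ln `|u|)); last exact: continuous_expR.
apply: continuousM; first exact: cst_continuous.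
apply: (continuous_comp (f := fun u : R => `|u|)); first exact: norm_continuous.
by apply: continuous_ln; rewrite normr_gt0.
Unshelve. all: by end_near. Qed.

(** The tangent inequality for |t|^r / r, derived from Young's inequality for |b| and |a|^(r-1),
    which is an equality at b = a. *)
Lemma dual_power_ge r a b : 1 < r ->
  `|a| `^ r / r - `|b| `^ r / r <= dual_power r a * (a - b).
Proof.
move=> r1; have r0 : 0 < r by exact: lt_trans r1.
have q0 : 0 < conj_exp r by exact: lt_trans (conj_exp_gt1 r1).
have := conjugate_powR (normr_ge0 b) (normr_ge0 (dual_power r a)) r0 q0 (conj_exp_inv r1).
rewrite powR_dual_power// -normrM => yb.
have := le_trans (ler_norm _) yb; rewrite mulrBr -powR_dual_mul//.
have -> : (conj_exp r)^-1 = 1 - r^-1 by rewrite -(conj_exp_inv r1) addrAC subrr add0r.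
rewrite /dual_power; lra.
Qed.

End dual_power.

Lemma dominated_Rintegral_cvg d (T : measurableType d) (R : realType)
  (mu : {measure set T -> \bar R}) (D : set T) (f_ : nat -> T -> R) (f g : T -> R) :
  measurable D -> (forall n, measurable_fun D (f_ n)) -> measurable_fun D f ->
  mu.-integrable D (EFin \o g) ->
  {ae mu, forall x, D x -> f_ n x @[n --> \oo] --> f x} ->
  {ae mu, forall x, D x -> forall n, `|f_ n x| <= g x} ->
  \int[mu]_(x in D) f_ n x @[n --> \oo] --> \int[mu]_(x in D) f x.
Proof.
move=> mD mf_ mf ig cf bf.
have [||||fi _ cvg_int] := @dominated_convergence _ _ _ mu D mD
    (fun n => EFin \o f_ n) (EFin \o f) (EFin \o g) _ _ _ ig.
- by move=> n; exact/measurable_EFinP.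
- exact/measurable_EFinP.
- by apply: filterS cf => x cf Dx; apply: cvg_EFin; [exact: nearW|exact: cf].
- by apply: filterS bf => x bf n Dx; rewrite /= lee_fin; exact: bf.
by apply: fine_cvg; rewrite fineK//; exact: integrable_fin_num.
Qed.

Section one_sided_limits.
Context {R : realType}.

Lemma harmonic_le1 n : harmonic n <= 1 :> R.
Proof. by rewrite /harmonic invf_le1 ?ltr0n// ler1n. Qed.

Lemma cvg_harmonic_lin (U : normedModType R) (a b : U) :
  harmonic n *: a + b @[n --> \oo] --> b.
Proof.
rewrite -[X in _ --> X]add0r -[X in _ --> X + _](scale0r a).
by apply: cvgD; [apply: cvgZr_tmp; exact: cvg_harmonic|exact: cvg_cst].
Qed.

Lemma convex_C1_real_monotone (f : R -> \bar R) (x y : R) : econvex f -> C1_real f ->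
  0 <= (derive1 (fine \o f) x - derive1 (fine \o f) y) * (x - y).
Proof.
move=> cf c1; have := convex_C1_real_ge x y cf c1; have := convex_C1_real_ge y x cf c1.
set a := derive1 _ _; set b := derive1 _ _; lra.
Qed.

Lemma ler_norm_between (x lo hi : R) : lo <= x -> x <= hi -> `|x| <= `|hi| + `|lo|.
Proof.
move=> lx xh; have [x0|x0] := ger0P x.
  by rewrite (le_trans xh)// (le_trans (ler_norm _))// lerDl.
rewrite (@le_trans _ _ `|lo|)// ?lerDr// -normrN (le_trans _ (ler_norm _))//.
by rewrite lerN2.
Qed.

Lemma derivative_between (f : R -> \bar R) (a b t : R) : econvex f -> C1_real f ->
  0 < t <= 1 ->
  `|derive1 (fine \o f) (t * b + a) * b| <=
  `|derive1 (fine \o f) (1 * b + a) * b| + `|derive1 (fine \o f) a * b|.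
Proof.
move=> cf c1 /andP[t0 t1].
have lo : derive1 (fine \o f) a * b <= derive1 (fine \o f) (t * b + a) * b.
  have := convex_C1_real_monotone (t * b + a) a cf c1.
  by rewrite addrK mulrCA pmulr_rge0// mulrBl subr_ge0.
have hi : derive1 (fine \o f) (t * b + a) * b <= derive1 (fine \o f) (1 * b + a) * b.
  have [->//|tn1] := eqVneq t 1; have {}t1 : 0 < 1 - t by rewrite subr_gt0 lt_neqAle tn1.
  have := convex_C1_real_monotone (1 * b + a) (t * b + a) cf c1.
  rewrite (_ : _ - (t * b + a) = (1 - t) * b); last by ring.
  by rewrite mulrCA pmulr_rge0// mulrBl subr_ge0.
exact: ler_norm_between lo hi.
Qed.

End one_sided_limits.

(** The arithmetic of [variation_ge0]: [A] and [B] are the values of W at the gradients of u and v,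
    [C] and [D] those of psi_h at u and v, where u = v + t w. *)
Lemma tangent_sum (R : realType) (a b c e t A B C D : R) :
  - (t * a) <= B - A -> b * (e - (t * c + e)) <= D - C ->
  A + C <= B + D + t * (a + b * c).
Proof. lra. Qed.

(** * The Euler-Lagrange equation *)

Section euler_lagrange.
Context {R : realType} {m : nat} (Om GammaD : set 'rV[R]_m.+2) (M : mesh R m.+2).
Hypothesis Om_dom : polyhedral_lipschitz_domain Om.
Hypothesis M_mesh : is_mesh M Om.
Variables (k : nat) (r s : R).
Hypothesis r_gt1 : 1 < r.
Variables (W : 'rV[R]_m.+2 -> R) (psi : 'rV[R]_m.+2 -> R -> \bar R).
Hypothesis W_convex : convex_function [set: 'rV[R]_m.+2] W.
Hypothesis W_C1 : C1_rV W.
Hypothesis psi_meas : psi_measurable Om psi.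
Hypothesis psi_plc : psi_proper_lsc_convex Om psi.
Hypothesis psiC1 : psi_C1 Om psi.
Local Notation V := 'rV[R]_m.+2.
Local Notation leb := (@lebesgue_rV R m.+2).
Local Notation grad := (discrete_gradient Om GammaD k).
Implicit Types (K : cellT M) (S : faceT M) (x : V) (u v w phi q : pwpoly M).

Let mO := domain_measurable Om_dom.
Let bO := bounded_measurable_pweval Om_dom M_mesh.
Let mS S := face_measurable M_mesh S.
Let bj S v := bounded_measurable_jump Om_dom M_mesh S v.
Let iO (f : V -> R) := @integrable_domain R m Om Om_dom f.

Definition gradient (y : V) : V := \row_i 'D_(delta_mx ord0 i) W y.

Definition psi_derivative u q :=
  P_ k q /\ {ae leb, forall x, Om x ->
    derive1 (fine \o psi x) (pweval u x) = pweval q x}.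

(* The derivative of E_h at u in direction w, if q is the derivative of psi_h
   along u. *)
Definition variation u q w : R :=
  \int[leb]_(x in Om) (dot (gradient (pwevalV (grad u) x)) (pwevalV (grad w) x) +
    pweval q x * pweval w x) + s_h GammaD r s u w.

Lemma W_continuousT : continuous W.
Proof. by move=> x; apply: differentiable_continuous; case: W_C1. Qed.

Lemma pwevalV_box (F : 'I_m.+2 -> pwpoly M) :
  exists2 e : R, 0 < e & forall x, Om x -> box 0 e (pwevalV F x).
Proof.
have [b Fb] := fin_all_exists (fun i => (bO (F i)).2).
exists (\sum_i `|b i| + 1) => [|x Ox i]; first by rewrite ltr_wpDl ?sumr_ge0.
rewrite !mxE subr0 (le_lt_trans (Fb i x Ox))// (le_lt_trans (ler_norm _))//.
by rewrite (bigD1 i)//= -addrA ltrDl ltr_wpDl// sumr_ge0.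
Qed.

Lemma bounded_measurable_gradient (F : 'I_m.+2 -> pwpoly M) i :
  bounded_measurable Om (fun x => gradient (pwevalV F x) ord0 i).
Proof.
have [_ /(_ i) cW] := W_C1; under eq_fun do rewrite mxE.
split.
  apply: measurable_funTS; apply: (@measurableT_comp _ _ _ _ _ _ (fun y => 'D_(delta_mx ord0 i) W y)).
    exact: continuous_measurable_rV.
  exact: (measurable_pwevalV M_mesh).
have [e e0 Fe] := pwevalV_box F.
have [b eb] := continuous_bounded cW (box_bounded 0 e).
by exists b => x Ox; apply/eb/Fe.
Qed.

Lemma bounded_measurable_dot (f : V -> V) (F : 'I_m.+2 -> pwpoly M) :
  (forall i, bounded_measurable Om (fun x => f x ord0 i)) ->
  bounded_measurable Om (fun x => dot (f x) (pwevalV F x)).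
Proof.
move=> bf; apply: bounded_measurable_sum => i _; apply: bounded_measurableM => //.
by under eq_fun do rewrite mxE; exact: bO.
Qed.

Lemma bounded_measurable_variation u q w : bounded_measurable Om (fun x =>
  dot (gradient (pwevalV (grad u) x)) (pwevalV (grad w) x) + pweval q x * pweval w x).
Proof.
apply: bounded_measurableD; last exact: bounded_measurableM.
by apply: bounded_measurable_dot => i; exact: bounded_measurable_gradient.
Qed.

Lemma bounded_measurable_dual_power S u : bounded_measurable (face S)
  (fun x => dual_power r (jump S u x)).
Proof.
have [mj [b jb]] := bj S u; split.
  apply: (@measurableT_comp _ _ _ _ _ _ (dual_power r)) => //.
  exact: measurable_dual_power.
exists (b `^ (r - 1)) => x Sx; rewrite normr_dual_power// ge0_ler_powR ?nnegrE ?subr_ge0 ?(ltW r_gt1)//.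
- exact: le_trans (jb x Sx).
- exact: jb.
Qed.

(** [dual_power_ge] integrated over the faces, with the jumps of u and v as arguments; their
    difference is t times the jump of w. *)
Lemma s_h_convex t v w : 0 < t ->
  s_h GammaD r s (fun K => t *: w K + v K) (fun K => t *: w K + v K) / r -
    s_h GammaD r s v v / r <= t * s_h GammaD r s (fun K => t *: w K + v K) w.
Proof.
move=> t0; set u := fun K => _; rewrite !(s_hE _ _ r_gt1) -mulrBl -sumrB mulr_suml mulr_sumr.
apply: ler_sum => S _; rewrite -mulrBr -mulrA [leRHS]mulrCA ler_wpM2l ?powR_ge0//.
have ip z : (surf S).-integrable (face S) (EFin \o (fun x => `|jump S z x| `^ r)).
  apply: (integrable_face Om_dom M_mesh); apply: bounded_measurable_powR => //.
  by rewrite ltW// (lt_trans ltr01).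
have id : (surf S).-integrable (face S) (EFin \o (fun x => dual_power r (jump S u x) * jump S w x)).
  apply: (integrable_face Om_dom M_mesh); apply: bounded_measurableM => //.
  exact: bounded_measurable_dual_power.
rewrite -RintegralB// -RintegralZr// -?RintegralZl//; last exact: (integrableB (mS S) (ip u) (ip v)).
apply: le_Rintegral => //.
- exact: (integrableZr (mS S) r^-1 (integrableB (mS S) (ip u) (ip v))).
- exact: (integrableZl (mS S) t id).
move=> x Sx; rewrite mulrBl (le_trans (dual_power_ge _ _ r_gt1))//.
by rewrite {2}/u jump_lin addrK mulrCA.
Qed.

(* The energy at v is above its tangent at v + t w, whose slope is the
   variation. *)
Lemma variation_ge0 v w t (q : pwpoly M) (mv : R) : 0 < t -> P_ k v ->
  E_h Om GammaD M k r s W psi v = mv%:E ->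
  (mv%:E <= E_h Om GammaD M k r s W psi (fun K => (t *: w K + v K)%R))%E ->
  psi_derivative (fun K => t *: w K + v K) q ->
  0 <= variation (fun K => t *: w K + v K) q w.
Proof.
move=> t0 Pv Ev + [_ qE]; set u := fun K => _ => mu_.
have [d md dE] := energy_density_measurable GammaD Om_dom M_mesh k W_continuousT psi_meas v.
have DE : (\int[leb]_(x in Om) energy_density Om GammaD k W psi v x =
    \int[leb]_(x in Om) d x)%E by exact: eq_integral_ae.
have Dfin : (\int[leb]_(x in Om) d x)%E = (mv - s_h GammaD r s v v / r)%:E.
  by rewrite -DE; exact: adde_EFin_eq Ev.
have idd : leb.-integrable Om d.
  by apply: fin_num_integrable => //; [exact: measurable_funTS|rewrite Dfin].
pose F x := dot (gradient (pwevalV (grad u) x)) (pwevalV (grad w) x) +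
    pweval q x * pweval w x.
have iF : leb.-integrable Om (EFin \o F) := iO (bounded_measurable_variation u q w).
have itF : leb.-integrable Om (EFin \o (fun x => t * F x)) := integrableZl mO t iF.
(* Only an upper bound is needed, so the density at u need not be shown integrable beforehand. *)
have le : (\int[leb]_(x in Om) energy_density Om GammaD k W psi u x <=
    (mv - s_h GammaD r s v v / r + t * \int[leb]_(x in Om) F x)%:E)%E.
  rewrite EFinD -Dfin -RintegralZl// EFin_Rintegral// -integralD//.
  apply: le_integral_ae => //.
  apply: filterS2 (filterI dE qE) (filterI psi_plc psiC1) => x [dEx qEx] [plc c1] Ox.
  rewrite /= -dEx// /energy_density.
  have [_ _ cvx] := plc Ox; have [fpsi _ _] := c1 Ox.
  move: (fineK (fpsi (pweval u x))) (fineK (fpsi (pweval v x))) => <- <-.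
  rewrite -!EFinD lee_fin.
  have := convex_C1_real_ge (pweval v x) (pweval u x) cvx (c1 Ox).
  rewrite qEx//.
  have := convex_gradient_le (pwevalV (grad v) x) W_convex (W_C1.1 (pwevalV (grad u) x)).
  rewrite -/(gradient _).
  have -> : pwevalV (grad v) x - pwevalV (grad u) x = - (t *: pwevalV (grad w) x).
    apply/rowP => i; rewrite !mxE /u (discrete_gradient_lin _ Om_dom M_mesh) pweval_lin.
    by rewrite opprD addrC subrK.
  rewrite dotNr dotZr {2}/u pweval_lin /F.
  exact: tangent_sum.
have := s_h_convex v w t0; rewrite -/u => sle.
have : mv <= (mv - s_h GammaD r s v v / r + t * \int[leb]_(x in Om) F x) + s_h GammaD r s u u / r.
  by rewrite -lee_fin (le_trans mu_)// /E_h EFinD leeD2r.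
rewrite -(pmulr_rge0 _ t0) /variation -/u mulrDr -/F; move: sle; lra.
Qed.

Section limit.
Variables (v w : pwpoly M).

Let u_ n : pwpoly M := fun K => harmonic n *: w K + v K.

Lemma pwevalV_grad_lin t x : pwevalV (grad (fun K => t *: w K + v K)) x =
  t *: pwevalV (grad w) x + pwevalV (grad v) x.
Proof.
by apply/rowP => i; rewrite !mxE (discrete_gradient_lin _ Om_dom M_mesh) pweval_lin.
Qed.

Lemma gradient_term_cvg x : Om x ->
  dot (gradient (pwevalV (grad (u_ n)) x)) (pwevalV (grad w) x) @[n --> \oo] -->
  dot (gradient (pwevalV (grad v) x)) (pwevalV (grad w) x).
Proof.
move=> Ox; apply: cvg_big => [|i _]; first exact: add_continuous.
apply: cvgM; last exact: cvg_cst.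
rewrite (_ : (fun n => _) = (fun y => 'D_(delta_mx ord0 i) W y) \o
    (fun n => harmonic n *: pwevalV (grad w) x + pwevalV (grad v) x)).
  have -> : gradient (pwevalV (grad v) x) ord0 i =
      'D_(delta_mx ord0 i) W (pwevalV (grad v) x) by rewrite mxE.
  by apply: continuous_cvg; [exact: W_C1.2|exact: cvg_harmonic_lin].
by apply/funext => n; rewrite mxE /= pwevalV_grad_lin.
Qed.

Lemma gradient_term_bounded : exists b : R, forall x n, Om x ->
  `|dot (gradient (pwevalV (grad (u_ n)) x)) (pwevalV (grad w) x)| <= b.
Proof.
have [e1 e10 be1] := pwevalV_box (grad w).
have [e2 e20 be2] := pwevalV_box (grad v).
have [c Dc] := fin_all_exists (fun i =>
  continuous_bounded (W_C1.2 i) (box_bounded 0 (e1 + e2))).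
(* The steps are at most one, so the discrete gradients stay in a box of radius [e1 + e2], where the
   partial derivatives of W are bounded by the [c i]. *)
exists (\sum_i `|c i| * e1) => x n Ox; rewrite (le_trans (ler_norm_sum _ _ _))//.
apply: ler_sum => i _; rewrite normrM ler_pM//; last first.
  by rewrite mxE; have := be1 x Ox i; rewrite !mxE subr0 => /ltW.
rewrite mxE (le_trans _ (ler_norm _))// Dc// pwevalV_grad_lin => j.
rewrite !mxE subr0 (le_lt_trans (ler_normD _ _))// ler_ltD//; last first.
  by have := be2 x Ox j; rewrite !mxE subr0.
rewrite normrM ger0_norm ?harmonic_ge0// -[leRHS]mul1r ler_pM ?harmonic_ge0 ?harmonic_le1//.
by have := be1 x Ox j; rewrite !mxE subr0 => /ltW.
Qed.

Lemma variation_cvg q (q_ : nat -> pwpoly M) :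
  psi_derivative v q -> (forall n, psi_derivative (u_ n) (q_ n)) ->
  variation (u_ n) (q_ n) w @[n --> \oo] --> variation v q w.
Proof.
move=> [Pq qE] qnE; apply: cvgD; last first.
  apply: cvg_big => [|S _]; first exact: add_continuous.
  apply: cvgM; first exact: cvg_cst.
  have [_ [a ja]] := bj S w; have [_ [b jb]] := bj S v.
  (* Here [a] and [b] bound the jumps of w and v, so that those of v + w / (n + 1) are bounded by
     [a + b]. *)
  apply: (@dominated_Rintegral_cvg _ _ _ _ _ _ _ (fun=> (a + b) `^ (r - 1) * a)) => //.
  - move=> n; apply: measurable_funM; last exact: (bj S w).1.
    exact: (bounded_measurable_dual_power S _).1.
  - apply: measurable_funM; last exact: (bj S w).1.
    exact: (bounded_measurable_dual_power S _).1.
  - exact: (integrable_face Om_dom M_mesh (bounded_measurable_cst _ _)).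
  - apply: aeW => x Sx; apply: cvgM; last exact: cvg_cst.
    rewrite (_ : (fun n => _) = dual_power r \o (fun n => harmonic n *: jump S w x + jump S v x)).
      by apply: continuous_cvg; [exact: continuous_dual_power|exact: cvg_harmonic_lin].
    by apply/funext => n; rewrite /= -jump_lin.
  - apply: aeW => x Sx n; rewrite normrM ler_pM ?ja//.
    rewrite -/(dual_power r _) normr_dual_power// ge0_ler_powR ?nnegrE ?subr_ge0 ?(ltW r_gt1)//.
      by rewrite addr_ge0// ?(le_trans _ (ja x Sx)) ?(le_trans _ (jb x Sx)).
    rewrite jump_lin (le_trans (ler_normD _ _))// lerD ?jb// normrM ger0_norm ?harmonic_ge0//.
    by rewrite -[leRHS]mul1r ler_pM ?harmonic_ge0 ?harmonic_le1 ?ja.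
have [b Fb] := gradient_term_bounded.
(* [b] dominates the gradient terms; [q_ 0] and [q] are the derivatives of psi_h along v + w and v,
   bounded because they are piecewise polynomials. *)
apply: (@dominated_Rintegral_cvg _ _ _ _ _ _ _ (fun x => b +
  (`|pweval (q_ 0%N) x * pweval w x| + `|pweval q x * pweval w x|))) => //.
- by move=> n; exact: (bounded_measurable_variation _ _ _).1.
- exact: (bounded_measurable_variation _ _ _).1.
- apply: iO; apply: bounded_measurableD; first exact: bounded_measurable_cst.
  have bn (z : pwpoly M) : bounded_measurable Om (fun x => `|pweval z x * pweval w x|).
    have [mz [c zc]] := bounded_measurableM (bO z) (bO w).
    split; first exact: measurableT_comp.
    by exists c => x Ox; rewrite normr_id zc.
  exact: bounded_measurableD.
- apply: filterS3 qE (ae_foralln (fun n => (qnE n).2)) psiC1 => x qx qnx c1 Ox.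
  apply: cvgD; first exact: gradient_term_cvg.
  apply: cvgM; last exact: cvg_cst.
  rewrite -qx// (_ : (fun n => _) = derive1 (fine \o psi x) \o
      (fun n => harmonic n *: pweval w x + pweval v x)).
    have [_ _ cD] := c1 Ox.
    by apply: continuous_cvg; [exact: cD|exact: cvg_harmonic_lin].
  by apply/funext => n; rewrite -qnx//= pweval_lin.
- apply: filterS2 (filterI qE (ae_foralln (fun n => (qnE n).2))) (filterI psi_plc psiC1).
  move=> x [qx qnx] [plc c1] Ox n; rewrite (le_trans (ler_normD _ _))// lerD ?Fb//.
  have [_ _ cvx] := plc Ox; rewrite -qx// -!qnx// !pweval_lin.
  (* The sequence starts at step 1, so [q_ 0] is the upper end in [derivative_between]. *)
  have -> : harmonic 0%N = 1 :> R by rewrite /harmonic/= invr1.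
  by apply: derivative_between => //; [exact: c1|rewrite harmonic_gt0 harmonic_le1].
Qed.

End limit.

End euler_lagrange.

Lemma RintegralN d (T : measurableType d) (R : realType)
  (mu : {measure set T -> \bar R}) (D : set T) (f : T -> R) : measurable D ->
  mu.-integrable D (EFin \o f) ->
  \int[mu]_(x in D) (- f x) = - (\int[mu]_(x in D) f x).
Proof.
move=> mD fi; have <- : \int[mu]_(x in D) (-1 * f x) = - (\int[mu]_(x in D) f x).
  by rewrite RintegralZl// mulN1r.
by apply: eq_Rintegral => x _; rewrite mulN1r.
Qed.

(** * Strong duality *)

Section strong_duality.
Context {R : realType} {m : nat} (Om GammaD : set 'rV[R]_m.+2) (M : mesh R m.+2).
Hypothesis Om_dom : polyhedral_lipschitz_domain Om.
Hypothesis M_mesh : is_mesh M Om.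
Hypothesis GD : dirichlet_boundary M Om GammaD.
Variables (k : nat) (p r s : R).
Hypothesis k_ge1 : (1 <= k)%N.
Hypotheses (p_gt1 : 1 < p) (r_gt1 : 1 < r).
Variables (W : 'rV[R]_m.+2 -> R) (psi : 'rV[R]_m.+2 -> R -> \bar R).
Hypothesis W_convex : convex_function [set: 'rV[R]_m.+2] W.
Hypothesis W_C1 : C1_rV W.
Hypothesis psi_meas : psi_measurable Om psi.
Hypothesis psi_plc : psi_proper_lsc_convex Om psi.
Hypothesis psiC1 : psi_C1 Om psi.
Hypothesis psi_pw : psi_derivative_pwpoly Om M k psi.
Local Notation V := 'rV[R]_m.+2.
Local Notation leb := (@lebesgue_rV R m.+2).
Local Notation grad := (discrete_gradient Om GammaD k).
Local Notation E_ v := (E_h Om GammaD M k r s W psi v).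
Implicit Types (K : cellT M) (S : faceT M) (x : V) (u w phi : pwpoly M).

Let mO := domain_measurable Om_dom.
Let bO := bounded_measurable_pweval Om_dom M_mesh.
Let mS S := face_measurable M_mesh S.
Let bj S v := bounded_measurable_jump Om_dom M_mesh S v.
Let iO (f : V -> R) := @integrable_domain R m Om Om_dom f.

Variables (v q : pwpoly M) (mv : R).
Hypothesis Pv : P_ k v.
Hypothesis Ev : E_ v = mv%:E.
Hypothesis v_min : forall w, P_ k w -> (mv%:E <= E_ w)%E.
Hypothesis q_der : psi_derivative Om k psi v q.

Local Notation var w := (variation Om GammaD k r s W v q w).

Lemma variation_minimizer_ge0 w : P_ k w -> 0 <= var w.
Proof.
move=> Pw; pose u n : pwpoly M := fun K => harmonic n *: w K + v K.
have Pu n : P_ k (u n) by exact: P_lin.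
have /choice[q_ qE] : forall n, exists qn, psi_derivative Om k psi (u n) qn.
  by move=> n; have [qn Pqn qnE] := psi_pw (Pu n); exists qn.
have c := variation_cvg (GammaD := GammaD) (s := s) Om_dom M_mesh r_gt1 W_C1 psi_plc psiC1 q_der qE.
rewrite -(cvg_lim _ c)//; apply: limr_ge; first by apply/cvg_ex; exists (var w).
apply: nearW => n; apply: (variation_ge0 Om_dom M_mesh r_gt1 W_convex W_C1 psi_meas
  psi_plc psiC1 (harmonic_gt0 n) Pv Ev); last exact: qE.
exact: (v_min (Pu n)).
Qed.

Lemma discrete_gradient0 i K : grad (fun _ : cellT M => 0) i K = 0.
Proof.
have := congr1 (fun g : pwpoly M => g K) (discrete_gradient_lin GammaD Om_dom M_mesh k
  (fun=> 0) (fun=> 0) 1 i).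
under [X in grad X]eq_fun do rewrite scaler0 addr0.
by rewrite scale1r => /esym/eqP; rewrite -subr_eq0 addrK => /eqP.
Qed.

(** The direction [-w] is written as a linear combination with the zero polynomial, to match the
    linearity lemmas. *)
Lemma variationN w : var (fun K => -1 *: w K + 0) = - var w.
Proof.
rewrite /variation opprD; congr (_ + _).
  rewrite -RintegralN//; last first.
    by apply: iO; exact: (bounded_measurable_variation GammaD Om_dom M_mesh).
  apply: eq_Rintegral => x _.
  have -> : pwevalV (grad (fun K => -1 *: w K + 0)) x =
      -1 *: pwevalV (grad w) x + pwevalV (grad (fun _ : cellT M => 0)) x.
    exact: (pwevalV_grad_lin _ Om_dom M_mesh).
  rewrite pweval_lin pweval0 dotDr dotZr [X in _ + X + _](_ : _ = 0); first by ring.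
  rewrite /dot big1// => i _.
  have -> : pwevalV (grad (fun _ : cellT M => 0)) x ord0 i = 0; last by rewrite mulr0.
  rewrite mxE (_ : grad _ i = fun=> 0) ?pweval0//.
  by apply/funext => K; exact: discrete_gradient0.
rewrite /s_h -sumrN; apply: eq_bigr => S _; rewrite -mulrN; congr (_ * _).
rewrite -RintegralN//; last first.
  apply: (integrable_face Om_dom M_mesh); apply: bounded_measurableM => //.
  exact: (bounded_measurable_dual_power Om_dom M_mesh).
apply: eq_Rintegral => x _; rewrite jump_lin.
have -> : jump S (fun=> 0) x = 0.
  by rewrite /jump; case: Kminus => [L|]; rewrite /peval !meval0 ?subr0.
by rewrite addr0 mulN1r mulrN.
Qed.

Lemma variation_minimizer w : P_ k w -> var w = 0.
Proof.
move=> Pw; apply/eqP; rewrite eq_le variation_minimizer_ge0// andbT -oppr_ge0 -variationN.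
by apply: variation_minimizer_ge0; apply: P_lin => //; exact: P_0.
Qed.

Lemma bounded_measurable_in_Lp (mu : {measure set V -> \bar R}) (D : set V) (e : R) f :
  measurable D -> (mu D < +oo)%E -> 0 <= e -> bounded_measurable D f -> in_Lp mu D e f.
Proof.
move=> mD Doo e0 bf; split; first exact: bf.1.
have := bounded_measurable_integrable mD Doo (bounded_measurable_powR e0 bf).
move=> /integrableP[_]; apply: le_lt_trans; apply: le_integral_ae => //.
by apply: aeW => x _; rewrite /= lee_fin ler_norm.
Qed.

(* tau1 = DW (grad_h v), and sigma S = {Pi tau1}_S . nu_S - h_S^-s |[v]|^(r-2) [v]
   unless S is a Neumann face; the faces overlap in null sets. *)
Let tau1 x := gradient W (pwevalV (grad v) x).

Let PI : 'I_m.+2 -> pwpoly M := L2_projectionV Om k.-1 tau1.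

Let sigma S x := (~~ neumann_face GammaD S)%:R *
  (dot (avgV S PI x) (normal S) - diam (face S) `^ (- s) * dual_power r (jump S v x)).

Let tau2 x := if [pick L | `[< face L x >]] is Some L then sigma L x else 0.

Let tau := (tau1, tau2).

Lemma bounded_measurable_normal_avg S (F : 'I_m.+2 -> pwpoly M) :
  bounded_measurable (face S) (fun x => dot (avgV S F x) (normal S)).
Proof.
rewrite (_ : (fun x => _) = fun x => \sum_i avg S (F i) x * normal S ord0 i).
  apply: bounded_measurable_sum => i _; apply: bounded_measurableM.
    exact: (bounded_measurable_avg Om_dom M_mesh).
  exact: bounded_measurable_cst.
by apply/funext => x; apply: eq_bigr => i _; rewrite mxE.
Qed.

Lemma bounded_measurable_sigma S : bounded_measurable (face S) (sigma S).
Proof.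
apply: bounded_measurableM; first exact: bounded_measurable_cst.
apply: bounded_measurableB; first exact: bounded_measurable_normal_avg.
apply: bounded_measurableM; first exact: bounded_measurable_cst.
exact: (bounded_measurable_dual_power Om_dom M_mesh).
Qed.

Lemma measurable_jump S u : measurable_fun setT (jump S u).
Proof.
rewrite /jump; case: Kminus => [L|]; last exact: measurable_peval.
by apply: measurable_funB; exact: measurable_peval.
Qed.

Lemma measurable_avg S u : measurable_fun setT (avg S u).
Proof.
rewrite /avg; case: Kminus => [L|]; last exact: measurable_peval.
by apply: measurable_funM => //; apply: measurable_funD; exact: measurable_peval.
Qed.

Lemma measurable_sigma S : measurable_fun setT (sigma S).
Proof.
apply: measurable_funM => //; apply: measurable_funB.
  apply: measurable_sum => i; apply: measurable_funM => //.
  by under eq_fun do rewrite mxE; exact: measurable_avg.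
apply: measurable_funM => //; apply: (@measurableT_comp _ _ _ _ _ _ (dual_power r)).
  exact: measurable_dual_power.
exact: measurable_jump.
Qed.

Lemma bounded_measurable_tau2 S : bounded_measurable (face S) tau2.
Proof.
split.
  by apply: measurable_funTS; apply: measurable_fun_pick => L; [exact: mS|exact: measurable_sigma].
have [b sb] := fin_all_exists (fun L => (bounded_measurable_sigma L).2).
exists (\sum_L `|b L|) => x _; rewrite /tau2; case: pickP => [L /asboolP Lx|_].
  rewrite (le_trans (sb L x Lx))// (le_trans (ler_norm _))// (bigD1 L)//=.
  by rewrite lerDl sumr_ge0.
by rewrite normr0 sumr_ge0.
Qed.

Lemma ae_tau2 S : {ae surf S, forall x, face S x -> tau2 x = sigma S x}.
Proof.
have : {ae surf S, forall x L, S != L -> ~ (face S `&` face L) x}.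
  apply: (@filter_forall _ _ (fun L x => S != L -> ~ (face S `&` face L) x)) => L.
  have [->|SL] := eqVneq S L; first exact: aeW.
  exists (face S `&` face L); split; [exact: measurableI|exact: (face_overlap M_mesh)|].
  by move=> x /= /not_implyP[_ /contrapT].
apply: filterS => x xu Sx; rewrite /tau2; case: pickP => [L /asboolP Lx|/(_ S)].
  by have [->//|/xu] := eqVneq S L; case.
by move=> /asboolP.
Qed.

Lemma integrable_tau1 i : leb.-integrable Om (EFin \o (fun x => tau.1 x ord0 i)).
Proof. by apply: iO; exact: (bounded_measurable_gradient Om_dom M_mesh). Qed.

(** Both components are bounded on sets of finite measure, hence lie in all the required Lebesgue
    spaces. *)
Lemma optimal_in_Y : Y Om GammaD M p tau.
Proof.
split=> [i|S|S nS].
- apply: bounded_measurable_in_Lp => //; first exact: (domain_finite Om_dom).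
    by rewrite ltW// (lt_trans ltr01)// conj_exp_gt1.
  exact: (bounded_measurable_gradient Om_dom M_mesh).
- apply: bounded_measurable_in_Lp => //; first exact: (surf_face_finite Om_dom M_mesh).
  exact: bounded_measurable_tau2.
- by apply: filterS (ae_tau2 S) => x t2 Sx; rewrite /= t2// /sigma nS mul0r.
Qed.

Lemma bounded_measurable_tau1_dot (F : 'I_m.+2 -> pwpoly M) :
  bounded_measurable Om (fun x => dot (tau1 x) (pwevalV F x)).
Proof.
apply: (bounded_measurable_dot Om_dom M_mesh) => i.
exact: (bounded_measurable_gradient Om_dom M_mesh).
Qed.

Lemma variationE w : var w =
  \int[leb]_(x in Om) dot (tau1 x) (pwevalV (grad w) x) +
  \int[leb]_(x in Om) (pweval q x * pweval w x) + s_h GammaD r s v w.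
Proof.
rewrite /variation RintegralD//; first exact: iO (bounded_measurable_tau1_dot _).
by apply: iO; exact: bounded_measurableM.
Qed.

(** With tau_S inserted, the projection terms turn the piecewise gradient of phi into grad_h phi and
    the remaining face terms give s_h(v; phi). The vanishing variation then is the defining equation
    of div_h tau. *)
Lemma optimal_divergence : discrete_divergence Om GammaD k tau = q.
Proof.
apply: (discrete_divergence_eq Om_dom M_mesh); first exact: integrable_tau1.
  move=> S; apply: (integrable_face Om_dom M_mesh); exact: bounded_measurable_tau2.
split=> [|phi Pphi]; first exact: q_der.1.
have := variation_minimizer Pphi; rewrite variationE.
rewrite (Rintegral_gradient_residual Om_dom M_mesh GD k_ge1 integrable_tau1 Pphi).
have -> : \sum_(S | ~~ neumann_face GammaD S) \int[surf S]_(x in face S) (tau.2 x * jump S phi x)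
  = \sum_(S | ~~ neumann_face GammaD S)
      \int[surf S]_(x in face S) (dot (avgV S PI x) (normal S) * jump S phi x)
    - s_h GammaD r s v phi.
  rewrite /s_h -sumrB; apply: eq_bigr => S nS.
  have b1 := bounded_measurableM (bounded_measurable_normal_avg S PI) (bj S phi).
  have b2 := bounded_measurableM (bounded_measurable_dual_power Om_dom M_mesh r_gt1 S v) (bj S phi).
  have i1 := integrable_face Om_dom M_mesh b1.
  have i2 := integrable_face Om_dom M_mesh b2.
  rewrite -RintegralZl// -RintegralB//; last exact: (integrableZl (mS S) _ i2).
  apply: ae_eq_Rintegral => //.
  - apply: measurable_funM; last exact: (bj S phi).1.
    exact: (bounded_measurable_tau2 S).1.
  - by apply: measurable_funB; [exact: b1.1|apply: measurable_funM; [exact: measurable_cst|exact: b2.1]].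
  apply: filterS (ae_tau2 S) => x t2 Sx; rewrite /= t2// /sigma nS mul1r mulrBl.
  by rewrite /dual_power -!mulrA.
rewrite /tau /=; lra.
Qed.

(** By the tangent inequality of W at grad_h v, the supremum in the conjugate is attained there:
    equality in Fenchel's inequality. *)
Lemma conjugate_gradient x : conjugate dot (EFin \o W) (tau1 x) =
  (dot (tau1 x) (pwevalV (grad v) x) - W (pwevalV (grad v) x))%:E.
Proof.
apply/eqP; rewrite eq_le; apply/andP; split; last first.
  exact: (conjugate_ge dot (EFin \o W) (pwevalV (grad v) x) (tau1 x)).
apply: ge_ereal_sup => _ [y _ <-]; rewrite /= -EFinB lee_fin.
have := convex_gradient_le y W_convex (W_C1.1 (pwevalV (grad v) x)).
rewrite -/(gradient W (pwevalV (grad v) x)) -/(tau1 x) dotBr; lra.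
Qed.

Lemma conjugate_derivative (f : R -> \bar R) (a : R) : econvex f -> C1_real f ->
  (conjugate *%R f (derive1 (fine \o f) a) = (derive1 (fine \o f) a * a)%:E - f a)%E.
Proof.
move=> cf c1; have [ff _ _] := c1.
apply/eqP; rewrite eq_le; apply/andP; split; last exact: conjugate_ge.
apply: ge_ereal_sup => _ [y _ <-]; have := convex_C1_real_ge y a cf c1.
move: (fineK (ff y)) (fineK (ff a)) => {2}<- {2}<-.
rewrite -!EFinB lee_fin mulrBr; lra.
Qed.

(** The residual on S is minus h^(-s) times [dual_power]. Its power r' carries h^(-s r'), and - s r'
    + s / (r - 1) = - s. *)
Lemma optimal_gamma : gamma_h Om GammaD M k r s tau = (s_h GammaD r s v v)%:E.
Proof.
rewrite (s_hE _ _ r_gt1) -sumEFin; apply: eq_bigr => S nS.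
have ir : (surf S).-integrable (face S) (EFin \o (fun x => `|jump S v x| `^ r)).
  apply: (integrable_face Om_dom M_mesh); apply: bounded_measurable_powR => //.
  by rewrite ltW// (lt_trans ltr01).
have h0 := diam_face_gt0 Om_dom M_mesh S.
pose c := diam (face S) `^ (- s).
rewrite (@eq_integral_ae _ _ _ (surf S) (face S) _
    (fun x => ((c `^ conj_exp r)%:E * (`|jump S v x| `^ r)%:E)%E))//; last first.
  apply: filterS (ae_tau2 S) => x t2 Sx; rewrite /= t2// /sigma nS mul1r addrAC subrr add0r.
  by rewrite normrN normrM powRM// ger0_norm ?powR_ge0// powR_dual_power// EFinM.
rewrite ge0_integralZl_EFin ?powR_ge0//; last exact: (measurable_int (surf S) ir).
rewrite -EFin_Rintegral// -?EFinM mulrA; congr (_ * _)%:E.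
rewrite /c -powRrM -powRD; last by rewrite (gt_eqF h0) implybT.
congr (_ `^ _); rewrite /conj_exp; field; rewrite gt_eqF// subr_gt0//.
Qed.

Lemma optimal_energy : E_h_dual Om GammaD M k r s W psi tau = mv%:E.
Proof.
have W_continuous := W_continuousT W_C1.
rewrite /E_h_dual optimal_gamma optimal_divergence.
have [d md dE] := energy_density_measurable GammaD Om_dom M_mesh k W_continuous psi_meas v.
have DE : (\int[leb]_(x in Om) energy_density Om GammaD k W psi v x =
    \int[leb]_(x in Om) d x)%E by exact: eq_integral_ae.
have Dfin : (\int[leb]_(x in Om) d x)%E = (mv - s_h GammaD r s v v / r)%:E.
  by rewrite -DE; exact: adde_EFin_eq Ev.
have idd : leb.-integrable Om d.
  by apply: fin_num_integrable => //; [exact: measurable_funTS|rewrite Dfin].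
pose b x := dot (tau1 x) (pwevalV (grad v) x) + pweval q x * pweval v x.
have ib : leb.-integrable Om (EFin \o b) := iO (bounded_measurable_variation GammaD Om_dom M_mesh k W_C1 v q v).
rewrite (@eq_integral_ae _ _ _ leb Om _ (fun x => (b x)%:E - d x)%E)//; last first.
  apply: filterS2 (filterI dE q_der.2) (filterI psi_plc psiC1) => x [dx qx] [plc c1] Ox.
  have [_ _ cvx] := plc Ox; have [ff _ _] := c1 Ox.
  rewrite conjugate_gradient -qx// conjugate_derivative//; last exact: c1.
  rewrite -dx// /energy_density /b qx//.
  move: (fineK (ff (pweval v x))) => <-.
  by rewrite -!EFinB -!EFinD; congr EFin; ring.
rewrite integralB// Dfin -EFin_Rintegral//.
(* The Euler-Lagrange equation tested with v itself. With 1/r + 1/r' = 1 the stabilization terms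
   then cancel. *)
have bE : \int[leb]_(x in Om) b x = - s_h GammaD r s v v.
  by have := variation_minimizer Pv; rewrite /variation -/b => /eqP; rewrite addr_eq0 => /eqP.
rewrite bE -?(EFinB, EFinN, EFinM); congr EFin.
have -> : (conj_exp r)^-1 = 1 - r^-1 by rewrite -(conj_exp_inv r_gt1) addrAC subrr add0r.
by ring.
Qed.

Lemma dual_attained : exists2 t, Y Om GammaD M p t &
  E_h_dual Om GammaD M k r s W psi t = mv%:E.
Proof. by exists tau; [exact: optimal_in_Y|exact: optimal_energy]. Qed.

End strong_duality.

Theorem theorem3p2 (R : realType) (n : nat) (Om GammaD : set 'rV[R]_n)
    (M : mesh R n) (k : nat) (p r s : R)
    (W : 'rV[R]_n -> R) (psi : 'rV[R]_n -> R -> \bar R) (m : R)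
    (n_gt1 : (1 < n)%N)
    (Om_domain : polyhedral_lipschitz_domain Om)
    (M_mesh : is_mesh M Om)
    (GammaD_boundary : dirichlet_boundary M Om GammaD)
    (k_ge1 : (1 <= k)%N) (p_gt1 : 1 < p) (r_gt1 : 1 < r)
    (W_continuous : continuous W)
    (W_convex : convex_function [set: 'rV[R]_n] W)
    (psi_neq_ninfty : forall x u, Om x -> psi x u != -oo%E)
    (psi_meas : psi_measurable Om psi)
    (psi_plc : psi_proper_lsc_convex Om psi)
    (E_well_defined : E_h_well_defined Om GammaD M k W psi)
    (E_min : is_min (P_ k) (E_h Om GammaD M k r s W psi) m%:E) :
  (ereal_sup [set E_h_dual Om GammaD M k r s W psi tau | tau in Y Om GammaD M p]
     <= m%:E)%E /\
  (C1_rV W -> psi_C1 Om psi -> psi_derivative_pwpoly Om M k psi ->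
   is_max (Y Om GammaD M p) (E_h_dual Om GammaD M k r s W psi) m%:E).
Proof.
(* In dimension at least two the faces have dimension at least one, and so positive diameter. *)
case: n => [|[|n]]// in Om GammaD M W psi n_gt1 Om_domain M_mesh GammaD_boundary
  W_continuous W_convex psi_neq_ninfty psi_meas psi_plc E_well_defined E_min *.
have [[v Pv Ev] v_min] := E_min.
have weak tau : Y Om GammaD M p tau ->
    (E_h_dual Om GammaD M k r s W psi tau <= m%:E)%E.
  exact: (weak_duality Om_domain M_mesh GammaD_boundary k_ge1 p_gt1 r_gt1
    W_continuous psi_meas Pv Ev).
split; first by apply: ge_ereal_sup => _ [tau Yt <-]; exact: weak.
move=> W_C1 psiC1 psi_pw; split; last exact: weak.
have [q Pq qv] := psi_pw v Pv.
exact: (dual_attained Om_domain M_mesh GammaD_boundary k_ge1 p_gt1 r_gt1 W_convex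
  W_C1 psi_meas psi_plc psiC1 psi_pw Pv Ev v_min (conj Pq qv)).
Qed.
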